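(* Let $s,u,t,v\in\mathbb C^\times$, $\lambda,\varepsilon\in\mathbb R$, $x,y\in\mathbb C^\times$ with $0<|ux|,|u/x|,|vy|,|v/y|\le q^2$ and $0<|s/u|,|t/v|\le q$. Put $$(a,b,c,d,\kappa)=(sq^{1-2i\lambda},sq^{1+2i\lambda},tvq/u,qv/ut,q^{-1-2\varepsilon+2i\lambda}),\qquad \tilde a=\sqrt{abcd/q^2}=svq/u.$$ Then (for parameters for which all expressions are defined) $$\sum_{n\in\mathbb Z}{}_2\varphi_1\!\left({ax,a/x\atop ab};q^2,\kappa q^{2-2n}\right){}_2\varphi_1\!\left({bcy/\tilde a,\,bc/y\tilde a\atop cq^2/d};q^2,\frac{q^{2n}}{\kappa}\right)\left(\frac{q^2}{ad}\right)^n$$ $$=\frac{(q^2,ac,bcy^{\pm1}/\tilde a;q^2)_\infty\,\theta(ad\kappa;q^2)}{(q^2/ad,cq^2/d,\tilde ay^{\pm1};q^2)_\infty\,\theta(1/\kappa;q^2)}\,{}_4\varphi_3\!\left({ax,a/x,\tilde ay,\tilde a/y\atop ab,ac,ad};q^2,q^2\right)$$ $$+\frac{(q^2,q^2b/d,ax^{\pm1};q^2)_\infty\,\theta(ad\kappa;q^2)}{(ab,ad/q^2,q^2x^{\pm1}/d;q^2)_\infty\,\theta(1/\kappa;q^2)}\,{}_4\varphi_3\!\left({q^2x/d,q^2/dx,bcy/\tilde a,bc/y\tilde a\atop q^2b/d,q^2c/d,q^4/ad};q^2,q^2\right).$$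
   Context: Fix $q\in(0,1)$. $(x;q)_\infty=\prod_{k\ge0}(1-xq^k)$, $\theta(x;q)=(x;q)_\infty(q/x;q)_\infty$; several arguments mean products, and $\pm$ in exponents means the product over both signs. ${}_2\varphi_1$ and ${}_4\varphi_3$ are the standard basic hypergeometric series, with ${}_2\varphi_1$ denoting its (single-valued) analytic continuation in the argument. *)

(* Defs.v *)
From Stdlib Require Import Reals ZArith List ClassicalEpsilon.
From Coquelicot Require Import Coquelicot.
Import ListNotations.
Local Open Scope C_scope.

(* As with Coquelicot's [Lim_seq] and [Series], these are total: the value is
   the limit (sum) in [C] when it exists, and is not meaningful otherwise. *)
Definition CLim_seq (u : nat -> C) : C :=
  (real (Lim_seq (fun n => Re (u n))), real (Lim_seq (fun n => Im (u n)))).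

Definition CSeries (u : nat -> C) : C :=
  (Series (fun n => Re (u n)), Series (fun n => Im (u n))).

(* q ^ z = exp (z ln q), for a real base q > 0 and a complex exponent z. *)
Definition RCpower (q : R) (z : C) : C :=
  (exp (Re z * ln q) * cos (Im z * ln q),
   exp (Re z * ln q) * sin (Im z * ln q))%R.

Definition CpowerZ (z : C) (n : Z) : C :=
  match n with
  | Z0 => 1
  | Zpos k => z ^ Pos.to_nat k
  | Zneg k => / z ^ Pos.to_nat k
  end.

(* Both one-sided series (n >= 0 and n < 0) converge, with total sum S. *)
Definition is_sumZ (f : Z -> C) (S : C) : Prop :=
  exists S1 S2 : C,
    @is_series C_AbsRing C_NormedModule (fun n => f (Z.of_nat n)) S1 /\
    @is_series C_AbsRing C_NormedModule (fun n => f (- Z.of_nat (n + 1))%Z) S2 /\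
    S = S1 + S2.

Fixpoint qpoch (x p : C) (n : nat) : C :=
  match n with
  | O => 1
  | S m => qpoch x p m * (1 - x * p ^ m)
  end.

Definition qpoch_inf (x p : C) : C := CLim_seq (qpoch x p).

Definition qpochs (l : list C) (p : C) (n : nat) : C :=
  fold_right (fun x r => qpoch x p n * r) 1 l.

Definition qpochs_inf (l : list C) (p : C) : C :=
  fold_right (fun x r => qpoch_inf x p * r) 1 l.

Definition theta (x p : C) : C := qpoch_inf x p * qpoch_inf (p / x) p.

(* The series {r+1}_phi_r (A; B; p, z), for which length A = length B + 1: the
   factor ((-1)^n p^(n(n-1)/2))^(1+s-r) of a general r_phi_s is then 1. *)
Definition bhyp_term (A B : list C) (p z : C) (n : nat) : C :=
  qpochs A p n / qpochs (p :: B) p n * z ^ n.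

Definition bhyp (A B : list C) (p z : C) : C := CSeries (bhyp_term A B p z).

Definition lower_ok (B : list C) (p : C) : Prop :=
  forall b : C, In b B -> forall k : nat, b * p ^ k <> 1.

Definition analytic_at (f : C -> C) (w : C) : Prop :=
  exists (r : R) (a : nat -> C), (0 < r)%R /\
    forall z : C, (Cmod (z - w) < r)%R ->
      @is_series C_AbsRing C_NormedModule (fun n => a n * (z - w) ^ n) (f z).

(* For 0 < |p| < 1 the domain of the single-valued continuation of 2phi1 in its
   argument is C minus the (possible) poles p^(-k), k >= 0. *)
Definition phi21_regular (p z : C) : Prop := forall k : nat, z * p ^ k <> 1.

Definition is_phi21_continuation (A B D p : C) (f : C -> C) : Prop :=
  (forall w : C, phi21_regular p w -> analytic_at f w) /\
  (forall z : C, (Cmod z < 1)%R -> f z = bhyp [A; B] [D] p z).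

(* The analytic continuation of z |-> 2phi1 (A, B; D; p, z); it is determined
   at all z satisfying [phi21_regular p z], since this set is connected. *)
Definition phi21 (A B D p : C) : C -> C :=
  epsilon (inhabits (fun _ : C => RtoC 0)) (is_phi21_continuation A B D p).

Definition phi43 (A1 A2 A3 A4 B1 B2 B3 p z : C) : C :=
  bhyp [A1; A2; A3; A4] [B1; B2; B3] p z.

(* Main.v *)
Require Import Defs.
From Stdlib Require Import Reals ZArith List.
From Stdlib Require Import Lra Lia Permutation ClassicalEpsilon FunctionalExtensionality.
From Coquelicot Require Import Coquelicot.
Import ListNotations.
Local Open Scope C_scope.

(** The base is p = q^2; put zeta = p/(ad) and X = 1/kappa, so that the series
    is the sum over all integers n of F(p^(1-n)/X) G(X p^n) zeta^n, where F and
    G are the two continued 2phi1.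

    A 2phi1 with upper entries A, B in the unit disc and lower entry D is a sum
    of simple fractions.  Its coefficient of z^n is H(p^n), where
      H(w) = c (pw)_oo (Dw)_oo / ((Aw)_oo (Bw)_oo).
    By the q-binomial theorem H(w) = sum_k g_k w^|k|, with k running over pairs
    of natural numbers and |k| the sum of the pair, in a disc of radius larger
    than 1.  Summing over n,
      2phi1(z) = sum_k g_k / (1 - z p^|k|)          for |z| < 1;
    the right-hand side is analytic off the points p^(-j), so it is the
    continuation ([phi21_partial_fractions]; uniqueness is
    [continuation_unique]).

    Let g, H1 belong to F and h, H2 to G.  The terms k of F and l of G
    contribute a product of two simple fractions in X p^n, which is a
    difference of two simple fractions divided by 1 - p^(|k|+|l|+1)
    ([kernel_split]).  Multiply the bilateral series by the theta series
    sum_n (-1)^n p^(n(n-1)/2) zeta^n.  The coefficient of zeta^r then only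
    involves the sums sum_n (-1)^(r-n) p^((r-n)(r-n-1)/2) / (1 - X p^n), which
    equal (-1)^r p^(r(r-1)/2) X^r (p)_oo^2 / theta(X)  ([theta_recip_eq],
    [theta_recip_0]).  Hence the sum over r is again a theta series, at X zeta,
    and what is left is the double sum of
      g_k h_l (zeta^(-|l|) - zeta^(|k|+1)) / (1 - p^(|k|+|l|+1)).
    A geometric expansion of the denominator turns it into
      sum_m p^m (H1(p^m) H2(p^m/zeta) - zeta H1(zeta p^m) H2(p^m))
    ([bilateral_sum]), and the two parts of this sum are the two 4phi3, while
    the triple product identity gives the prefactors.

    The factor theta(zeta) is what makes the interchanges legitimate: the
    triple sum over n, k, l converges absolutely only for |p| < |zeta| < 1/|p|,
    but multiplied by the rapidly decreasing theta coefficients it does so for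
    all zeta.  Absolute convergence of the bilateral series itself comes from
    H(p^(-j)) = 0 for j >= 1: these vanishing moments of the g_k make
    2phi1(c p^(-n)) decay like rho^n for every rho > max(|A|, |B|)
    ([partial_fractions_decay]). *)

(** * Unordered summation *)

Fixpoint lsum {I : Type} (f : I -> C) (L : list I) : C :=
  match L with nil => 0 | i :: L' => f i + lsum f L' end.

Fixpoint rsum {I : Type} (b : I -> R) (L : list I) : R :=
  match L with nil => 0%R | i :: L' => (b i + rsum b L')%R end.

(** Convergence along the finite subsets of an arbitrary index type: the proof
    interchanges sums over integers, pairs and pairs of pairs, and this notion is
    invariant under every reindexing. *)
Definition has_sum {I : Type} (f : I -> C) (S : C) : Prop :=
  forall eps : R, (0 < eps)%R -> exists L : list I,
    forall L', NoDup L' -> incl L L' -> (Cmod (lsum f L' - S) < eps)%R.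

Definition bounded_sums {I : Type} (b : I -> R) : Prop :=
  exists M : R, forall L, NoDup L -> (rsum b L <= M)%R.

Definition abs_summable {I : Type} (f : I -> C) : Prop := bounded_sums (fun i => Cmod (f i)).

Definition tsum {I : Type} (f : I -> C) : C := epsilon (inhabits (RtoC 0)) (has_sum f).

Definition clim (u : nat -> C) (l : C) : Prop :=
  forall eps : R, (0 < eps)%R -> exists N : nat, forall n, (N <= n)%nat ->
    (Cmod (u n - l) < eps)%R.

Definition classic_eq_dec {I : Type} (x y : I) : {x = y} + {x <> y} :=
  excluded_middle_informative (x = y).

Lemma lsum_app {I : Type} (f : I -> C) L1 L2 : lsum f (L1 ++ L2) = lsum f L1 + lsum f L2.
Proof. induction L1; simpl; [|rewrite IHL1]; ring. Qed.

Lemma rsum_app {I : Type} (f : I -> R) L1 L2 :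
  rsum f (L1 ++ L2) = (rsum f L1 + rsum f L2)%R.
Proof. induction L1; simpl; [|rewrite IHL1]; ring. Qed.

Lemma lsum_perm {I : Type} (f : I -> C) L1 L2 : Permutation L1 L2 -> lsum f L1 = lsum f L2.
Proof. induction 1; simpl; try congruence; ring. Qed.

Lemma rsum_perm {I : Type} (f : I -> R) L1 L2 : Permutation L1 L2 -> rsum f L1 = rsum f L2.
Proof. induction 1; simpl; try congruence; ring. Qed.

Lemma lsum_ext_in {I : Type} (f g : I -> C) L :
  (forall i, In i L -> f i = g i) -> lsum f L = lsum g L.
Proof.
  induction L as [|a L IH]; simpl; intros H; [easy|].
  rewrite (H a), IH; auto.
Qed.

Lemma lsum_plus {I : Type} (f g : I -> C) L :
  lsum (fun i => f i + g i) L = lsum f L + lsum g L.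
Proof. induction L; simpl; [|rewrite IHL]; ring. Qed.

Lemma lsum_scal {I : Type} (c : C) (f : I -> C) L :
  lsum (fun i => c * f i) L = c * lsum f L.
Proof. induction L; simpl; [|rewrite IHL]; ring. Qed.

Lemma lsum_map {I J : Type} (f : I -> C) (g : J -> I) L :
  lsum f (map g L) = lsum (fun j => f (g j)) L.
Proof. induction L; simpl; congruence. Qed.

Lemma rsum_map {I J : Type} (f : I -> R) (g : J -> I) L :
  rsum f (map g L) = rsum (fun j => f (g j)) L.
Proof. induction L; simpl; congruence. Qed.

Lemma rsum_le {I : Type} (f g : I -> R) L :
  (forall i, In i L -> (f i <= g i)%R) -> (rsum f L <= rsum g L)%R.
Proof.
  induction L as [|a L IH]; simpl; intros H; [lra|].
  apply Rplus_le_compat; auto.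
Qed.

Lemma rsum_nonneg {I : Type} (f : I -> R) L :
  (forall i, (0 <= f i)%R) -> (0 <= rsum f L)%R.
Proof. intros H; induction L; simpl; [lra|]. specialize (H a); lra. Qed.

Lemma rsum_scal {I : Type} (c : R) (f : I -> R) L :
  rsum (fun i => c * f i)%R L = (c * rsum f L)%R.
Proof. induction L; simpl; [|rewrite IHL]; ring. Qed.

Lemma rsum_plus {I : Type} (f g : I -> R) L :
  rsum (fun i => f i + g i)%R L = (rsum f L + rsum g L)%R.
Proof. induction L; simpl; [|rewrite IHL]; ring. Qed.

Lemma rsum_const {I : Type} (c : R) (L : list I) :
  rsum (fun _ => c) L = (INR (length L) * c)%R.
Proof.
  induction L; simpl rsum; simpl length; [simpl; ring|]. rewrite IHL, S_INR; ring.
Qed.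

Lemma lsum_Cmod {I : Type} (f : I -> C) L :
  (Cmod (lsum f L) <= rsum (fun i => Cmod (f i)) L)%R.
Proof.
  induction L; simpl; [rewrite Cmod_0; lra|].
  eapply Rle_trans; [apply Cmod_triangle|lra].
Qed.

Lemma lsum_RtoC {I : Type} (b : I -> R) L :
  lsum (fun i => RtoC (b i)) L = RtoC (rsum b L).
Proof. induction L; simpl; [easy|]. rewrite IHL, RtoC_plus; easy. Qed.

Lemma incl_perm {I : Type} (L L' : list I) :
  NoDup L -> incl L L' -> exists K, Permutation L' (L ++ K).
Proof.
  revert L'; induction L as [|a L IH]; intros L' ND Hi.
  - exists L'; reflexivity.
  - inversion ND; subst.
    destruct (in_split a L') as (l1 & l2 & ->); [apply Hi; left; easy|].
    destruct (IH (l1 ++ l2)) as [K HK]; [easy| |].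
    + intros z Hz. assert (In z (l1 ++ a :: l2)) by (apply Hi; right; easy).
      rewrite in_app_iff in *; simpl in *. intuition; subst; easy.
    + exists K. simpl. rewrite <- HK. symmetry; apply Permutation_middle.
Qed.

Lemma rsum_incl {I : Type} (b : I -> R) L L' :
  (forall i, (0 <= b i)%R) -> NoDup L -> incl L L' -> (rsum b L <= rsum b L')%R.
Proof.
  intros Hb ND Hi. destruct (incl_perm L L' ND Hi) as [K HK].
  rewrite (rsum_perm _ _ _ HK), rsum_app.
  pose proof (rsum_nonneg b K Hb); lra.
Qed.

Definition list_union {I : Type} (L1 L2 : list I) := nodup classic_eq_dec (L1 ++ L2).

Lemma list_union_NoDup {I : Type} (L1 L2 : list I) : NoDup (list_union L1 L2).
Proof. apply NoDup_nodup. Qed.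

Lemma list_union_l {I : Type} (L1 L2 : list I) : incl L1 (list_union L1 L2).
Proof. intros z Hz; apply nodup_In, in_app_iff; auto. Qed.

Lemma list_union_r {I : Type} (L1 L2 : list I) : incl L2 (list_union L1 L2).
Proof. intros z Hz; apply nodup_In, in_app_iff; auto. Qed.

Lemma Cmod_small_eq (x y : C) :
  (forall eps : R, (0 < eps)%R -> (Cmod (x - y) < eps)%R) -> x = y.
Proof.
  intros H. destruct (Req_dec (Cmod (x - y)) 0) as [E|E].
  - apply Cmod_eq_0 in E. replace x with (x - y + y) by ring. rewrite E; ring.
  - pose proof (Cmod_ge_0 (x - y)). specialize (H (Cmod (x - y))). lra.
Qed.

Lemma Cmod_minus_sym (x y : C) : Cmod (x - y) = Cmod (y - x).
Proof. rewrite <- Cmod_opp. f_equal; ring. Qed.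

Lemma Cmod_dist3 (x y z : C) : (Cmod (x - z) <= Cmod (x - y) + Cmod (y - z))%R.
Proof. replace (x - z) with ((x - y) + (y - z)) by ring. apply Cmod_triangle. Qed.

Lemma has_sum_unique {I : Type} (f : I -> C) S1 S2 : has_sum f S1 -> has_sum f S2 -> S1 = S2.
Proof.
  intros H1 H2. apply Cmod_small_eq; intros eps He.
  destruct (H1 (eps / 2)%R) as [L1 K1]; [lra|].
  destruct (H2 (eps / 2)%R) as [L2 K2]; [lra|].
  specialize (K1 _ (list_union_NoDup L1 L2) (list_union_l L1 L2)).
  specialize (K2 _ (list_union_NoDup L1 L2) (list_union_r L1 L2)).
  eapply Rle_lt_trans; [apply (Cmod_dist3 _ (lsum f (list_union L1 L2)))|].
  rewrite Cmod_minus_sym in K1. lra.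
Qed.

Lemma has_sum_ext {I : Type} (f g : I -> C) S : (forall i, f i = g i) -> has_sum f S -> has_sum g S.
Proof. intros H; replace g with f; [easy|]. apply functional_extensionality, H. Qed.

Lemma tsum_ext {I : Type} (f g : I -> C) : (forall i, f i = g i) -> tsum f = tsum g.
Proof. intros H; f_equal. apply functional_extensionality, H. Qed.

Lemma tsum_unique {I : Type} (f : I -> C) S : has_sum f S -> tsum f = S.
Proof.
  intros H. apply (has_sum_unique f); [|easy].
  apply (epsilon_spec (inhabits (RtoC 0)) (has_sum f)). exists S; easy.
Qed.

Lemma has_sum_plus {I : Type} (f g : I -> C) S T :
  has_sum f S -> has_sum g T -> has_sum (fun i => f i + g i) (S + T).
Proof.
  intros H1 H2 eps He.
  destruct (H1 (eps / 2)%R) as [L1 K1]; [lra|].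
  destruct (H2 (eps / 2)%R) as [L2 K2]; [lra|].
  exists (L1 ++ L2). intros L' ND Hi.
  rewrite lsum_plus.
  replace (lsum f L' + lsum g L' - (S + T)) with ((lsum f L' - S) + (lsum g L' - T)) by ring.
  eapply Rle_lt_trans; [apply Cmod_triangle|].
  specialize (K1 L' ND). specialize (K2 L' ND).
  assert (incl L1 L') by (intros z Hz; apply Hi, in_app_iff; auto).
  assert (incl L2 L') by (intros z Hz; apply Hi, in_app_iff; auto).
  specialize (K1 H). specialize (K2 H0). lra.
Qed.

Lemma has_sum_scal {I : Type} (c : C) (f : I -> C) S :
  has_sum f S -> has_sum (fun i => c * f i) (c * S).
Proof.
  intros H eps He. pose proof (Cmod_ge_0 c) as Hc.
  destruct (H (eps / (Cmod c + 1))%R) as [L K]; [apply Rdiv_lt_0_compat; lra|].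
  exists L. intros L' ND Hi. rewrite lsum_scal.
  replace (c * lsum f L' - c * S) with (c * (lsum f L' - S)) by ring.
  rewrite Cmod_mult. specialize (K L' ND Hi).
  apply Rle_lt_trans with (Cmod c * (eps / (Cmod c + 1)))%R.
  - apply Rmult_le_compat_l; lra.
  - replace (Cmod c * (eps / (Cmod c + 1)))%R with (eps - eps / (Cmod c + 1))%R by (field; lra).
    assert (0 < eps / (Cmod c + 1))%R by (apply Rdiv_lt_0_compat; lra). lra.
Qed.

Lemma bounded_sums_le {I : Type} (b b' : I -> R) :
  (forall i, (b i <= b' i)%R) -> bounded_sums b' -> bounded_sums b.
Proof.
  intros H [M HM]; exists M; intros L ND.
  eapply Rle_trans; [|apply (HM L ND)]. apply rsum_le; auto.
Qed.

Lemma bounded_sums_scal {I : Type} (c : R) (b : I -> R) :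
  (0 <= c)%R -> bounded_sums b -> bounded_sums (fun i => c * b i)%R.
Proof.
  intros Hc [M HM]; exists (c * M)%R; intros L ND.
  rewrite rsum_scal. apply Rmult_le_compat_l; auto.
Qed.

Lemma bounded_sums_plus {I : Type} (a b : I -> R) :
  bounded_sums a -> bounded_sums b -> bounded_sums (fun i => a i + b i)%R.
Proof.
  intros [M HM] [N HN]; exists (M + N)%R; intros L ND.
  rewrite rsum_plus. apply Rplus_le_compat; auto.
Qed.

Lemma bounded_sums_sup {I : Type} (b : I -> R) : bounded_sums b ->
  exists S : R, (forall L, NoDup L -> (rsum b L <= S)%R) /\
    forall eps, (0 < eps)%R -> exists L, NoDup L /\ (S - eps < rsum b L)%R.
Proof.
  intros [M HM].
  destruct (completeness (fun r => exists L, NoDup L /\ r = rsum b L)) as [S [H1 H2]].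
  - exists M. intros r (L & ND & ->); auto.
  - exists 0%R, nil. split; [constructor|easy].
  - exists S; split.
    + intros L ND. apply H1. exists L; auto.
    + intros eps He. apply NNPP; intros Hn.
      assert (S <= S - eps)%R; [|lra]. apply H2. intros r (L & ND & ->).
      destruct (Rle_or_lt (rsum b L) (S - eps)); [easy|]. exfalso; apply Hn; exists L; auto.
Qed.

Lemma has_sum_nonneg {I : Type} (b : I -> R) : (forall i, (0 <= b i)%R) -> bounded_sums b ->
  exists S : R, has_sum (fun i => RtoC (b i)) (RtoC S).
Proof.
  intros Hb Hs. destruct (bounded_sums_sup b Hs) as (S & H1 & H2). exists S.
  intros eps He. destruct (H2 eps He) as (L & ND & HL). exists L. intros L' ND' Hi.
  rewrite lsum_RtoC, <- RtoC_minus, Cmod_R.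
  pose proof (rsum_incl b L L' Hb ND Hi). pose proof (H1 L' ND').
  rewrite Rabs_left1; lra.
Qed.

(** |f|, |f| + Re f and |f| + Im f are nonnegative with bounded finite sums, and
    f is a linear combination of them; a nonnegative family sums to its supremum. *)
Lemma abs_summable_has_sum {I : Type} (f : I -> C) : abs_summable f -> exists S, has_sum f S.
Proof.
  intros H. pose proof H as H0.
  assert (Habs : forall i, (Rabs (Re (f i)) <= Cmod (f i) /\ Rabs (Im (f i)) <= Cmod (f i))%R).
  { intros i. pose proof (Rmax_Cmod (f i)). pose proof (Rmax_l (Rabs (fst (f i))) (Rabs (snd (f i)))).
    pose proof (Rmax_r (Rabs (fst (f i))) (Rabs (snd (f i)))). unfold Re, Im. lra. }
  destruct (has_sum_nonneg (fun i => Cmod (f i))) as [S3 H3]; [intros; apply Cmod_ge_0|easy|].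
  destruct (has_sum_nonneg (fun i => Cmod (f i) + Re (f i))%R) as [S1 H1].
  { intros i. destruct (Habs i). unfold Rabs in *; destruct (Rcase_abs (Re (f i))); lra. }
  { apply (bounded_sums_le _ (fun i => 2 * Cmod (f i))%R); [|apply bounded_sums_scal; [lra|easy]].
    intros i. destruct (Habs i). pose proof (Rle_abs (Re (f i))). lra. }
  destruct (has_sum_nonneg (fun i => Cmod (f i) + Im (f i))%R) as [S2 H2].
  { intros i. destruct (Habs i). unfold Rabs in *; destruct (Rcase_abs (Im (f i))); lra. }
  { apply (bounded_sums_le _ (fun i => 2 * Cmod (f i))%R); [|apply bounded_sums_scal; [lra|easy]].
    intros i. destruct (Habs i). pose proof (Rle_abs (Im (f i))). lra. }
  exists ((S1 + (-(1)) * S3) + Ci * (S2 + (-(1)) * S3)).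
  eapply has_sum_ext; [|apply has_sum_plus; [apply has_sum_plus; [apply H1|apply has_sum_scal, H3]|
    apply has_sum_scal, has_sum_plus; [apply H2|apply has_sum_scal, H3]]].
  intros i. simpl. apply injective_projections; simpl; unfold Re, Im; ring.
Qed.

Lemma tsum_has_sum {I : Type} (f : I -> C) : abs_summable f -> has_sum f (tsum f).
Proof. intros H. destruct (abs_summable_has_sum f H) as [S HS]. rewrite (tsum_unique f S HS); easy. Qed.

Lemma has_sum_norm {I : Type} (f : I -> C) S M :
  has_sum f S -> (forall L, NoDup L -> (rsum (fun i => Cmod (f i)) L <= M)%R) -> (Cmod S <= M)%R.
Proof.
  intros H HM. apply Rnot_lt_le; intros Hlt.
  destruct (H (Cmod S - M)%R) as [L K]; [lra|].
  specialize (K _ (list_union_NoDup L L) (list_union_l L L)).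
  specialize (HM _ (list_union_NoDup L L)).
  pose proof (lsum_Cmod f (list_union L L)).
  assert (Cmod S <= Cmod (lsum f (list_union L L) - S) + Cmod (lsum f (list_union L L)))%R; [|lra].
  rewrite Cmod_minus_sym.
  replace S with (S - lsum f (list_union L L) + lsum f (list_union L L)) at 1 by ring.
  apply Cmod_triangle.
Qed.

Lemma has_sum_finite {I : Type} (f : I -> C) L :
  NoDup L -> (forall i, ~ In i L -> f i = 0) -> has_sum f (lsum f L).
Proof.
  intros ND H eps He. exists L. intros L' ND' Hi.
  destruct (incl_perm L L' ND Hi) as [K HK].
  rewrite (lsum_perm _ _ _ HK), lsum_app.
  assert (E : lsum f K = 0).
  { assert (HN : NoDup (L ++ K)) by (eapply Permutation_NoDup; eauto).
    rewrite (lsum_ext_in f (fun _ => 0 * 0)).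
    - rewrite lsum_scal; ring.
    - intros i Hi'. rewrite H; [ring|]. intros HiL.
      clear - HN Hi' HiL. induction L; simpl in *; [easy|].
      inversion HN; subst. destruct HiL as [->|]; auto. apply H1, in_app_iff; auto. }
  rewrite E. replace (lsum f L + 0 - lsum f L) with (RtoC 0) by ring.
  rewrite Cmod_0; easy.
Qed.

Lemma has_sum_bij {I J : Type} (f : I -> C) (phi : J -> I) (psi : I -> J) S :
  (forall j, psi (phi j) = j) -> (forall i, phi (psi i) = i) ->
  has_sum f S -> has_sum (fun j => f (phi j)) S.
Proof.
  intros H1 H2 H eps He. destruct (H eps He) as [L K].
  exists (map psi L). intros L' ND Hi. rewrite <- lsum_map. apply K.
  - apply FinFun.Injective_map_NoDup; [|easy]. intros a b Hab. rewrite <- (H1 a), Hab; auto.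
  - intros i Hi'. rewrite <- (H2 i). apply in_map, Hi, in_map; easy.
Qed.

Lemma tsum_bij {I J : Type} (f : I -> C) (phi : J -> I) (psi : I -> J) :
  (forall j, psi (phi j) = j) -> (forall i, phi (psi i) = i) -> abs_summable f ->
  tsum (fun j => f (phi j)) = tsum f.
Proof. intros H1 H2 H. apply tsum_unique, (has_sum_bij f phi psi); auto. apply tsum_has_sum, H. Qed.

Lemma bounded_sums_inj {I J : Type} (b : I -> R) (phi : J -> I) :
  (forall j j', phi j = phi j' -> j = j') -> bounded_sums b -> bounded_sums (fun j => b (phi j)).
Proof.
  intros H [M HM]. exists M. intros L ND. rewrite <- rsum_map. apply HM.
  apply FinFun.Injective_map_NoDup; [|easy]. exact H.
Qed.

Lemma abs_summable_le {I : Type} (f : I -> C) (b : I -> R) :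
  bounded_sums b -> (forall i, (Cmod (f i) <= b i)%R) -> abs_summable f.
Proof. intros H1 H2; exact (bounded_sums_le _ _ H2 H1). Qed.

Lemma abs_summable_scal {I : Type} (c : C) (f : I -> C) : abs_summable f -> abs_summable (fun i => c * f i).
Proof.
  intros H. apply (abs_summable_le _ (fun i => Cmod c * Cmod (f i))%R).
  - apply bounded_sums_scal; [apply Cmod_ge_0|easy].
  - intros i. rewrite Cmod_mult; lra.
Qed.

Lemma abs_summable_plus {I : Type} (f g : I -> C) : abs_summable f -> abs_summable g -> abs_summable (fun i => f i + g i).
Proof.
  intros H1 H2. apply (abs_summable_le _ (fun i => Cmod (f i) + Cmod (g i))%R).
  - apply bounded_sums_plus; easy.
  - intros i. apply Cmod_triangle.
Qed.

Lemma tsum_scal {I : Type} (c : C) (f : I -> C) :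
  abs_summable f -> tsum (fun i => c * f i) = c * tsum f.
Proof. intros H. apply tsum_unique, has_sum_scal, tsum_has_sum, H. Qed.

Lemma tsum_plus {I : Type} (f g : I -> C) :
  abs_summable f -> abs_summable g -> tsum (fun i => f i + g i) = tsum f + tsum g.
Proof. intros H1 H2. apply tsum_unique, has_sum_plus; apply tsum_has_sum; easy. Qed.

Lemma rsum_list_prod {I J : Type} (b : I * J -> R) L K :
  rsum b (list_prod L K) = rsum (fun i => rsum (fun j => b (i, j)) K) L.
Proof.
  induction L; simpl; [easy|]. rewrite rsum_app, rsum_map, IHL. easy.
Qed.

(** A finite set of pairs lies in the product of its projections, so bounds on
    the rows that have bounded sums suffice. *)
Lemma bounded_sums_iter {I J : Type} (f : I * J -> R) (b : I -> R) :
  (forall x, (0 <= f x)%R) ->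
  (forall i K, NoDup K -> (rsum (fun j => f (i, j)) K <= b i)%R) ->
  bounded_sums b -> bounded_sums f.
Proof.
  intros Hf Hb [M HM]. exists M. intros L ND.
  set (L1 := nodup classic_eq_dec (map fst L)). set (L2 := nodup classic_eq_dec (map snd L)).
  apply Rle_trans with (rsum f (list_prod L1 L2)).
  - apply rsum_incl; auto. intros [i j] H. apply in_prod; apply nodup_In.
    + apply (in_map fst) in H; easy.
    + apply (in_map snd) in H; easy.
  - rewrite rsum_list_prod. eapply Rle_trans; [|apply (HM L1 (NoDup_nodup _ _))].
    apply rsum_le. intros i _. apply Hb, NoDup_nodup.
Qed.

Lemma bounded_sums_pair {I J : Type} (a : I -> R) (b : J -> R) :
  (forall i, (0 <= a i)%R) -> (forall j, (0 <= b j)%R) -> bounded_sums a -> bounded_sums b ->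
  bounded_sums (fun x : I * J => a (fst x) * b (snd x))%R.
Proof.
  intros Ha Hb H [M HM].
  apply (bounded_sums_iter _ (fun i => M * a i)%R).
  - intros x. apply Rmult_le_pos; auto.
  - intros i K ND. simpl. rewrite rsum_scal.
    rewrite Rmult_comm. apply Rmult_le_compat_r; auto.
  - apply bounded_sums_scal; [|easy]. apply (HM nil); constructor.
Qed.

Lemma abs_summable_pair {I J : Type} (f : I -> C) (g : J -> C) :
  abs_summable f -> abs_summable g -> abs_summable (fun x : I * J => f (fst x) * g (snd x)).
Proof.
  intros H1 H2. apply (abs_summable_le _ (fun x => Cmod (f (fst x)) * Cmod (g (snd x)))%R).
  - apply (bounded_sums_pair (fun i => Cmod (f i)) (fun i => Cmod (g i))); auto; intros; apply Cmod_ge_0.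
  - intros x. rewrite Cmod_mult; lra.
Qed.

Lemma lsum_list_dep {I J : Type} (f : I * J -> C) (K : I -> list J) L :
  lsum f (flat_map (fun i => map (fun j => (i, j)) (K i)) L)
  = lsum (fun i => lsum (fun j => f (i, j)) (K i)) L.
Proof. induction L; simpl; [easy|]. rewrite lsum_app, lsum_map, IHL. easy. Qed.

Lemma NoDup_list_dep {I J : Type} (K : I -> list J) L :
  NoDup L -> (forall i, NoDup (K i)) -> NoDup (flat_map (fun i => map (fun j => (i, j)) (K i)) L).
Proof.
  intros ND HK. induction L as [|a L IH]; simpl; [constructor|].
  inversion ND; subst. apply NoDup_app; auto.
  - apply FinFun.Injective_map_NoDup; [|apply HK]. intros x y Hxy; congruence.
  - intros [i j] H H'. apply in_map_iff in H. destruct H as (j' & E & _). inversion E; subst.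
    apply in_flat_map in H'. destruct H' as (i' & Hi' & H'').
    apply in_map_iff in H''. destruct H'' as (j'' & E' & _). inversion E'; subst. easy.
Qed.

(** Fubini: replace each inner sum over the finite outer set by a finite sum
    that is exact up to an equal share of the error; together these finite sets
    form one finite set of pairs, which can be taken large. *)
Lemma has_sum_fubini {I J : Type} (f : I * J -> C) (s : I -> C) S :
  has_sum f S -> (forall i, has_sum (fun j => f (i, j)) (s i)) -> has_sum s S.
Proof.
  intros H Hs eps He.
  destruct (H (eps / 2)%R) as [L0 K0]; [lra|].
  exists (map fst L0). intros L' ND Hi.
  set (d := (eps / 2 / (INR (length L') + 1))%R).
  pose proof (pos_INR (length L')) as Hl.
  assert (Hd : (0 < d)%R) by (unfold d; apply Rdiv_lt_0_compat; lra).
  assert (HK : forall i, exists K, NoDup K /\ incl (map snd L0) K /\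
                (Cmod (lsum (fun j => f (i, j)) K - s i) < d)%R).
  { intros i. destruct (Hs i d Hd) as [Ki HKi]. exists (list_union Ki (map snd L0)). repeat split.
    - apply list_union_NoDup.
    - apply list_union_r.
    - apply HKi; [apply list_union_NoDup|apply list_union_l]. }
  set (K := fun i => epsilon (inhabits nil) (fun K => NoDup K /\ incl (map snd L0) K /\
                (Cmod (lsum (fun j => f (i, j)) K - s i) < d)%R)).
  assert (HK' : forall i, NoDup (K i) /\ incl (map snd L0) (K i) /\
                (Cmod (lsum (fun j => f (i, j)) (K i) - s i) < d)%R).
  { intros i. unfold K. apply epsilon_spec. apply HK. }
  clearbody K; clear HK.
  set (theta_recip := flat_map (fun i => map (fun j => (i, j)) (K i)) L').
  assert (H1 : (Cmod (lsum f theta_recip - S) < eps / 2)%R).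
  { apply K0.
    - apply NoDup_list_dep; auto. intros i; apply HK'.
    - intros [i j] Hij. apply in_flat_map. exists i. split.
      + apply Hi. apply (in_map fst) in Hij. easy.
      + apply in_map. apply HK'. apply (in_map snd) in Hij; easy. }
  assert (H2 : (Cmod (lsum s L' - lsum f theta_recip) <= INR (length L') * d)%R).
  { unfold theta_recip. rewrite lsum_list_dep.
    replace (lsum s L' - lsum (fun i => lsum (fun j => f (i, j)) (K i)) L')
      with (lsum (fun i => s i + (-(1)) * lsum (fun j => f (i, j)) (K i)) L')
      by (rewrite lsum_plus, lsum_scal; ring).
    eapply Rle_trans; [apply lsum_Cmod|]. rewrite <- rsum_const.
    apply rsum_le. intros i _. destruct (HK' i) as (_ & _ & Hc).
    rewrite Cmod_minus_sym in Hc.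
    replace (s i + (-(1)) * lsum (fun j : J => f (i, j)) (K i))
      with (s i - lsum (fun j : J => f (i, j)) (K i)) by ring. lra. }
  eapply Rle_lt_trans; [apply (Cmod_dist3 _ (lsum f theta_recip))|].
  assert (INR (length L') * d <= eps / 2)%R; [|lra].
  replace (eps / 2)%R with ((INR (length L') + 1) * d)%R by (unfold d; field; lra).
  apply Rmult_le_compat_r; lra.
Qed.

Lemma abs_summable_slice {I J : Type} (f : I * J -> C) i : abs_summable f -> abs_summable (fun j => f (i, j)).
Proof.
  intros H. unfold abs_summable. apply (bounded_sums_inj (fun x => Cmod (f x)) (fun j => (i, j))); [|easy].
  intros; congruence.
Qed.

Lemma tsum_fubini {I J : Type} (f : I * J -> C) :
  abs_summable f -> tsum (fun i => tsum (fun j => f (i, j))) = tsum f.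
Proof.
  intros H. apply tsum_unique. apply (has_sum_fubini f).
  - apply tsum_has_sum, H.
  - intros i. apply tsum_has_sum, abs_summable_slice, H.
Qed.

Definition swap {I J : Type} (x : I * J) : J * I := (snd x, fst x).

Lemma abs_summable_swap {I J : Type} (f : I * J -> C) : abs_summable f -> abs_summable (fun x => f (swap x)).
Proof.
  intros H. unfold abs_summable. apply (bounded_sums_inj (fun x => Cmod (f x)) swap); [|easy].
  intros [a b] [a' b'] E; inversion E; easy.
Qed.

Lemma tsum_swap {I J : Type} (f : I -> J -> C) :
  abs_summable (fun x => f (fst x) (snd x)) ->
  tsum (fun i => tsum (fun j => f i j)) = tsum (fun j => tsum (fun i => f i j)).
Proof.
  intros H. etransitivity; [apply (tsum_fubini (fun x => f (fst x) (snd x)) H)|].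
  etransitivity; [|symmetry; apply (tsum_fubini (fun x => f (snd x) (fst x)) (abs_summable_swap _ H))].
  symmetry. apply (tsum_bij (fun x => f (fst x) (snd x)) swap swap); try easy;
  intros [a b]; easy.
Qed.

Lemma tsum_pair {I J : Type} (f : I -> C) (g : J -> C) : abs_summable f -> abs_summable g ->
  tsum (fun x : I * J => f (fst x) * g (snd x)) = tsum f * tsum g.
Proof.
  intros H1 H2.
  rewrite <- (tsum_fubini (fun x : I * J => f (fst x) * g (snd x))) by (apply abs_summable_pair; easy).
  simpl. rewrite (tsum_ext _ (fun i => tsum g * f i)).
  - rewrite tsum_scal by easy; ring.
  - intros i. rewrite tsum_scal by easy; ring.
Qed.

Lemma tsum_norm {I : Type} (f : I -> C) (b : I -> R) M :
  (forall i, (Cmod (f i) <= b i)%R) -> (forall L, NoDup L -> (rsum b L <= M)%R) ->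
  (Cmod (tsum f) <= M)%R.
Proof.
  intros H HM. apply (has_sum_norm f).
  - apply tsum_has_sum. apply (abs_summable_le _ b); [exists M; exact HM|exact H].
  - intros L ND. eapply Rle_trans; [|apply (HM L ND)]. apply rsum_le; auto.
Qed.

Lemma bounded_sums_tail {I : Type} (b : I -> R) : bounded_sums b -> (forall i, (0 <= b i)%R) ->
  forall eps, (0 < eps)%R -> exists L, NoDup L /\
    forall K, NoDup K -> (forall i, In i K -> ~ In i L) -> (rsum b K <= eps)%R.
Proof.
  intros H Hb eps He. destruct (bounded_sums_sup b H) as (S & H1 & H2).
  destruct (H2 eps He) as (L & ND & HL). exists L; split; [easy|].
  intros K NK Hd. assert (HN : NoDup (K ++ L)) by (apply NoDup_app; auto).
  specialize (H1 _ HN). rewrite rsum_app in H1. lra.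
Qed.

Lemma tsum_tail {I : Type} (f : I -> C) (b : I -> R) L eps :
  bounded_sums b -> (forall i, (Cmod (f i) <= b i)%R) -> NoDup L ->
  (forall K, NoDup K -> (forall i, In i K -> ~ In i L) -> (rsum b K <= eps)%R) ->
  (Cmod (tsum f - lsum f L) <= eps)%R.
Proof.
  intros Hs Hf ND HL. apply Rnot_lt_le; intros Hlt.
  assert (H : has_sum f (tsum f)) by (apply tsum_has_sum, (abs_summable_le _ b); easy).
  destruct (H (Cmod (tsum f - lsum f L) - eps)%R) as [L1 K1]; [lra|].
  specialize (K1 _ (list_union_NoDup L L1) (list_union_r L L1)).
  destruct (incl_perm L (list_union L L1) ND (list_union_l L L1)) as [K HK].
  rewrite (lsum_perm _ _ _ HK), lsum_app in K1.
  assert (HN : NoDup (L ++ K)) by (eapply Permutation_NoDup; [apply HK|apply list_union_NoDup]).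
  assert (H2 : (rsum b K <= eps)%R).
  { apply HL; [eapply NoDup_app_remove_l, HN|]. intros i Hi HiL.
    clear - HN Hi HiL. induction L; simpl in *; [easy|].
    inversion HN; subst. destruct HiL as [->|]; auto. apply H1, in_app_iff; auto. }
  assert (H3 : (Cmod (lsum f K) <= eps)%R).
  { eapply Rle_trans; [apply lsum_Cmod|]. eapply Rle_trans; [|apply H2]. apply rsum_le; auto. }
  pose proof (Cmod_dist3 (tsum f) (lsum f L + lsum f K) (lsum f L)) as H4.
  rewrite (Cmod_minus_sym (tsum f) (lsum f L + lsum f K)) in H4.
  replace (lsum f L + lsum f K - lsum f L) with (lsum f K) in H4 by ring. lra.
Qed.

Lemma clim_plus u v l m : clim u l -> clim v m -> clim (fun n => u n + v n) (l + m).
Proof.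
  intros H1 H2 eps He. destruct (H1 (eps/2)%R) as [N1 K1]; [lra|].
  destruct (H2 (eps/2)%R) as [N2 K2]; [lra|]. exists (max N1 N2). intros n Hn.
  specialize (K1 n ltac:(lia)). specialize (K2 n ltac:(lia)).
  replace (u n + v n - (l + m)) with ((u n - l) + (v n - m)) by ring.
  eapply Rle_lt_trans; [apply Cmod_triangle|]; lra.
Qed.

Lemma clim_const c : clim (fun _ => c) c.
Proof. intros eps He. exists O. intros. replace (c - c) with (RtoC 0) by ring. rewrite Cmod_0; easy. Qed.

Lemma clim_ext u v l : (forall n, u n = v n) -> clim u l -> clim v l.
Proof. intros H; replace v with u; [easy|]. apply functional_extensionality, H. Qed.

Lemma clim_ext_ev u v l N : (forall n, (N <= n)%nat -> u n = v n) -> clim u l -> clim v l.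
Proof.
  intros H Hu eps He. destruct (Hu eps He) as [N' K]. exists (max N N'). intros n Hn.
  rewrite <- H by lia. apply K; lia.
Qed.

Lemma clim_unique u l m : clim u l -> clim u m -> l = m.
Proof.
  intros H1 H2. apply Cmod_small_eq; intros eps He.
  destruct (H1 (eps/2)%R) as [N1 K1]; [lra|]. destruct (H2 (eps/2)%R) as [N2 K2]; [lra|].
  specialize (K1 (max N1 N2) ltac:(lia)). specialize (K2 (max N1 N2) ltac:(lia)).
  eapply Rle_lt_trans; [apply (Cmod_dist3 _ (u (max N1 N2)))|].
  rewrite Cmod_minus_sym. lra.
Qed.

Lemma clim_bounded u l : clim u l -> exists M, (0 <= M)%R /\ forall n, (Cmod (u n) <= M)%R.
Proof.
  intros H. destruct (H 1%R) as [N HN]; [lra|].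
  assert (HB : exists M, (0 <= M)%R /\ forall n, (n < N)%nat -> (Cmod (u n) <= M)%R).
  { clear HN. induction N as [|N [M [HM IH]]]; [exists 0%R; split; [lra|lia]|].
    exists (Rmax M (Cmod (u N))). split; [eapply Rle_trans; [apply HM|apply Rmax_l]|].
    intros n Hn. destruct (Nat.eq_dec n N) as [->|]; [apply Rmax_r|].
    eapply Rle_trans; [apply IH; lia|apply Rmax_l]. }
  destruct HB as (M & HM & HB). pose proof (Cmod_ge_0 l) as Hl.
  exists (Rmax M (Cmod l + 1)). split; [eapply Rle_trans; [apply HM|apply Rmax_l]|].
  intros n. destruct (Nat.lt_ge_cases n N) as [Hn|Hn].
  - eapply Rle_trans; [apply HB, Hn|apply Rmax_l].
  - eapply Rle_trans; [|apply Rmax_r]. specialize (HN n Hn).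
    replace (u n) with ((u n - l) + l) by ring.
    eapply Rle_trans; [apply Cmod_triangle|]. lra.
Qed.

Lemma clim_mult u v l m : clim u l -> clim v m -> clim (fun n => u n * v n) (l * m).
Proof.
  intros H1 H2 eps He. destruct (clim_bounded u l H1) as (M & HM & HB).
  pose proof (Cmod_ge_0 m) as Hm.
  set (d := (eps / (M + Cmod m + 1))%R).
  assert (Hd : (0 < d)%R) by (apply Rdiv_lt_0_compat; lra).
  destruct (H1 d Hd) as [N1 K1]. destruct (H2 d Hd) as [N2 K2].
  exists (max N1 N2). intros n Hn.
  specialize (K1 n ltac:(lia)). specialize (K2 n ltac:(lia)).
  replace (u n * v n - l * m) with (u n * (v n - m) + (u n - l) * m) by ring.
  eapply Rle_lt_trans; [apply Cmod_triangle|]. rewrite !Cmod_mult.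
  apply Rle_lt_trans with (M * d + d * Cmod m)%R.
  - apply Rplus_le_compat; apply Rmult_le_compat; auto; try apply Cmod_ge_0; lra.
  - replace eps with ((M + Cmod m + 1) * d)%R by (unfold d; field; lra). nra.
Qed.

Lemma clim_inv (u : nat -> C) (l : C) : l <> 0 -> clim u l -> clim (fun n => / u n) (/ l).
Proof.
  intros Hl H eps He. pose proof (proj1 (Cmod_gt_0 l) Hl) as Hl'.
  destruct (H (Rmin (Cmod l / 2) (eps * Cmod l * Cmod l / 2))) as [N K].
  { apply Rmin_pos; [lra|]. assert (0 < eps * Cmod l * Cmod l)%R by
      (repeat apply Rmult_lt_0_compat; easy). lra. }
  exists N. intros n Hn. specialize (K n Hn).
  pose proof (Rmin_l (Cmod l / 2) (eps * Cmod l * Cmod l / 2)).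
  pose proof (Rmin_r (Cmod l / 2) (eps * Cmod l * Cmod l / 2)).
  assert (Hu : (Cmod l / 2 < Cmod (u n))%R).
  { pose proof (Cmod_triangle (l - u n) (u n)) as Ht.
    replace (l - u n + u n) with l in Ht by ring. rewrite Cmod_minus_sym in K. lra. }
  assert (u n <> 0) by (apply Cmod_gt_0; lra).
  replace (/ u n - / l) with ((l - u n) * (/ u n * / l)) by (field; auto).
  rewrite !Cmod_mult, !Cmod_inv by easy. rewrite Cmod_minus_sym.
  apply Rlt_le_trans with ((eps * Cmod l * Cmod l / 2) * (/ Cmod (u n) * / Cmod l))%R.
  - apply Rmult_lt_compat_r; [|lra]. apply Rmult_lt_0_compat; apply Rinv_0_lt_compat; lra.
  - replace ((eps * Cmod l * Cmod l / 2) * (/ Cmod (u n) * / Cmod l))%R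
      with (eps * ((Cmod l / 2) * / Cmod (u n)))%R by (field; split; lra).
    rewrite <- (Rmult_1_r eps) at 2. apply Rmult_le_compat_l; [lra|].
    apply Rmult_le_reg_r with (Cmod (u n)); [lra|]. rewrite Rmult_assoc, Rinv_l by lra. lra.
Qed.

Lemma clim_lsum {I : Type} (f : nat -> I -> C) (g : I -> C) L :
  (forall i, clim (fun N => f N i) (g i)) -> clim (fun N => lsum (f N) L) (lsum g L).
Proof.
  intros H. induction L; simpl; [apply clim_const|]. apply clim_plus; auto.
Qed.

(** Dominated convergence for series: outside a finite set all the sums are
    uniformly small, and on it the convergence is termwise. *)
Lemma tannery {I : Type} (f : nat -> I -> C) (g : I -> C) (b : I -> R) :
  bounded_sums b -> (forall N i, (Cmod (f N i) <= b i)%R) ->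
  (forall i, clim (fun N => f N i) (g i)) -> clim (fun N => tsum (f N)) (tsum g).
Proof.
  intros Hb Hf Hl.
  assert (Hg : forall i, (Cmod (g i) <= b i)%R).
  { intros i. apply Rnot_lt_le; intros Hlt.
    destruct (Hl i (Cmod (g i) - b i)%R) as [N HN]; [lra|].
    specialize (HN N (Nat.le_refl _)). specialize (Hf N i).
    pose proof (Cmod_triangle (g i - f N i) (f N i)) as Ht.
    replace (g i - f N i + f N i) with (g i) in Ht by ring.
    rewrite Cmod_minus_sym in HN. lra. }
  assert (Hb0 : forall i, (0 <= b i)%R).
  { intros i. eapply Rle_trans; [apply Cmod_ge_0|apply Hg]. }
  intros eps He. destruct (bounded_sums_tail b Hb Hb0 (eps / 3)%R) as (L & ND & HL); [lra|].
  destruct (clim_lsum f g L Hl (eps / 3)%R) as [N HN]; [lra|].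
  exists N. intros n Hn. specialize (HN n Hn).
  pose proof (tsum_tail (f n) b L _ Hb (Hf n) ND HL) as H1.
  pose proof (tsum_tail g b L _ Hb Hg ND HL) as H2.
  rewrite Cmod_minus_sym in H2.
  eapply Rle_lt_trans; [apply (Cmod_dist3 _ (lsum (f n) L))|].
  pose proof (Cmod_dist3 (lsum (f n) L) (lsum g L) (tsum g)). lra.
Qed.

Lemma bounded_sums_nat (b : nat -> R) M :
  (forall i, (0 <= b i)%R) -> (forall N, (rsum b (seq 0 N) <= M)%R) -> bounded_sums b.
Proof.
  intros Hb H. exists M. intros L ND.
  eapply Rle_trans; [|apply (H (S (list_max L)))].
  apply rsum_incl; auto. intros i Hi. apply in_seq.
  pose proof (proj1 (list_max_le L (list_max L)) (Nat.le_refl _)) as HF.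
  rewrite Forall_forall in HF. specialize (HF i Hi). lia.
Qed.

Lemma geom_partial (r : R) n : (0 <= r < 1)%R -> (rsum (fun k => r ^ k)%R (seq 0 n) <= / (1 - r))%R.
Proof.
  intros Hr. assert (H : rsum (fun n => r ^ n)%R (seq 0 n) = ((1 - r ^ n) / (1 - r))%R).
  { induction n; [simpl; field; lra|]. rewrite seq_S, rsum_app, IHn. simpl. field; lra. }
  rewrite H. unfold Rdiv. rewrite <- (Rmult_1_l (/ (1 - r))) at 2.
  apply Rmult_le_compat_r; [left; apply Rinv_0_lt_compat; lra|].
  pose proof (pow_le r n); lra.
Qed.

Lemma bounded_sums_geom (r : R) : (0 <= r < 1)%R -> bounded_sums (fun n => r ^ n)%R.
Proof.
  intros Hr. apply (bounded_sums_nat _ (/ (1 - r))).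
  - intros; apply pow_le; lra.
  - intros N. apply geom_partial, Hr.
Qed.

(** Reindexing of the integers by a sign and a natural number, matching the two
    one-sided series of [is_sumZ]. *)
Definition Z_of_half (x : bool * nat) : Z :=
  if fst x then Z.of_nat (snd x) else (- Z.of_nat (snd x + 1))%Z.
Definition half_of_Z (n : Z) : bool * nat :=
  if (0 <=? n)%Z then (true, Z.to_nat n) else (false, Z.to_nat (- n - 1)).

Lemma half_of_Z_of_half x : half_of_Z (Z_of_half x) = x.
Proof.
  destruct x as [[|] n]; unfold half_of_Z, Z_of_half; simpl.
  - destruct (Z.leb_spec 0 (Z.of_nat n)); [|lia]. f_equal; lia.
  - destruct (Z.leb_spec 0 (- Z.of_nat (n + 1))); [lia|]. f_equal; lia.
Qed.

Lemma Z_of_half_of_Z n : Z_of_half (half_of_Z n) = n.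
Proof. unfold half_of_Z, Z_of_half. destruct (Z.leb_spec 0 n); simpl; lia. Qed.

Lemma bounded_sums_Z (b : Z -> R) : (forall n, (0 <= b n)%R) ->
  bounded_sums (fun n => b (Z.of_nat n)) -> bounded_sums (fun n => b (- Z.of_nat n)%Z) -> bounded_sums b.
Proof.
  intros Hb [M1 H1] [M2 H2].
  assert (H2' : bounded_sums (fun n => b (- Z.of_nat (n + 1))%Z)).
  { apply (bounded_sums_inj (fun n => b (- Z.of_nat n)%Z) (fun n => (n + 1)%nat)); [lia|].
    exists M2; easy. }
  destruct H2' as [M3 H3].
  assert (H : bounded_sums (fun x => b (Z_of_half x))).
  { apply (bounded_sums_iter _ (fun i : bool => if i then M1 else M3)); auto.
    - intros [|] K ND; unfold Z_of_half; simpl; auto.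
    - exists (rsum (fun i : bool => if i then M1 else M3) [true; false]). intros L ND.
      apply rsum_incl; auto.
      + intros [|]; [apply (H1 nil)|apply (H3 nil)]; constructor.
      + intros [|] _; simpl; auto. }
  apply (bounded_sums_le _ (fun n => b (Z_of_half (half_of_Z n)))).
  - intros n; rewrite Z_of_half_of_Z; lra.
  - apply (bounded_sums_inj (fun x => b (Z_of_half x)) half_of_Z); [|easy].
    intros j j' E. rewrite <- (Z_of_half_of_Z j), E, Z_of_half_of_Z; easy.
Qed.

Lemma sum_n_lsum (f : nat -> C) N : sum_n (G := C_AbelianMonoid) f N = lsum f (seq 0 (S N)).
Proof.
  induction N; [rewrite sum_O; simpl; ring|].
  rewrite sum_Sn, IHN, (seq_S (S N)), lsum_app. simpl lsum. unfold plus; simpl. ring.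
Qed.

Lemma is_series_clim (f : nat -> C) S :
  @is_series C_AbsRing C_NormedModule f S <-> clim (fun n => lsum f (seq 0 (Datatypes.S n))) S.
Proof.
  unfold is_series. split; intros H.
  - intros eps He.
    pose proof (proj1 (filterlim_locally_ball_norm (K := C_AbsRing) (U := C_NormedModule) _ S) H
      (mkposreal eps He)) as [N HN].
    exists N. intros n Hn. specialize (HN n Hn). unfold ball_norm in HN. simpl in HN.
    rewrite <- sum_n_lsum. exact HN.
  - apply (filterlim_locally_ball_norm (K := C_AbsRing) (U := C_NormedModule)).
    intros [eps He]. destruct (H eps He) as [N HN]. exists N. intros n Hn. specialize (HN n Hn).
    rewrite <- sum_n_lsum in HN. exact HN.
Qed.

Lemma has_sum_clim (f : nat -> C) S : has_sum f S -> clim (fun n => lsum f (seq 0 (Datatypes.S n))) S.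
Proof.
  intros H eps He. destruct (H eps He) as [L K]. exists (list_max L). intros n Hn.
  apply K; [apply seq_NoDup|]. intros i Hi. apply in_seq.
  pose proof (proj1 (list_max_le L (list_max L)) (Nat.le_refl _)) as HF.
  rewrite Forall_forall in HF. specialize (HF i Hi). lia.
Qed.

Lemma abs_summable_is_series (f : nat -> C) : abs_summable f -> @is_series C_AbsRing C_NormedModule f (tsum f).
Proof. intros H. apply is_series_clim, has_sum_clim, tsum_has_sum, H. Qed.

Lemma Re_le_Cmod (z : C) : (Rabs (Re z) <= Cmod z)%R.
Proof. eapply Rle_trans; [apply Rmax_l|apply (Rmax_Cmod z)]. Qed.

Lemma Im_le_Cmod (z : C) : (Rabs (Im z) <= Cmod z)%R.
Proof. eapply Rle_trans; [apply Rmax_r|apply (Rmax_Cmod z)]. Qed.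

Lemma clim_Re u l : clim u l -> is_lim_seq (fun n => Re (u n)) (Re l).
Proof.
  intros H. apply is_lim_seq_spec. intros [eps He]. destruct (H eps He) as [N K].
  exists N. intros n Hn. simpl. eapply Rle_lt_trans; [|apply (K n Hn)].
  exact (Re_le_Cmod (u n - l)).
Qed.

Lemma clim_Im u l : clim u l -> is_lim_seq (fun n => Im (u n)) (Im l).
Proof.
  intros H. apply is_lim_seq_spec. intros [eps He]. destruct (H eps He) as [N K].
  exists N. intros n Hn. simpl. eapply Rle_lt_trans; [|apply (K n Hn)].
  exact (Im_le_Cmod (u n - l)).
Qed.

Lemma C_ext (z w : C) : Re z = Re w -> Im z = Im w -> z = w.
Proof. destruct z, w; simpl; congruence. Qed.

Lemma CLim_seq_clim u l : clim u l -> CLim_seq u = l.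
Proof.
  intros H. unfold CLim_seq. apply C_ext; simpl.
  - rewrite (is_lim_seq_unique _ _ (clim_Re u l H)); easy.
  - rewrite (is_lim_seq_unique _ _ (clim_Im u l H)); easy.
Qed.

Lemma Re_lsum (f : nat -> C) L : Re (lsum f L) = rsum (fun n => Re (f n)) L.
Proof. induction L; simpl; [easy|]. rewrite <- IHL; easy. Qed.

Lemma Im_lsum (f : nat -> C) L : Im (lsum f L) = rsum (fun n => Im (f n)) L.
Proof. induction L; simpl; [easy|]. rewrite <- IHL; easy. Qed.

Lemma sum_n_rsum (f : nat -> R) N : sum_n f N = rsum f (seq 0 (S N)).
Proof.
  induction N; [rewrite sum_O; simpl; ring|].
  rewrite sum_Sn, IHN, (seq_S (S N)), rsum_app. simpl rsum. unfold plus; simpl. ring.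
Qed.

Lemma clim_series_Re (f : nat -> C) S :
  clim (fun n => lsum f (seq 0 (Datatypes.S n))) S -> is_series (fun n => Re (f n)) (Re S).
Proof.
  intros H. apply clim_Re in H.
  apply (is_lim_seq_ext _ (sum_n (fun n => Re (f n)))) in H; [exact H|].
  intros n. rewrite Re_lsum, sum_n_rsum; easy.
Qed.

Lemma clim_series_Im (f : nat -> C) S :
  clim (fun n => lsum f (seq 0 (Datatypes.S n))) S -> is_series (fun n => Im (f n)) (Im S).
Proof.
  intros H. apply clim_Im in H.
  apply (is_lim_seq_ext _ (sum_n (fun n => Im (f n)))) in H; [exact H|].
  intros n. rewrite Im_lsum, sum_n_rsum; easy.
Qed.

Lemma CSeries_tsum (f : nat -> C) : abs_summable f -> CSeries f = tsum f.
Proof.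
  intros H. apply tsum_has_sum, has_sum_clim in H. unfold CSeries. apply C_ext; simpl.
  - apply is_series_unique, clim_series_Re, H.
  - apply is_series_unique, clim_series_Im, H.
Qed.

Lemma is_sumZ_tsum (f : Z -> C) : abs_summable f -> is_sumZ f (tsum f).
Proof.
  intros H.
  assert (H1 : abs_summable (fun n => f (Z.of_nat n))).
  { apply (bounded_sums_inj (fun n => Cmod (f n)) Z.of_nat); [lia|easy]. }
  assert (H2 : abs_summable (fun n => f (- Z.of_nat (n + 1))%Z)).
  { apply (bounded_sums_inj (fun n => Cmod (f n)) (fun n => - Z.of_nat (n + 1))%Z); [lia|easy]. }
  exists (tsum (fun n => f (Z.of_nat n))), (tsum (fun n => f (- Z.of_nat (n + 1))%Z)).
  repeat split; [apply abs_summable_is_series, H1|apply abs_summable_is_series, H2|].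
  assert (HZ : abs_summable (fun x => f (Z_of_half x))).
  { apply (bounded_sums_inj (fun n => Cmod (f n)) Z_of_half); [|easy].
    intros j j' E. rewrite <- (half_of_Z_of_half j), E, half_of_Z_of_half; easy. }
  rewrite <- (tsum_bij f Z_of_half half_of_Z half_of_Z_of_half Z_of_half_of_Z H).
  rewrite <- (tsum_fubini (fun x => f (Z_of_half x)) HZ).
  apply tsum_unique.
  replace (tsum (fun n => f (Z.of_nat n)) + tsum (fun n => f (- Z.of_nat (n + 1))%Z)) with
    (lsum (fun i => tsum (fun j => f (Z_of_half (i, j)))) [true; false]).
  - apply has_sum_finite.
    + repeat constructor; simpl; intuition congruence.
    + intros [|] Hn; exfalso; apply Hn; simpl; auto.
  - simpl. unfold Z_of_half; simpl. ring.
Qed.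

(** * Shifted factorials *)

Lemma qpoch_left (x p : C) n : qpoch x p (S n) = (1 - x) * qpoch (x * p) p n.
Proof.
  induction n; [simpl; ring|].
  change (qpoch x p (S (S n))) with (qpoch x p (S n) * (1 - x * p ^ S n)).
  rewrite IHn. simpl. ring.
Qed.

Lemma qpoch_add (x p : C) m n : qpoch x p (m + n) = qpoch x p m * qpoch (x * p ^ m) p n.
Proof.
  induction n; [rewrite Nat.add_0_r; simpl; ring|].
  rewrite Nat.add_succ_r. simpl. rewrite IHn, Cpow_add_r. ring.
Qed.

Lemma qpoch_nz (x p : C) n : (forall k, x * p ^ k <> 1) -> qpoch x p n <> 0.
Proof.
  intros H. induction n; simpl; [exact C1_nz|].
  apply Cmult_neq_0; [easy|]. apply Cminus_eq_contra. intros E; apply (H n); easy.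
Qed.

Lemma one_minus_nz (z : C) : z <> 1 -> 1 - z <> 0.
Proof. intros H. apply Cminus_eq_contra; congruence. Qed.

Lemma lt1_ne1 (z : C) : (Cmod z < 1)%R -> z <> 1.
Proof. intros H E; rewrite E, Cmod_1 in H; lra. Qed.

Lemma Cmod_pow_lt1 (x p : C) k : (Cmod p < 1)%R -> (Cmod x < 1)%R -> (Cmod (x * p ^ k) < 1)%R.
Proof.
  intros Hp Hx. rewrite Cmod_mult, Cmod_pow.
  pose proof (Cmod_ge_0 p). pose proof (Cmod_ge_0 x).
  assert (0 <= Cmod p ^ k <= 1)%R.
  { split; [apply pow_le; easy|]. rewrite <- (pow1 k). apply pow_incr; lra. }
  nra.
Qed.

Lemma small_regular (x p : C) : (Cmod p < 1)%R -> (Cmod x < 1)%R -> forall k, x * p ^ k <> 1.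
Proof. intros Hp Hx k. apply lt1_ne1, Cmod_pow_lt1; easy. Qed.

(** Induction with |u (1 - y) - 1| <= |u - 1| + |u| |y| and 1 + |y| <= exp |y|;
    the bound is uniform in n and tends to 0 with x. *)
Lemma qpoch_near1 (x p : C) n : (Cmod p < 1)%R ->
  (Cmod (qpoch x p n - 1) <= exp (Cmod x / (1 - Cmod p)) - 1)%R.
Proof.
  intros Hp. pose proof (Cmod_ge_0 p) as Hp0. pose proof (Cmod_ge_0 x) as Hx0.
  assert (H : (Cmod (qpoch x p n - 1)
     <= exp (Cmod x * rsum (fun k => Cmod p ^ k)%R (seq 0 n)) - 1)%R).
  { induction n.
    - simpl. replace (1 - 1) with (RtoC 0) by ring. rewrite Cmod_0, Rmult_0_r, exp_0; lra.
    - rewrite seq_S, rsum_app. simpl qpoch. simpl rsum. rewrite Rplus_0_r, Rmult_plus_distr_l, exp_plus.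
      set (E := exp (Cmod x * rsum (fun k => Cmod p ^ k)%R (seq 0 n))) in *.
      replace (qpoch x p n * (1 - x * p ^ n) - 1)
        with ((qpoch x p n - 1) + (- (qpoch x p n)) * (x * p ^ n)) by ring.
      eapply Rle_trans; [apply Cmod_triangle|]. rewrite !Cmod_mult, Cmod_opp, Cmod_pow.
      assert (Hu : (Cmod (qpoch x p n) <= E)%R).
      { replace (qpoch x p n) with ((qpoch x p n - 1) + 1) by ring.
        eapply Rle_trans; [apply Cmod_triangle|]. rewrite Cmod_1; lra. }
      set (y := (Cmod x * Cmod p ^ n)%R).
      assert (0 <= y)%R by (apply Rmult_le_pos; [easy|apply pow_le; easy]).
      assert (1 + y <= exp y)%R by apply exp_ineq1_le.
      pose proof (Cmod_ge_0 (qpoch x p n)). nra. }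
  eapply Rle_trans; [apply H|]. apply Rplus_le_compat_r.
  assert (Cmod x * rsum (fun k => Cmod p ^ k)%R (seq 0 n) <= Cmod x / (1 - Cmod p))%R.
  { apply Rmult_le_compat_l; [easy|]. apply geom_partial; lra. }
  destruct (Rle_lt_or_eq_dec _ _ H0) as [H1|H1]; [left; apply exp_increasing; easy|rewrite H1; lra].
Qed.

Lemma qpoch_bound (x p : C) n : (Cmod p < 1)%R ->
  (Cmod (qpoch x p n) <= exp (Cmod x / (1 - Cmod p)))%R.
Proof.
  intros Hp. pose proof (qpoch_near1 x p n Hp).
  replace (qpoch x p n) with ((qpoch x p n - 1) + 1) by ring.
  eapply Rle_trans; [apply Cmod_triangle|]. rewrite Cmod_1; lra.
Qed.

Lemma abs_summable_geom (z : C) : (Cmod z < 1)%R -> abs_summable (fun n => z ^ n).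
Proof.
  intros H. apply (abs_summable_le _ (fun n => Cmod z ^ n)%R).
  - apply bounded_sums_geom. split; [apply Cmod_ge_0|easy].
  - intros n; rewrite Cmod_pow; lra.
Qed.

Lemma abs_summable_mul_bounded {I : Type} (f g : I -> C) M :
  (forall i, (Cmod (f i) <= M)%R) -> abs_summable g -> abs_summable (fun i => f i * g i).
Proof.
  intros Hf Hg. apply (abs_summable_le _ (fun i => Rmax M 0 * Cmod (g i))%R).
  - apply bounded_sums_scal; [apply Rmax_r|easy].
  - intros i. rewrite Cmod_mult. apply Rmult_le_compat_r; [apply Cmod_ge_0|].
    eapply Rle_trans; [apply Hf|apply Rmax_l].
Qed.

Lemma clim_shift u l : clim u l <-> clim (fun n => u (S n)) l.
Proof.
  split; intros H eps He; destruct (H eps He) as [N K].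
  - exists N. intros n Hn. apply K; lia.
  - exists (S N). intros [|n] Hn; [lia|]. apply (K n); lia.
Qed.

Lemma clim_comp u l (phi : nat -> nat) :
  (forall n, exists N, forall m, (N <= m)%nat -> (n <= phi m)%nat) ->
  clim u l -> clim (fun n => u (phi n)) l.
Proof.
  intros Hphi H eps He. destruct (H eps He) as [N K]. destruct (Hphi N) as [N' HN].
  exists N'. intros n Hn. apply K, HN, Hn.
Qed.

(** The increments - x p^n (x; p)_n are dominated by a geometric series. *)
Lemma qpoch_clim (x p : C) : (Cmod p < 1)%R -> clim (qpoch x p) (qpoch_inf x p).
Proof.
  intros Hp. enough (H : exists l, clim (qpoch x p) l).
  { destruct H as [l Hl]. unfold qpoch_inf. rewrite (CLim_seq_clim _ _ Hl). easy. }
  set (f := fun k => (- x * qpoch x p k) * p ^ k).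
  assert (Hf : abs_summable f).
  { apply (abs_summable_mul_bounded _ _ (Cmod (- x) * exp (Cmod x / (1 - Cmod p)))%R); [|apply abs_summable_geom, Hp].
    intros i. rewrite Cmod_mult. apply Rmult_le_compat_l; [apply Cmod_ge_0|].
    apply qpoch_bound, Hp. }
  exists (1 + tsum f). apply clim_shift.
  apply (clim_ext (fun n => 1 + lsum f (seq 0 (S n)))).
  - intros n. generalize (S n) as m. intros m. induction m; [simpl; ring|].
    rewrite seq_S, lsum_app. simpl.
    transitivity ((1 + lsum f (seq 0 m)) + f m); [ring|rewrite IHm; unfold f; ring].
  - apply clim_plus; [apply clim_const|]. apply has_sum_clim, tsum_has_sum, Hf.
Qed.

Lemma qpoch_inf_split (x p : C) n : (Cmod p < 1)%R ->
  qpoch_inf x p = qpoch x p n * qpoch_inf (x * p ^ n) p.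
Proof.
  intros Hp. apply (clim_unique (fun m => qpoch x p (n + m))).
  - apply (clim_comp (qpoch x p)); [|apply qpoch_clim, Hp].
    intros k; exists k; intros; lia.
  - apply (clim_ext (fun m => qpoch x p n * qpoch (x * p ^ n) p m)).
    + intros m; rewrite qpoch_add; easy.
    + apply clim_mult; [apply clim_const|apply qpoch_clim, Hp].
Qed.

Lemma clim_le u l M : clim u l -> (forall n, (Cmod (u n) <= M)%R) -> (Cmod l <= M)%R.
Proof.
  intros H HM. apply Rnot_lt_le; intros Hlt. destruct (H (Cmod l - M)%R) as [N K]; [lra|].
  specialize (K N (Nat.le_refl _)). specialize (HM N).
  pose proof (Cmod_triangle (l - u N) (u N)) as Ht.
  replace (l - u N + u N) with l in Ht by ring. rewrite Cmod_minus_sym in K. lra.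
Qed.

Lemma qpoch_inf_near1 (x p : C) : (Cmod p < 1)%R ->
  (Cmod (qpoch_inf x p - 1) <= exp (Cmod x / (1 - Cmod p)) - 1)%R.
Proof.
  intros Hp. apply (clim_le (fun n => qpoch x p n - 1)).
  - apply clim_plus; [apply qpoch_clim, Hp|apply clim_const].
  - intros n; apply qpoch_near1, Hp.
Qed.

Lemma clim_pow (z : C) : (Cmod z < 1)%R -> clim (fun n => z ^ n) 0.
Proof.
  intros Hz eps He. destruct (pow_lt_1_zero (Cmod z)) with (y := eps) as [N HN]; [|easy|].
  - rewrite Rabs_pos_eq; [easy|apply Cmod_ge_0].
  - exists N. intros n Hn. replace (z ^ n - 0) with (z ^ n) by ring. rewrite Cmod_pow.
    specialize (HN n Hn). rewrite Rabs_pos_eq in HN; [easy|]. apply pow_le, Cmod_ge_0.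
Qed.

Lemma qpoch_inf_clim1 (x p : C) : (Cmod p < 1)%R -> clim (fun n => qpoch_inf (x * p ^ n) p) 1.
Proof.
  intros Hp eps He.
  assert (Hc : continuity_pt exp 0) by apply derivable_continuous_pt, derivable_pt_exp.
  destruct (Hc eps He) as (al & Hal & Hd).
  destruct (clim_pow p Hp (al * (1 - Cmod p) / (Cmod x + 1))%R) as [N HN].
  { pose proof (Cmod_ge_0 x). apply Rdiv_lt_0_compat; [|lra]. apply Rmult_lt_0_compat; lra. }
  exists N. intros n Hn. specialize (HN n Hn). replace (p ^ n - 0) with (p ^ n) in HN by ring.
  eapply Rle_lt_trans; [apply qpoch_inf_near1, Hp|]. rewrite Cmod_mult.
  pose proof (Cmod_ge_0 x) as Hx. pose proof (Cmod_ge_0 (p ^ n)) as Hpn.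
  set (y := (Cmod x * Cmod (p ^ n) / (1 - Cmod p))%R).
  assert (Hy : (0 <= y < al)%R).
  { split.
    - apply Rdiv_le_0_compat; [apply Rmult_le_pos; easy|lra].
    - unfold y. apply Rmult_lt_reg_r with (1 - Cmod p)%R; [lra|].
      unfold Rdiv. rewrite Rmult_assoc, Rinv_l, Rmult_1_r by lra.
      apply Rle_lt_trans with ((Cmod x + 1) * Cmod (p ^ n))%R; [nra|].
      apply Rlt_le_trans with ((Cmod x + 1) * (al * (1 - Cmod p) / (Cmod x + 1)))%R.
      + apply Rmult_lt_compat_l; lra.
      + right; field; lra. }
  destruct (Req_dec y 0) as [E|E]; [rewrite E, exp_0; lra|].
  specialize (Hd y). simpl in Hd. unfold R_dist, D_x, no_cond in Hd.
  rewrite exp_0 in Hd.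
  assert (Rabs (exp y - 1) < eps)%R.
  { apply Hd. split; [split; auto|]. rewrite Rminus_0_r, Rabs_pos_eq; lra. }
  pose proof (Rle_abs (exp y - 1)). lra.
Qed.

(** A far tail (x p^N; p)_oo is close to 1, and the first N factors do not
    vanish. *)
Lemma qpoch_inf_nz (x p : C) : (Cmod p < 1)%R -> (forall k, x * p ^ k <> 1) -> qpoch_inf x p <> 0.
Proof.
  intros Hp H. destruct (qpoch_inf_clim1 x p Hp 1%R) as [N K]; [lra|].
  specialize (K N (Nat.le_refl _)). rewrite (qpoch_inf_split x p N Hp).
  apply Cmult_neq_0; [apply qpoch_nz, H|]. intros E. rewrite E in K.
  rewrite Cmod_minus_sym in K. replace (1 - 0) with (RtoC 1) in K by ring.
  rewrite Cmod_1 in K. lra.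
Qed.

Lemma qpoch_inf_zero (x p : C) k : (Cmod p < 1)%R -> x * p ^ k = 1 -> qpoch_inf x p = 0.
Proof.
  intros Hp H. rewrite (qpoch_inf_split x p (S k) Hp). simpl. rewrite H. ring.
Qed.

Lemma qpoch_inv_bound (x p : C) : (Cmod p < 1)%R -> (forall k, x * p ^ k <> 1) ->
  exists M, forall n, (Cmod (/ qpoch x p n) <= M)%R.
Proof.
  intros Hp H.
  destruct (clim_bounded _ _ (clim_inv _ _ (qpoch_inf_nz x p Hp H) (qpoch_clim x p Hp)))
    as (M & _ & HM).
  exists M; exact HM.
Qed.

(** * The q-binomial theorem *)

Lemma tsum_nat_S (f : nat -> C) : abs_summable f -> tsum f = f O + tsum (fun n => f (S n)).
Proof.
  intros H. assert (H' : abs_summable (fun n => f (S n))).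
  { apply (bounded_sums_inj (fun n => Cmod (f n)) S); [lia|easy]. }
  apply (clim_unique (fun n => lsum f (seq 0 (S (S n))))).
  - apply (clim_shift (fun n => lsum f (seq 0 (S n)))), has_sum_clim, tsum_has_sum, H.
  - apply (clim_ext (fun n => f O + lsum (fun n => f (S n)) (seq 0 (S n)))).
    + intros n. rewrite <- lsum_map, seq_shift. easy.
    + apply clim_plus; [apply clim_const|]. apply has_sum_clim, tsum_has_sum, H'.
Qed.

Definition qbin (A p : C) (k : nat) : C := qpoch A p k / qpoch p p k.

Lemma qpoch_pp_nz (p : C) n : (Cmod p < 1)%R -> qpoch p p n <> 0.
Proof. intros Hp. apply qpoch_nz, small_regular; easy. Qed.

Lemma qbin_bound (A p : C) : (Cmod p < 1)%R -> exists M, forall k, (Cmod (qbin A p k) <= M)%R.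
Proof.
  intros Hp. destruct (qpoch_inv_bound p p Hp (small_regular p p Hp Hp)) as [M HM].
  exists (exp (Cmod A / (1 - Cmod p)) * M)%R. intros k. unfold qbin, Cdiv. rewrite Cmod_mult.
  apply Rmult_le_compat; try apply Cmod_ge_0; [apply qpoch_bound, Hp|apply HM].
Qed.

Lemma abs_summable_qbin (A p z : C) : (Cmod p < 1)%R -> (Cmod z < 1)%R -> abs_summable (fun k => qbin A p k * z ^ k).
Proof.
  intros Hp Hz. destruct (qbin_bound A p Hp) as [M HM].
  apply (abs_summable_mul_bounded _ _ M HM), abs_summable_geom, Hz.
Qed.

(** The recursion (1 - p^(k+1)) c_(k+1) = (1 - A p^k) c_k of the coefficients,
    summed against z^(k+1), compares the series at z and at zp. *)
Lemma qbin_step (A p z : C) : (Cmod p < 1)%R -> (Cmod z < 1)%R ->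
  (1 - z) * tsum (fun k => qbin A p k * z ^ k)
  = (1 - A * z) * tsum (fun k => qbin A p k * (z * p) ^ k).
Proof.
  intros Hp Hz.
  assert (Hzp : (Cmod (z * p) < 1)%R).
  { rewrite Cmod_mult. pose proof (Cmod_ge_0 z). pose proof (Cmod_ge_0 p). nra. }
  pose proof (abs_summable_qbin A p z Hp Hz) as H1. pose proof (abs_summable_qbin A p (z * p) Hp Hzp) as H2.
  set (f := fun k => qbin A p k * z ^ k) in *. set (g := fun k => qbin A p k * (z * p) ^ k) in *.
  assert (E : tsum f + (-(1)) * tsum g = z * (tsum f + (- A) * tsum g)).
  { rewrite <- (tsum_scal (-(1))), <- (tsum_scal (- A)) by easy.
    rewrite <- !tsum_plus by (try apply abs_summable_scal; easy).
    rewrite <- tsum_scal by (apply abs_summable_plus; [|apply abs_summable_scal]; easy).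
    rewrite tsum_nat_S by (apply abs_summable_plus; [|apply abs_summable_scal]; easy).
    unfold f at 1, g at 1. unfold qbin at 1 2. simpl qpoch. simpl Cpow.
    match goal with |- ?a + ?b = ?c => cut (b = c); [intros ->; field; try exact C1_nz|] end.
    apply tsum_ext. intros k. unfold f, g, qbin.
      simpl qpoch. change (p * p ^ k) with (p ^ S k).
      assert (1 - p ^ S k <> 0) by (apply one_minus_nz; simpl; apply (small_regular p p Hp Hp)).
      pose proof (qpoch_pp_nz p k Hp). rewrite !Cpow_mult_l. simpl Cpow in *.
      field. split; easy. }
  transitivity (tsum f - z * (tsum f + (- A) * tsum g) - A * z * tsum g); [ring|].
  rewrite <- E. ring.
Qed.

(** Iterate [qbin_step] and let z p^n tend to 0. *)
Lemma q_binomial (A p z : C) : (Cmod p < 1)%R -> (Cmod z < 1)%R ->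
  tsum (fun k => qbin A p k * z ^ k) = qpoch_inf (A * z) p / qpoch_inf z p.
Proof.
  intros Hp Hz. set (f := fun z => tsum (fun k => qbin A p k * z ^ k)).
  assert (H : forall n, qpoch z p n * f z = qpoch (A * z) p n * f (z * p ^ n)).
  { induction n.
    - simpl. rewrite Cmult_1_r. ring.
    - simpl qpoch.
      transitivity ((1 - z * p ^ n) * (qpoch z p n * f z)); [ring|]. rewrite IHn.
      assert (Hs : (Cmod (z * p ^ n) < 1)%R) by (apply Cmod_pow_lt1; easy).
      transitivity (qpoch (A * z) p n * ((1 - z * p ^ n) * f (z * p ^ n))); [ring|].
      unfold f at 1. rewrite qbin_step by easy.
      replace (z * p ^ n * p) with (z * p ^ S n) by (simpl; ring).
      unfold f. ring. }
  assert (H1 : clim (fun n => f (z * p ^ n)) 1).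
  { replace (RtoC 1) with (tsum (fun k => qbin A p k * 0 ^ k)).
    - apply (tannery _ _ (fun k => Cmod (qbin A p k * z ^ k))).
      + apply abs_summable_qbin; easy.
      + intros N i. rewrite !Cmod_mult, !Cmod_pow, Cmod_mult, Cmod_pow.
        apply Rmult_le_compat_l; [apply Cmod_ge_0|]. apply pow_incr.
        pose proof (Cmod_ge_0 z). pose proof (Cmod_ge_0 p).
        assert (0 <= Cmod p ^ N <= 1)%R.
        { split; [apply pow_le; easy|]. rewrite <- (pow1 N). apply pow_incr; lra. }
        nra.
      + intros k. apply clim_mult; [apply clim_const|].
        assert (Hc : clim (fun n => z * p ^ n) 0).
        { replace (RtoC 0) with (z * 0) by ring. apply clim_mult; [apply clim_const|apply clim_pow, Hp]. }
        induction k; simpl; [apply clim_const|]. apply clim_mult; easy.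
    - apply tsum_unique. replace (RtoC 1) with (lsum (fun k => qbin A p k * 0 ^ k) [O]).
      + apply has_sum_finite; [repeat constructor; easy|]. intros [|i] Hi; [simpl in Hi; intuition|].
        simpl. ring.
      + simpl. unfold qbin; simpl. field; try exact C1_nz. }
  assert (Hz' : qpoch_inf z p <> 0) by (apply qpoch_inf_nz, small_regular; easy).
  assert (E : qpoch_inf z p * f z = qpoch_inf (A * z) p * 1).
  { apply (clim_unique (fun n => qpoch z p n * f z)).
    - apply clim_mult; [apply qpoch_clim, Hp|apply clim_const].
    - apply (clim_ext (fun n => qpoch (A * z) p n * f (z * p ^ n))); [intros; symmetry; apply H|].
      apply clim_mult; [apply qpoch_clim, Hp|apply H1]. }
  fold (f z). apply (f_equal (fun w => w / qpoch_inf z p)) in E.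
  transitivity (qpoch_inf z p * f z / qpoch_inf z p); [field; easy|]. rewrite E. field; easy.
Qed.

(** * Integer powers *)

Lemma CpowerZ_nat (z : C) n : CpowerZ z (Z.of_nat n) = z ^ n.
Proof. destruct n; [easy|]. simpl. rewrite SuccNat2Pos.id_succ. easy. Qed.

Lemma CpowerZ_neg_nat (z : C) n : CpowerZ z (- Z.of_nat n) = / z ^ n.
Proof.
  destruct n; simpl; [|rewrite SuccNat2Pos.id_succ; easy].
  field; try exact C1_nz.
Qed.

Lemma CpowerZ_succ (z : C) n : z <> 0 -> CpowerZ z (n + 1) = z * CpowerZ z n.
Proof.
  intros Hz. destruct (Z_le_gt_dec 0 n) as [H|H].
  - rewrite <- (Z2Nat.id n) by easy.
    replace (Z.of_nat (Z.to_nat n) + 1)%Z with (Z.of_nat (S (Z.to_nat n))) by lia.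
    rewrite !CpowerZ_nat. easy.
  - replace n with (- Z.of_nat (S (Z.to_nat (- n - 1))))%Z by lia.
    replace (- Z.of_nat (S (Z.to_nat (- n - 1))) + 1)%Z with (- Z.of_nat (Z.to_nat (- n - 1)))%Z by lia.
    rewrite !CpowerZ_neg_nat. simpl. pose proof (Cpow_nz z (Z.to_nat (- n - 1)) Hz). field; auto.
Qed.

Lemma Z_ind2 (P : Z -> Prop) : P 0%Z -> (forall n, P n <-> P (n + 1)%Z) -> forall n, P n.
Proof.
  intros H0 Hs. apply Z.bi_induction; [intros ? ? ->; easy|easy|]. intros n. apply Hs.
Qed.

Lemma CpowerZ_nz (z : C) n : z <> 0 -> CpowerZ z n <> 0.
Proof.
  intros Hz. revert n. apply Z_ind2; [exact C1_nz|].
  intros n. rewrite CpowerZ_succ by easy. split; intros H.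
  - apply Cmult_neq_0; easy.
  - intros E; apply H; rewrite E; ring.
Qed.

Lemma Cmult_cancel_l (a b c : C) : a <> 0 -> a * b = a * c -> b = c.
Proof.
  intros Ha H. transitivity (/ a * (a * b)); [field; easy|]. rewrite H. field; easy.
Qed.

Lemma CpowerZ_add (z : C) n m : z <> 0 -> CpowerZ z (n + m) = CpowerZ z n * CpowerZ z m.
Proof.
  intros Hz. revert n. apply Z_ind2; [simpl; ring|].
  intros n. replace (n + 1 + m)%Z with (n + m + 1)%Z by lia. rewrite !CpowerZ_succ by easy.
  split; intros H; [rewrite H; ring|].
  apply (Cmult_cancel_l z); [easy|]. rewrite H; ring.
Qed.

Lemma CpowerZ_opp (z : C) n : z <> 0 -> CpowerZ z (- n) = / CpowerZ z n.
Proof.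
  intros Hz. pose proof (CpowerZ_nz z n Hz).
  apply (Cmult_cancel_l (CpowerZ z n)); [easy|]. rewrite <- CpowerZ_add by easy.
  rewrite Z.add_opp_diag_r. simpl. field; easy.
Qed.

Lemma CpowerZ_mult (z w : C) n : z <> 0 -> w <> 0 -> CpowerZ (z * w) n = CpowerZ z n * CpowerZ w n.
Proof.
  intros Hz Hw. assert (Hzw : z * w <> 0) by (apply Cmult_neq_0; easy).
  revert n. apply Z_ind2; [simpl; ring|].
  intros n. rewrite !CpowerZ_succ by easy. split; intros H; [rewrite H; ring|].
  apply (Cmult_cancel_l (z * w)); [easy|]. rewrite H; ring.
Qed.

Lemma CpowerZ_CpZ (z : C) n m : z <> 0 -> CpowerZ (CpowerZ z m) n = CpowerZ z (m * n).
Proof.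
  intros Hz. pose proof (CpowerZ_nz z m Hz) as Hm. revert n. apply Z_ind2; [rewrite Z.mul_0_r; easy|].
  intros n. rewrite !CpowerZ_succ by easy. replace (m * (n + 1))%Z with (m + m * n)%Z by lia.
  rewrite CpowerZ_add by easy. split; intros H; [rewrite H; ring|].
  apply (Cmult_cancel_l (CpowerZ z m)); [easy|]. rewrite H; ring.
Qed.

Lemma CpowerZ_1 (z : C) : CpowerZ z 1 = z.
Proof. simpl. ring. Qed.

(** * Gaussian coefficients (-1)^n p^(n(n-1)/2) *)

(** The coefficients of the theta series; the exponent is an integer because
    n (n - 1) is even. *)
Definition gauss (p : C) (n : Z) : C := CpowerZ (-(1)) n * CpowerZ p (n * (n - 1) / 2).

Lemma m1_nz : - (RtoC 1) <> 0.
Proof. intros E. apply C1_nz. transitivity (- - RtoC 1); [ring|rewrite E; ring]. Qed.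

Lemma gauss_0 (p : C) : gauss p 0 = 1.
Proof. unfold gauss. simpl. ring. Qed.

Lemma tri_div n : (2 * (n * (n - 1) / 2) = n * (n - 1))%Z.
Proof.
  assert (H : ((n * (n - 1)) mod 2 = 0)%Z).
  { rewrite Zmult_mod, Zminus_mod. pose proof (Z.mod_pos_bound n 2 ltac:(lia)).
    assert (n mod 2 = 0 \/ n mod 2 = 1)%Z as [E|E] by lia; rewrite E; easy. }
  pose proof (Z.div_mod (n * (n - 1)) 2 ltac:(lia)). lia.
Qed.

Lemma gauss_add (p : C) n m : p <> 0 -> gauss p (n + m) = gauss p n * gauss p m * CpowerZ p (n * m).
Proof.
  intros Hp. unfold gauss. pose proof m1_nz.
  replace ((n + m) * (n + m - 1) / 2)%Z with (n * (n - 1) / 2 + m * (m - 1) / 2 + n * m)%Z.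
  - rewrite !CpowerZ_add by easy. ring.
  - pose proof (tri_div n). pose proof (tri_div m). pose proof (tri_div (n + m)). lia.
Qed.

Lemma gauss_nz (p : C) n : p <> 0 -> gauss p n <> 0.
Proof. intros Hp. unfold gauss. apply Cmult_neq_0; apply CpowerZ_nz; [apply m1_nz|easy]. Qed.

Lemma gauss_succ (p : C) n : p <> 0 -> gauss p (n + 1) = - CpowerZ p n * gauss p n.
Proof.
  intros Hp. rewrite gauss_add by easy. rewrite Z.mul_1_r.
  replace (gauss p 1) with (-(RtoC 1)); [ring|]. unfold gauss. simpl. ring.
Qed.

Lemma gauss_opp (p : C) n : p <> 0 -> gauss p (- n) = CpowerZ p n * gauss p n.
Proof.
  intros Hp. revert n. apply Z_ind2; [simpl; rewrite gauss_0; ring|]. intros n.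
  rewrite gauss_succ, CpowerZ_succ by easy.
  pose proof (gauss_succ p (- (n + 1)) Hp) as H.
  replace (- (n + 1) + 1)%Z with (- n)%Z in H by lia.
  rewrite CpowerZ_opp, CpowerZ_succ in H by easy. rewrite H.
  pose proof (CpowerZ_nz p n Hp).
  assert (E : forall w, - / (p * CpowerZ p n) * w = CpowerZ p n * gauss p n <->
                 w = p * CpowerZ p n * (- CpowerZ p n * gauss p n)).
  { intros w. split; intros Hw.
    - transitivity (- (p * CpowerZ p n) * (- / (p * CpowerZ p n) * w)); [field; auto|].
      rewrite Hw. ring.
    - rewrite Hw. field; auto. }
  apply E.
Qed.

(** This antisymmetry is the vanishing of the theta series at 1. *)
Lemma gauss_refl (p : C) n : p <> 0 -> gauss p (1 - n) = - gauss p n.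
Proof.
  intros Hp. replace (1 - n)%Z with (- n + 1)%Z by lia.
  rewrite gauss_succ, gauss_opp, CpowerZ_opp by easy. pose proof (CpowerZ_nz p n Hp). field; easy.
Qed.

(** The ratio of consecutive terms tends to 0, so from some point on it is below
    1/2. *)
Lemma bounded_sums_superexp (u : nat -> R) (c r : R) :
  (0 <= c)%R -> (0 <= r < 1)%R -> (forall k, (0 <= u k)%R) ->
  (forall k, (u (S k) <= u k * (c * r ^ k))%R) -> bounded_sums u.
Proof.
  intros Hc Hr Hu Hs.
  destruct (pow_lt_1_zero r) with (y := (/ 2 / (c + 1))%R) as [N HN].
  { rewrite Rabs_pos_eq; lra. }
  { apply Rdiv_lt_0_compat; lra. }
  assert (Hhalf : forall k, (N <= k)%nat -> (u (S k) <= u k * / 2)%R).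
  { intros k Hk. eapply Rle_trans; [apply Hs|]. apply Rmult_le_compat_l; [apply Hu|].
    specialize (HN k Hk). rewrite Rabs_pos_eq in HN by (apply pow_le; lra).
    pose proof (pow_le r k ltac:(lra)).
    apply Rle_trans with ((c + 1) * (/ 2 / (c + 1)))%R; [|right; field; lra].
    apply Rmult_le_compat; lra. }
  assert (HM : exists M, (0 <= M)%R /\ forall k, (k <= N)%nat -> (u k <= M * (/ 2) ^ k)%R).
  { clear HN Hhalf. induction N as [|N (M & HM & IH)].
    - exists (u O). split; [apply Hu|]. intros k Hk. replace k with O by lia. simpl; lra.
    - exists (M + u (S N) * 2 ^ (S N))%R.
      assert (H0 : (0 <= u (S N) * 2 ^ S N)%R) by (apply Rmult_le_pos; [apply Hu|apply pow_le; lra]).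
      split; [lra|]. intros k Hk. rewrite Rmult_plus_distr_r.
      destruct (Nat.eq_dec k (S N)) as [->|].
      + rewrite Rmult_assoc, <- Rpow_mult_distr.
        replace (2 * / 2)%R with 1%R by field. rewrite pow1, Rmult_1_r.
        pose proof (pow_le (/ 2) (S N) ltac:(lra)). nra.
      + specialize (IH k ltac:(lia)). pose proof (pow_le (/ 2) k ltac:(lra)). nra. }
  destruct HM as (M & HM0 & HM).
  apply (bounded_sums_le _ (fun k => M * (/ 2) ^ k)%R).
  - intros k. destruct (Nat.le_gt_cases k N) as [H|H]; [apply HM, H|].
    induction H as [|k H IH].
    + eapply Rle_trans; [apply Hhalf; lia|]. simpl. specialize (HM N (Nat.le_refl _)). lra.
    + eapply Rle_trans; [apply Hhalf; lia|]. simpl. lra.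
  - apply bounded_sums_scal; [easy|]. apply bounded_sums_geom; lra.
Qed.

Lemma abs_summable_gauss (p w : C) : p <> 0 -> (Cmod p < 1)%R -> w <> 0 -> abs_summable (fun n => gauss p n * CpowerZ w n).
Proof.
  intros Hp Hp1 Hw. pose proof (Cmod_ge_0 p). apply bounded_sums_Z.
  - intros; apply Cmod_ge_0.
  - apply (bounded_sums_superexp _ (Cmod w) (Cmod p)); try apply Cmod_ge_0; [lra|intros; apply Cmod_ge_0|].
    intros k. replace (Z.of_nat (S k)) with (Z.of_nat k + 1)%Z by lia.
    rewrite gauss_succ, CpowerZ_succ, CpowerZ_nat by easy.
    rewrite !Cmod_mult, Cmod_opp, !Cmod_pow. right; ring.
  - apply (bounded_sums_superexp _ (Cmod (/ w) * Cmod p) (Cmod p)); [|lra|intros; apply Cmod_ge_0|].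
    { apply Rmult_le_pos; apply Cmod_ge_0. }
    intros k. rewrite !gauss_opp, !CpowerZ_opp by easy.
    replace (Z.of_nat (S k)) with (Z.of_nat k + 1)%Z by lia.
    rewrite gauss_succ, !CpowerZ_succ, CpowerZ_nat by easy.
    pose proof (CpowerZ_nz w (Z.of_nat k) Hw).
    replace (/ (w * CpowerZ w (Z.of_nat k))) with (/ w * / CpowerZ w (Z.of_nat k)) by (field; auto).
    rewrite !Cmod_mult, Cmod_opp, !Cmod_pow. right; ring.
Qed.

Definition theta_series (p w : C) : C := tsum (fun n => gauss p n * CpowerZ w n).

Lemma tsum_Z_shift (f : Z -> C) m : abs_summable f -> tsum (fun n => f (n + m)%Z) = tsum f.
Proof.
  intros H. apply (tsum_bij f (fun n => n + m)%Z (fun n => n - m)%Z); [intros; lia|intros; lia|easy].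
Qed.

Lemma tsum_Z_refl (f : Z -> C) m : abs_summable f -> tsum (fun n => f (m - n)%Z) = tsum f.
Proof.
  intros H. apply (tsum_bij f (fun n => m - n)%Z (fun n => m - n)%Z); [intros; lia|intros; lia|easy].
Qed.

Lemma abs_summable_Z_refl (f : Z -> C) m : abs_summable f -> abs_summable (fun n => f (m - n)%Z).
Proof. intros H. apply (bounded_sums_inj (fun n => Cmod (f n)) (fun n => m - n)%Z); [lia|easy]. Qed.

Lemma abs_summable_Z_shift (f : Z -> C) m : abs_summable f -> abs_summable (fun n => f (n + m)%Z).
Proof. intros H. apply (bounded_sums_inj (fun n => Cmod (f n)) (fun n => n + m)%Z); [lia|easy]. Qed.

Lemma abs_summable_ext {I : Type} (f g : I -> C) : (forall i, f i = g i) -> abs_summable f -> abs_summable g.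
Proof. intros H; replace g with f; [easy|]. apply functional_extensionality, H. Qed.

Lemma CpowerZ_base1 n : CpowerZ 1 n = 1.
Proof.
  revert n. apply Z_ind2; [easy|]. intros n. rewrite CpowerZ_succ by exact C1_nz.
  rewrite Cmult_1_l. easy.
Qed.

Lemma abs_summable_gauss_1 (p : C) : p <> 0 -> (Cmod p < 1)%R -> abs_summable (gauss p).
Proof.
  intros H0 H1. apply (abs_summable_ext (fun n => gauss p n * CpowerZ 1 n)).
  - intros; rewrite CpowerZ_base1; ring.
  - apply abs_summable_gauss; auto. exact C1_nz.
Qed.

Lemma tsum_gauss (p : C) : p <> 0 -> (Cmod p < 1)%R -> tsum (gauss p) = 0.
Proof.
  intros H0 H1. pose proof (abs_summable_gauss_1 p H0 H1) as H.
  assert (E : tsum (gauss p) = -(1) * tsum (gauss p)).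
  { rewrite <- tsum_scal by easy. rewrite <- (tsum_Z_refl (gauss p) 1 H) at 1.
    apply tsum_ext. intros n. rewrite gauss_refl by easy. ring. }
  assert (E2 : 2 * tsum (gauss p) = 0).
  { transitivity (tsum (gauss p) + tsum (gauss p)); [ring|]. rewrite E at 1. ring. }
  apply (Cmult_cancel_l 2); [|rewrite E2; ring].
  intros E3. apply RtoC_inj in E3. lra.
Qed.

(** * Reciprocal theta sums *)

(** X avoids the spiral of poles of the bilateral fractions 1 / (1 - X p^n). *)
Definition avoids_powers (p X : C) : Prop := forall n : Z, X * CpowerZ p n <> 1.

(** 1 / (1 - z p^n) converges, so it is bounded. *)
Lemma regular_delta (p z : C) : (Cmod p < 1)%R -> phi21_regular p z ->
  exists d, (0 < d)%R /\ forall n, (d <= Cmod (1 - z * p ^ n))%R.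
Proof.
  intros Hp1 Hx.
  assert (Hl : clim (fun n => / (1 - z * p ^ n)) (/ 1)).
  { apply clim_inv; [exact C1_nz|].
    replace (RtoC 1) with (1 + (- z) * 0) by ring.
    apply (clim_ext (fun n => 1 + (- z) * p ^ n)); [intros; ring|].
    apply clim_plus; [apply clim_const|]. apply clim_mult; [apply clim_const|apply clim_pow, Hp1]. }
  destruct (clim_bounded _ _ Hl) as (M & HM & HB). exists (/ (M + 1))%R.
  split; [apply Rinv_0_lt_compat; lra|]. intros n. specialize (HB n).
  assert (Hnz : 1 - z * p ^ n <> 0) by (apply one_minus_nz, Hx).
  rewrite Cmod_inv in HB by easy. pose proof (proj1 (Cmod_gt_0 _) Hnz) as Hgt.
  apply Rmult_le_reg_r with (M + 1)%R; [lra|]. rewrite Rinv_l by lra.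
  apply Rle_trans with (Cmod (1 - z * p ^ n) * / Cmod (1 - z * p ^ n))%R;
    [rewrite Rinv_r; lra|]. apply Rmult_le_compat_l; lra.
Qed.

(** For negative n write 1 - X p^n = - X p^n (1 - p^(-n) / X). *)
Lemma avoids_powers_delta (p X : C) : p <> 0 -> (Cmod p < 1)%R -> X <> 0 -> avoids_powers p X ->
  exists d, (0 < d)%R /\ forall n, (d <= Cmod (1 - X * CpowerZ p n))%R.
Proof.
  intros Hp Hp1 HX H.
  destruct (regular_delta p X Hp1) as (d1 & Hd1 & K1).
  { intros n. rewrite <- CpowerZ_nat. apply H. }
  destruct (regular_delta p (/ X) Hp1) as (d2 & Hd2 & K2).
  { intros n E. apply (H (- Z.of_nat n)%Z). rewrite CpowerZ_neg_nat.
    pose proof (Cpow_nz p n Hp).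
    assert (p ^ n = X) as ->; [|field; easy].
    transitivity (X * (/ X * p ^ n)); [field; easy|]. rewrite E; ring. }
  pose proof (proj1 (Cmod_gt_0 X) HX) as HX'.
  exists (Rmin d1 (d2 * Cmod X)). split; [apply Rmin_pos; [easy|apply Rmult_lt_0_compat; easy]|].
  intros n. destruct (Z_le_gt_dec 0 n) as [Hn|Hn].
  - eapply Rle_trans; [apply Rmin_l|]. rewrite <- (Z2Nat.id n) by easy. rewrite CpowerZ_nat. apply K1.
  - eapply Rle_trans; [apply Rmin_r|]. replace n with (- Z.of_nat (Z.to_nat (- n)))%Z by lia.
    rewrite CpowerZ_neg_nat. specialize (K2 (Z.to_nat (- n))). set (k := Z.to_nat (- n)) in *.
    pose proof (Cpow_nz p k Hp).
    replace (1 - X * / p ^ k) with (- (X * (1 - / X * p ^ k)) * / p ^ k) by (field; easy).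
    rewrite Cmod_mult, Cmod_opp, Cmod_mult, Cmod_inv by easy.
    assert (1 <= / Cmod (p ^ k))%R.
    { rewrite <- Rinv_1. apply Rinv_le_contravar; [apply Cmod_gt_0; easy|].
      rewrite Cmod_pow, <- (pow1 k). apply pow_incr. split; [apply Cmod_ge_0|lra]. }
    set (y := Cmod (1 - / X * p ^ k)) in *. set (w := (/ Cmod (p ^ k))%R) in *.
    assert (0 <= Cmod X * y)%R by (apply Rmult_le_pos; lra).
    apply Rle_trans with (Cmod X * y * 1)%R; [rewrite Rmult_1_r, Rmult_comm; apply Rmult_le_compat_l; lra|].
    apply Rmult_le_compat_l; lra.
Qed.

Lemma Cmod_inv_le (z : C) d : (0 < d)%R -> (d <= Cmod z)%R -> (Cmod (/ z) <= / d)%R.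
Proof.
  intros Hd H. assert (z <> 0) by (apply Cmod_gt_0; lra). rewrite Cmod_inv by easy.
  apply Rinv_le_contravar; easy.
Qed.

(** The coefficient of w^r in the product of the theta series in w with
    sum_n w^n / (1 - X p^n). *)
Definition theta_recip (p X : C) (r : Z) : C := tsum (fun n => gauss p (r - n) * / (1 - X * CpowerZ p n)).

Lemma abs_summable_theta_recip (p X : C) r : p <> 0 -> (Cmod p < 1)%R -> X <> 0 -> avoids_powers p X ->
  abs_summable (fun n => gauss p (r - n) * / (1 - X * CpowerZ p n)).
Proof.
  intros Hp Hp1 HX H. destruct (avoids_powers_delta p X Hp Hp1 HX H) as (d & Hd & K).
  apply (abs_summable_ext (fun n => / (1 - X * CpowerZ p n) * gauss p (r - n))); [intros; ring|].
  apply (abs_summable_mul_bounded _ _ (/ d)).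
  - intros n. apply Cmod_inv_le; auto.
  - apply abs_summable_Z_refl, abs_summable_gauss_1; easy.
Qed.

(** gauss (r+1-n) + p^r X gauss (r-n) is gauss (r+1-n) (1 - X p^n), which cancels
    the denominator and leaves the theta series at 1. *)
Lemma theta_recip_succ (p X : C) r : p <> 0 -> (Cmod p < 1)%R -> X <> 0 -> avoids_powers p X ->
  theta_recip p X (r + 1) = - CpowerZ p r * X * theta_recip p X r.
Proof.
  intros Hp Hp1 HX H.
  assert (E : theta_recip p X (r + 1) + (CpowerZ p r * X) * theta_recip p X r = 0).
  { unfold theta_recip. rewrite <- tsum_scal by (apply abs_summable_theta_recip; easy).
    rewrite <- tsum_plus by (try apply abs_summable_scal; apply abs_summable_theta_recip; easy).
    etransitivity; [|apply (tsum_gauss p Hp Hp1)].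
    rewrite <- (tsum_Z_refl (gauss p) (r + 1)) by (apply abs_summable_gauss_1; easy).
    apply tsum_ext. intros n.
    replace (r + 1 - n)%Z with (r - n + 1)%Z by lia. rewrite gauss_succ by easy.
    unfold Z.sub. rewrite CpowerZ_add, CpowerZ_opp by easy.
    pose proof (CpowerZ_nz p n Hp). specialize (H n). apply one_minus_nz in H. field; split; easy. }
  transitivity (theta_recip p X (r + 1) + CpowerZ p r * X * theta_recip p X r - CpowerZ p r * X * theta_recip p X r);
    [ring|rewrite E; ring].
Qed.

Lemma theta_recip_eq (p X : C) r : p <> 0 -> (Cmod p < 1)%R -> X <> 0 -> avoids_powers p X ->
  theta_recip p X r = gauss p r * CpowerZ X r * theta_recip p X 0.
Proof.
  intros Hp Hp1 HX H. revert r. apply Z_ind2; [rewrite gauss_0; simpl; ring|].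
  intros r. rewrite theta_recip_succ, gauss_succ, CpowerZ_succ by easy.
  pose proof (CpowerZ_nz p r Hp). split; intros E; [rewrite E; ring|].
  apply (Cmult_cancel_l (- CpowerZ p r * X)); [|rewrite E; ring].
  apply Cmult_neq_0; [|easy]. intros E'. apply H0.
  transitivity (- - CpowerZ p r); [ring|rewrite E'; ring].
Qed.

(** * Finite partial fractions *)

(** The Gaussian binomial coefficient with its sign and power of p, divided by
    (p; p)_K; it is set to 0 for k > K so that sums may run past K. *)
Definition qbin_coef (p : C) (K k : nat) : C :=
  if (k <=? K)%nat then gauss p (Z.of_nat k) / (qpoch p p k * qpoch p p (K - k)) else 0.

Lemma qbin_coef_out (p : C) (K k : nat) : (K < k)%nat -> qbin_coef p K k = 0.
Proof. intros H. unfold qbin_coef. destruct (Nat.leb_spec k K); [lia|easy]. Qed.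

Lemma qbin_coef_in (p : C) (K k : nat) : (k <= K)%nat -> qbin_coef p K k = gauss p (Z.of_nat k) / (qpoch p p k * qpoch p p (K - k)).
Proof. intros H. unfold qbin_coef. destruct (Nat.leb_spec k K); [easy|lia]. Qed.

Lemma one_minus_pow_nz (p : C) k : (Cmod p < 1)%R -> 1 - p ^ S k <> 0.
Proof. intros Hp. apply one_minus_nz. exact (small_regular p p Hp Hp k). Qed.

Lemma qbin_coef_0 (p : C) K : (Cmod p < 1)%R -> (1 - p ^ S K) * qbin_coef p (S K) 0 = qbin_coef p K 0.
Proof.
  intros Hp. rewrite !qbin_coef_in by lia. rewrite !Nat.sub_0_r. simpl qpoch.
  pose proof (qpoch_pp_nz p K Hp). pose proof (one_minus_pow_nz p K Hp). simpl in *. field; repeat split; try easy; exact C1_nz.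
Qed.

Lemma gauss_S (p : C) k : p <> 0 -> gauss p (Z.of_nat (S k)) = - p ^ k * gauss p (Z.of_nat k).
Proof.
  intros Hp. replace (Z.of_nat (S k)) with (Z.of_nat k + 1)%Z by lia.
  rewrite gauss_succ, CpowerZ_nat by easy. easy.
Qed.

Lemma qbin_coef_pascal (p : C) (K k : nat) : p <> 0 -> (Cmod p < 1)%R ->
  (1 - p ^ S K) * qbin_coef p (S K) (S k) = p ^ S k * qbin_coef p K (S k) - p ^ k * qbin_coef p K k.
Proof.
  intros Hp0 Hp. destruct (Nat.lt_trichotomy k K) as [H|[H|H]].
  - destruct (Nat.le_exists_sub (S k) K) as (j & -> & _); [lia|].
    rewrite !qbin_coef_in by lia.
    replace (S (j + S k) - S k)%nat with (S j) by lia.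
    replace (j + S k - S k)%nat with j by lia. replace (j + S k - k)%nat with (S j) by lia.
    rewrite gauss_S by easy. simpl qpoch.
    pose proof (qpoch_pp_nz p k Hp). pose proof (qpoch_pp_nz p j Hp). pose proof (one_minus_pow_nz p k Hp). pose proof (one_minus_pow_nz p j Hp).
    replace (p ^ S (j + S k)) with (p ^ S j * p ^ S k) by (rewrite <- Cpow_add_r; f_equal; lia).
    simpl in *. field. repeat split; easy.
  - subst k. rewrite (qbin_coef_out p K (S K)) by lia. rewrite !qbin_coef_in by lia.
    rewrite !Nat.sub_diag. rewrite gauss_S by easy. simpl qpoch.
    pose proof (qpoch_pp_nz p K Hp). pose proof (one_minus_pow_nz p K Hp). simpl in *. field;
    repeat split; try easy; exact C1_nz.
  - rewrite !qbin_coef_out by lia. ring.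
Qed.

Lemma qbin_coef_pascal_dual (p : C) (K k : nat) : p <> 0 -> (Cmod p < 1)%R -> (k <= K)%nat ->
  (1 - p ^ S K) * qbin_coef p (S K) (S k) * p ^ S k = qbin_coef p K (S k) * p ^ S k - p ^ S K * qbin_coef p K k * p ^ k.
Proof.
  intros Hp0 Hp Hk. destruct (Nat.eq_dec k K) as [->|H].
  - rewrite (qbin_coef_out p K (S K)) by lia. rewrite !qbin_coef_in by lia.
    rewrite !Nat.sub_diag. rewrite gauss_S by easy. simpl qpoch.
    pose proof (qpoch_pp_nz p K Hp). pose proof (one_minus_pow_nz p K Hp). simpl in *. field;
    repeat split; try easy; exact C1_nz.
  - destruct (Nat.le_exists_sub (S k) K) as (j & -> & _); [lia|].
    rewrite !qbin_coef_in by lia.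
    replace (S (j + S k) - S k)%nat with (S j) by lia.
    replace (j + S k - S k)%nat with j by lia. replace (j + S k - k)%nat with (S j) by lia.
    rewrite gauss_S by easy. simpl qpoch.
    pose proof (qpoch_pp_nz p k Hp). pose proof (qpoch_pp_nz p j Hp). pose proof (one_minus_pow_nz p k Hp). pose proof (one_minus_pow_nz p j Hp).
    replace (p ^ S (j + S k)) with (p ^ S j * p ^ S k) by (rewrite <- Cpow_add_r; f_equal; lia).
    simpl in *. field. repeat split; easy.
Qed.

Lemma lsum_seq_S (f : nat -> C) n : lsum f (seq 0 (S n)) = f O + lsum (fun k => f (S k)) (seq 0 n).
Proof. rewrite <- (lsum_map f S), seq_shift. easy. Qed.

Lemma lsum_seq_last (f : nat -> C) n : lsum f (seq 0 (S n)) = lsum f (seq 0 n) + f n.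
Proof. rewrite seq_S, lsum_app. simpl. ring. Qed.

Lemma finite_qbin (p : C) (K : nat) (w : C) : p <> 0 -> (Cmod p < 1)%R ->
  qpoch p p K * lsum (fun k => qbin_coef p K k * w ^ k) (seq 0 (S K)) = qpoch w p K.
Proof.
  intros Hp0 Hp. revert w. induction K; intros w.
  - simpl. rewrite qbin_coef_in by lia. simpl. rewrite gauss_0. field; try exact C1_nz.
  - rewrite (qpoch_left w), <- (IHK (w * p)). simpl qpoch. rewrite (lsum_seq_S _ (S K)).
    set (P := qpoch p p K). 
    replace (P * (1 - p * p ^ K) *
      (qbin_coef p (S K) 0 * w ^ 0 + lsum (fun k : nat => qbin_coef p (S K) (S k) * w ^ S k) (seq 0 (S K))))
      with (P * ((1 - p ^ S K) * qbin_coef p (S K) 0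
         + lsum (fun k : nat => (1 - p ^ S K) * (qbin_coef p (S K) (S k) * w ^ S k)) (seq 0 (S K))))
      by (rewrite lsum_scal; simpl; ring).
    rewrite qbin_coef_0 by easy.
    rewrite (lsum_ext_in _ (fun k => qbin_coef p K (S k) * (w * p) ^ S k + (- w) * (qbin_coef p K k * (w * p) ^ k))).
    2:{ intros k _. rewrite Cmult_assoc, qbin_coef_pascal by easy. rewrite !Cpow_mult_l. simpl. ring. }
    rewrite lsum_plus, lsum_scal.
    assert (E : lsum (fun k => qbin_coef p K k * (w * p) ^ k) (seq 0 (S K))
       = qbin_coef p K 0 + lsum (fun k : nat => qbin_coef p K (S k) * (w * p) ^ S k) (seq 0 (S K))).
    { rewrite lsum_seq_S, lsum_seq_last. rewrite (qbin_coef_out p K (S K)) by lia. simpl. ring. }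
    rewrite E. simpl. ring.
Qed.

(** Induction on K from
    (1 - p^(K+1)) / (Y)_(K+2) = 1 / (Y)_(K+1) - p^(K+1) / (Yp)_(K+1)
    and the second Pascal rule. *)
Lemma finite_partial_fractions (p : C) (K : nat) (Y : C) : p <> 0 -> (Cmod p < 1)%R -> (forall k, Y * p ^ k <> 1) ->
  lsum (fun k => qbin_coef p K k * p ^ k * / (1 - Y * p ^ k)) (seq 0 (S K)) = / qpoch Y p (S K).
Proof.
  intros Hp0 Hp. revert Y. induction K; intros Y HY.
  - simpl. rewrite qbin_coef_in by lia. simpl. rewrite gauss_0. specialize (HY O). simpl in HY.
    apply one_minus_nz in HY. rewrite Cmult_1_r in *. field. repeat split; try easy; exact C1_nz.
  - assert (HY' : forall k, Y * p * p ^ k <> 1) by (intros k; rewrite <- Cmult_assoc; apply (HY (S k))).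
    pose proof (one_minus_pow_nz p K Hp) as Hn. apply (Cmult_cancel_l (1 - p ^ S K)); [easy|].
    transitivity (/ qpoch Y p (S K) - p ^ S K * / qpoch (Y * p) p (S K)).
    + rewrite <- !IHK by easy. rewrite (lsum_seq_S _ (S K)), Cmult_plus_distr_l, <- lsum_scal.
      rewrite (lsum_ext_in _ (fun k => qbin_coef p K (S k) * p ^ S k * / (1 - Y * p ^ S k)
         + (- p ^ S K) * (qbin_coef p K k * p ^ k * / (1 - Y * p * p ^ k)))).
      2:{ intros k Hk. apply in_seq in Hk.
          replace (1 - Y * p * p ^ k) with (1 - Y * p ^ S k) by (simpl; ring).
          rewrite !Cmult_assoc, qbin_coef_pascal_dual by (easy || lia). ring. }
      rewrite lsum_plus, lsum_scal.
      assert (E : lsum (fun k => qbin_coef p K k * p ^ k * / (1 - Y * p ^ k)) (seq 0 (S K))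
       = qbin_coef p K 0 * / (1 - Y) + lsum (fun k : nat => qbin_coef p K (S k) * p ^ S k * / (1 - Y * p ^ S k)) (seq 0 (S K))).
      { rewrite lsum_seq_S, lsum_seq_last. rewrite (qbin_coef_out p K (S K)) by lia. simpl.
        rewrite !Cmult_1_r. ring. }
      rewrite E. replace ((1 - p ^ S K) * (qbin_coef p (S K) 0 * p ^ 0 * / (1 - Y * p ^ 0)))
        with (((1 - p ^ S K) * qbin_coef p (S K) 0) * / (1 - Y)) by (simpl; rewrite !Cmult_1_r; ring).
      rewrite qbin_coef_0 by easy. ring.
    + assert (N1 : forall n, qpoch Y p n <> 0) by (intros; apply qpoch_nz, HY).
      assert (N2 : forall n, qpoch (Y * p) p n <> 0) by (intros; apply qpoch_nz, HY').
      assert (HA : 1 - Y * p ^ S K <> 0) by apply one_minus_nz, HY.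
      assert (HB : 1 - Y <> 0) by (apply one_minus_nz; specialize (HY O); simpl in HY; rewrite Cmult_1_r in HY; easy).
      rewrite (qpoch_left Y p (S K)).
      replace (/ qpoch Y p (S K)) with ((1 - Y * p ^ S K) * / (qpoch Y p (S K) * (1 - Y * p ^ S K)))
        by (specialize (N1 (S K)); field; split; easy).
      change (qpoch Y p (S K) * (1 - Y * p ^ S K)) with (qpoch Y p (S (S K))).
      rewrite (qpoch_left Y p (S K)). specialize (N2 (S K)). set (W := qpoch (Y * p) p (S K)) in *.
      field. split; easy.
Qed.

(** Induction on r: the sum for r + 1 minus Y times the sum for r has no
    denominators left; it is a multiple of (p^(-r); p)_K, which vanishes for r < K. *)
Lemma finite_partial_fractions_pow (p : C) (K : nat) (Y : C) (r : nat) : p <> 0 -> (Cmod p < 1)%R -> (forall k, Y * p ^ k <> 1) -> (r <= K)%nat ->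
  lsum (fun k => qbin_coef p K k * p ^ k * (/ p ^ r) ^ k * / (1 - Y * p ^ k)) (seq 0 (S K))
  = Y ^ r * / qpoch Y p (S K).
Proof.
  intros Hp0 Hp HY Hr. induction r.
  - rewrite <- finite_partial_fractions by easy. rewrite Cmult_1_l. apply lsum_ext_in. intros k _.
    replace (/ p ^ 0) with (RtoC 1) by (simpl; field; exact C1_nz). rewrite Cpow_1_l. ring.
  - assert (E : lsum (fun k => qbin_coef p K k * p ^ k * (/ p ^ S r) ^ k * / (1 - Y * p ^ k)) (seq 0 (S K))
      + (- Y) * lsum (fun k => qbin_coef p K k * p ^ k * (/ p ^ r) ^ k * / (1 - Y * p ^ k)) (seq 0 (S K)) = 0).
    { rewrite <- lsum_scal, <- lsum_plus.
      rewrite (lsum_ext_in _ (fun k => qbin_coef p K k * (/ p ^ r) ^ k)).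
      - apply (Cmult_cancel_l (qpoch p p K)); [apply qpoch_pp_nz, Hp|].
        rewrite finite_qbin by easy.
        replace K with (S r + (K - S r))%nat by lia. rewrite qpoch_add. simpl.
        pose proof (Cpow_nz p r Hp0). replace (/ p ^ r * p ^ r) with (RtoC 1) by (field; easy). ring.
      - intros k _. pose proof (one_minus_nz _ (HY k)).
        replace ((/ p ^ r) ^ k) with (p ^ k * (/ p ^ S r) ^ k).
        + field; easy.
        + rewrite <- Cpow_mult_l. f_equal. simpl. pose proof (Cpow_nz p r Hp0). field; split; easy. }
    rewrite IHr in E by lia.
    transitivity (Y * (Y ^ r * / qpoch Y p (S K))); [|change (Y ^ S r) with (Y * Y ^ r); ring].
    apply Ceq_minus. rewrite <- E. ring.
Qed.

(** * Theta functions *)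

(** Reverses the order of the N factors 1 - X p^(-j), 1 <= j <= N, which
    symmetrizes the finite identities around the index N. *)
Lemma shifted_qpoch (p X : C) N : p <> 0 -> X <> 0 ->
  gauss p (- Z.of_nat N) * / X ^ N * qpoch (X * / p ^ N) p N = qpoch (p / X) p N.
Proof.
  intros Hp HX. induction N.
  - simpl. rewrite gauss_0. field; try exact C1_nz.
  - rewrite qpoch_left. pose proof (Cpow_nz p N Hp) as HN. pose proof (Cpow_nz X N HX) as HXN.
    replace (X * / p ^ S N * p) with (X * / p ^ N) by (simpl; field; auto).
    change (qpoch (p / X) p (S N)) with (qpoch (p / X) p N * (1 - p / X * p ^ N)). rewrite <- IHN.
    rewrite !gauss_opp, gauss_S by easy. rewrite !CpowerZ_nat. simpl. field. repeat split; auto.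
Qed.

Definition centered_range (N : nat) : list Z :=
  map (fun k => Z.of_nat k - Z.of_nat N)%Z (seq 0 (S (N + N))).

Lemma centered_range_NoDup N : NoDup (centered_range N).
Proof.
  apply FinFun.Injective_map_NoDup; [|apply seq_NoDup]. intros a b; lia.
Qed.

Lemma centered_range_In N n : In n (centered_range N) <-> (Z.abs n <= Z.of_nat N)%Z.
Proof.
  unfold centered_range. rewrite in_map_iff. split.
  - intros (k & <- & Hk). apply in_seq in Hk. lia.
  - intros H. exists (Z.to_nat (n + Z.of_nat N)). split; [lia|]. apply in_seq. lia.
Qed.

(** The weight of the index n + N in a finite identity of order 2N. *)
Definition central_coef (p : C) (N : nat) (n : Z) : C :=
  if (Z.abs n <=? Z.of_nat N)%Z
  then / qpoch p p (Z.to_nat (Z.of_nat N + n)) * / qpoch p p (Z.to_nat (Z.of_nat N - n)) else 0.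

Lemma central_coef_bound (p : C) : (Cmod p < 1)%R -> exists M, forall N n, (Cmod (central_coef p N n) <= M)%R.
Proof.
  intros Hp. destruct (qpoch_inv_bound p p Hp (small_regular p p Hp Hp)) as [M HM].
  assert (0 <= M)%R by (eapply Rle_trans; [apply Cmod_ge_0|apply (HM O)]).
  exists (M * M)%R. intros N n. unfold central_coef. destruct (Z.abs n <=? Z.of_nat N)%Z.
  - rewrite Cmod_mult. apply Rmult_le_compat; try apply Cmod_ge_0; apply HM.
  - rewrite Cmod_0. nra.
Qed.

Lemma central_coef_clim (p : C) n : (Cmod p < 1)%R ->
  clim (fun N => central_coef p N n) (/ qpoch_inf p p * / qpoch_inf p p).
Proof.
  intros Hp. pose proof (qpoch_inf_nz p p Hp (small_regular p p Hp Hp)) as Hq.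
  apply (clim_ext_ev (fun N => / qpoch p p (Z.to_nat (Z.of_nat N + n)) *
            / qpoch p p (Z.to_nat (Z.of_nat N - n))) _ _ (Z.to_nat (Z.abs n))).
  - intros N HN. unfold central_coef. destruct (Z.leb_spec (Z.abs n) (Z.of_nat N)); [easy|lia].
  - apply clim_mult.
    + apply (clim_comp (fun k => / qpoch p p k)); [|apply clim_inv; [easy|apply qpoch_clim, Hp]].
      intros m. exists (m + Z.to_nat (Z.abs n))%nat. intros; lia.
    + apply (clim_comp (fun k => / qpoch p p k)); [|apply clim_inv; [easy|apply qpoch_clim, Hp]].
      intros m. exists (m + Z.to_nat (Z.abs n))%nat. intros; lia.
Qed.

Lemma central_coef_sum (p : C) N (h : Z -> C) :
  tsum (fun n => central_coef p N n * h n)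
  = lsum (fun k => / qpoch p p k * / qpoch p p (N + N - k) * h (Z.of_nat k - Z.of_nat N)%Z)
      (seq 0 (S (N + N))).
Proof.
  apply tsum_unique.
  replace (lsum _ _) with (lsum (fun n => central_coef p N n * h n) (centered_range N)).
  - apply has_sum_finite; [apply centered_range_NoDup|]. intros n Hn. rewrite centered_range_In in Hn.
    unfold central_coef. destruct (Z.leb_spec (Z.abs n) (Z.of_nat N)); [lia|ring].
  - unfold centered_range. rewrite lsum_map. apply lsum_ext_in. intros k Hk. apply in_seq in Hk.
    unfold central_coef. destruct (Z.leb_spec (Z.abs (Z.of_nat k - Z.of_nat N)) (Z.of_nat N)); [|lia].
    repeat f_equal; lia.
Qed.

Lemma gauss_center (p : C) k N : p <> 0 ->
  gauss p (Z.of_nat k - Z.of_nat N) = gauss p (Z.of_nat k) * gauss p (- Z.of_nat N) * (/ p ^ N) ^ k.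
Proof.
  intros Hp. unfold Z.sub. rewrite gauss_add by easy. f_equal.
  replace (Z.of_nat k * - Z.of_nat N)%Z with (- Z.of_nat (N * k))%Z by lia.
  rewrite CpowerZ_neg_nat, Cpow_mult_r, Cpow_inv; [easy|]. apply Cpow_nz, Hp.
Qed.

Lemma CpowerZ_center (w : C) k N : w <> 0 ->
  CpowerZ w (Z.of_nat k - Z.of_nat N) = w ^ k * / w ^ N.
Proof. intros Hw. unfold Z.sub. rewrite CpowerZ_add, CpowerZ_neg_nat, CpowerZ_nat by easy. easy. Qed.

(** The finite q-binomial identity of order 2N, recentred at N, as N tends to
    infinity. *)
Lemma jacobi_triple_product (p w : C) : p <> 0 -> (Cmod p < 1)%R -> w <> 0 ->
  theta_series p w = qpoch_inf p p * theta w p.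
Proof.
  intros Hp Hp1 Hw. pose proof (qpoch_inf_nz p p Hp1 (small_regular p p Hp1 Hp1)) as Hq.
  destruct (central_coef_bound p Hp1) as [M HM].
  assert (H1 : clim (fun N => qpoch p p (N + N) * tsum (fun n => central_coef p N n * (gauss p n * CpowerZ w n)))
     (qpoch_inf p p * (/ qpoch_inf p p * / qpoch_inf p p * theta_series p w))).
  { apply clim_mult.
    - apply (clim_comp (qpoch p p)); [|apply qpoch_clim, Hp1]. intros n; exists n; intros; lia.
    - unfold theta_series. rewrite <- tsum_scal by (apply abs_summable_gauss; easy).
      apply (tannery _ _ (fun n => M * Cmod (gauss p n * CpowerZ w n))%R).
      + apply bounded_sums_scal; [|apply abs_summable_gauss; easy]. eapply Rle_trans; [apply Cmod_ge_0|apply (HM O 0%Z)].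
      + intros N n. rewrite Cmod_mult. apply Rmult_le_compat_r; [apply Cmod_ge_0|apply HM].
      + intros n. apply clim_mult; [apply central_coef_clim, Hp1|apply clim_const]. }
  assert (H2 : clim (fun N => qpoch p p (N + N) * tsum (fun n => central_coef p N n * (gauss p n * CpowerZ w n)))
     (theta w p)).
  { apply (clim_ext (fun N => qpoch w p N * qpoch (p / w) p N)).
    - intros N. rewrite central_coef_sum.
      rewrite (lsum_ext_in _ (fun k => (gauss p (- Z.of_nat N) * / w ^ N) *
                (qbin_coef p (N + N) k * (w * / p ^ N) ^ k))).
      + rewrite lsum_scal.
        transitivity (gauss p (- Z.of_nat N) * / w ^ N * (qpoch p p (N + N) *
            lsum (fun k => qbin_coef p (N + N) k * (w * / p ^ N) ^ k) (seq 0 (S (N + N))))); [|ring].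
        rewrite finite_qbin by easy. rewrite qpoch_add.
        replace (w * / p ^ N * p ^ N) with w by (pose proof (Cpow_nz p N Hp); field; easy).
        rewrite <- (shifted_qpoch p w N) by easy. ring.
      + intros k Hk. apply in_seq in Hk. rewrite gauss_center, CpowerZ_center, qbin_coef_in by (easy || lia).
        rewrite Cpow_mult_l. pose proof (qpoch_pp_nz p k Hp1). pose proof (qpoch_pp_nz p (N + N - k) Hp1).
        pose proof (Cpow_nz w N Hw). field. repeat split; easy.
    - apply clim_mult; apply qpoch_clim, Hp1. }
  pose proof (clim_unique _ _ _ H1 H2) as E. rewrite <- E. field; easy.
Qed.

Lemma avoids_powers_pos (p X : C) : p <> 0 -> avoids_powers p X -> forall N k, X * / p ^ N * p ^ k <> 1.
Proof.
  intros Hp H N k. specialize (H (Z.of_nat k - Z.of_nat N)%Z). rewrite CpowerZ_center in H by easy.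
  intros E; apply H. rewrite <- E. ring.
Qed.

Lemma avoids_powers_theta (p X : C) : p <> 0 -> (Cmod p < 1)%R -> X <> 0 -> avoids_powers p X -> theta X p <> 0.
Proof.
  intros Hp Hp1 HX H. unfold theta. apply Cmult_neq_0; apply qpoch_inf_nz; try easy; intros k.
  - rewrite <- CpowerZ_nat. apply H.
  - intros E. apply (H (- Z.of_nat (S k))%Z). rewrite CpowerZ_neg_nat. simpl.
    pose proof (Cpow_nz p k Hp).
    assert (X = p * p ^ k) as ->; [|field; easy].
    transitivity (X * (p / X * p ^ k)); [rewrite E; ring|field; easy].
Qed.

(** The partial fractions of 1 / theta(X): the finite expansion of order 2N with
    numerator Y^N at Y = X p^(-N), recentred at N, as N tends to infinity. *)
Lemma theta_recip_0 (p X : C) : p <> 0 -> (Cmod p < 1)%R -> X <> 0 -> avoids_powers p X ->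
  theta_recip p X 0 * theta X p = qpoch_inf p p * qpoch_inf p p.
Proof.
  intros Hp Hp1 HX HR. pose proof (qpoch_inf_nz p p Hp1 (small_regular p p Hp1 Hp1)) as Hq.
  pose proof (avoids_powers_theta p X Hp Hp1 HX HR) as Hth.
  destruct (central_coef_bound p Hp1) as [M HM].
  set (h := fun n => gauss p n * CpowerZ p n * / (1 - X * CpowerZ p n)).
  assert (Hh : forall n, gauss p (0 - n) * / (1 - X * CpowerZ p n) = h n).
  { intros n. simpl Z.sub. rewrite gauss_opp by easy. unfold h. ring. }
  assert (Hab : abs_summable h) by (apply (abs_summable_ext _ _ Hh), abs_summable_theta_recip; easy).
  assert (HL : theta_recip p X 0 = tsum h) by (apply tsum_ext, Hh).
  assert (H1 : clim (fun N => tsum (fun n => central_coef p N n * h n))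
     (/ qpoch_inf p p * / qpoch_inf p p * theta_recip p X 0)).
  { rewrite HL. rewrite <- tsum_scal by easy.
    apply (tannery _ _ (fun n => M * Cmod (h n))%R).
    - apply bounded_sums_scal; [|easy]. eapply Rle_trans; [apply Cmod_ge_0|apply (HM O 0%Z)].
    - intros N n. rewrite Cmod_mult. apply Rmult_le_compat_r; [apply Cmod_ge_0|apply HM].
    - intros n. apply clim_mult; [apply central_coef_clim, Hp1|apply clim_const]. }
  assert (H2 : clim (fun N => tsum (fun n => central_coef p N n * h n)) (/ theta X p)).
  { apply (clim_ext (fun N => / (qpoch X p (S N) * qpoch (p / X) p N))).
    - intros N. rewrite central_coef_sum.
      pose proof (avoids_powers_pos p X Hp HR N) as HRN.
      pose proof (Cpow_nz p N Hp) as HpN. pose proof (Cpow_nz X N HX) as HXN.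
      rewrite (lsum_ext_in _ (fun k => (gauss p (- Z.of_nat N) * / p ^ N) *
                (qbin_coef p (N + N) k * p ^ k * (/ p ^ N) ^ k * / (1 - X * / p ^ N * p ^ k)))).
      + rewrite lsum_scal, finite_partial_fractions_pow by (easy || lia).
        replace (S (N + N)) with (N + S N)%nat by lia. rewrite qpoch_add.
        replace (X * / p ^ N * p ^ N) with X by (field; easy).
        rewrite <- (shifted_qpoch p X N) by easy.
        assert (N1 : qpoch X p (S N) <> 0).
        { apply qpoch_nz. intros k. rewrite <- CpowerZ_nat. apply HR. }
        assert (N2 : qpoch (X * / p ^ N) p N <> 0) by (apply qpoch_nz; easy).
        pose proof (gauss_nz p (- Z.of_nat N) Hp) as N3.
        assert (E : gauss p (- Z.of_nat N) * gauss p (- Z.of_nat N) = p ^ N * p ^ (N * N)).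
        { pose proof (gauss_add p (- Z.of_nat N) (Z.of_nat N) Hp) as E1.
          rewrite Z.add_opp_diag_l, gauss_0 in E1.
          rewrite gauss_opp in N3 |- * by easy. rewrite gauss_opp in E1 by easy. rewrite CpowerZ_nat in *.
          replace (- Z.of_nat N * Z.of_nat N)%Z with (- Z.of_nat (N * N))%Z in E1 by lia.
          rewrite CpowerZ_neg_nat in E1. pose proof (Cpow_nz p (N * N) Hp).
          transitivity (p ^ N * p ^ (N * N) *
            (p ^ N * gauss p (Z.of_nat N) * gauss p (Z.of_nat N) * / p ^ (N * N))); [field; easy|].
          rewrite <- E1; ring. }
        rewrite Cpow_mult_l, Cpow_inv by easy. rewrite <- Cpow_mult_r.
        pose proof (Cpow_nz p (N * N) Hp).
        set (a := gauss p (- Z.of_nat N)) in *. set (u := qpoch X p (S N)) in *.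
        set (v := qpoch (X * / p ^ N) p N) in *.
        transitivity ((a * a) * (X ^ N * / (p ^ N * p ^ (N * N)) * / (a * u * v))).
        * rewrite E. field. repeat split; easy.
        * field. repeat split; easy.
      + intros k Hk. apply in_seq in Hk. unfold h. rewrite gauss_center, CpowerZ_center, qbin_coef_in by (easy || lia).
        pose proof (qpoch_pp_nz p k Hp1). pose proof (qpoch_pp_nz p (N + N - k) Hp1).
        pose proof (one_minus_nz _ (HRN k)) as Hd.
        replace (1 - X * (p ^ k * / p ^ N)) with (1 - X * / p ^ N * p ^ k) by ring.
        set (d := 1 - X * / p ^ N * p ^ k) in *. field. repeat split; easy.
    - apply clim_inv; [easy|]. apply clim_mult; [|apply qpoch_clim, Hp1].
      apply -> (clim_shift (qpoch X p)). apply qpoch_clim, Hp1. }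
  pose proof (clim_unique _ _ _ H1 H2) as E.
  transitivity (qpoch_inf p p * qpoch_inf p p * (/ qpoch_inf p p * / qpoch_inf p p * theta_recip p X 0) * theta X p);
    [field; easy|rewrite E; field; easy].
Qed.

Lemma tsum_geom (z : C) : (Cmod z < 1)%R -> tsum (fun m => z ^ m) = / (1 - z).
Proof.
  intros Hz. assert (1 - z <> 0) by (apply one_minus_nz, lt1_ne1, Hz).
  pose proof (tsum_nat_S _ (abs_summable_geom z Hz)) as E.
  cbv beta in E. rewrite (tsum_ext (fun n => z ^ S n) (fun n => z * z ^ n)) in E by easy.
  rewrite tsum_scal in E by (apply abs_summable_geom, Hz). set (T := tsum (fun m => z ^ m)) in *.
  assert (E2 : (1 - z) * T = 1) by (transitivity (T - z * T); [ring|rewrite E at 1; simpl; ring]).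
  transitivity (/ (1 - z) * ((1 - z) * T)); [field; easy|rewrite E2; ring].
Qed.

(** * The bilateral sum of a product of two partial fraction series *)

Definition partial_fractions {K : Type} (p : C) (g : K -> C) (w : K -> nat) (z : C) : C :=
  tsum (fun k => g k * / (1 - z * p ^ w k)).

Definition weighted_series {K : Type} (g : K -> C) (w : K -> nat) (z : C) : C :=
  tsum (fun k => g k * z ^ w k).

Lemma inv_flip (U : C) : U <> 0 -> 1 - U <> 0 -> / (1 - / U) = - U * / (1 - U).
Proof.
  intros H1 H2. assert (H3 : - (1 - U) <> 0).
  { intros E; apply H2. transitivity (- - (1 - U)); [ring|rewrite E; ring]. }
  replace (1 - / U) with (- (1 - U) * / U) by (field; easy).
  set (d := 1 - U) in *. field. repeat split; easy.
Qed.

(** U / (1 - U) stays bounded for large U as well, so a distance from the pole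
    is enough. *)
Lemma flip_bound (U : C) d : (0 < d)%R -> (d <= Cmod (1 - U))%R ->
  (Cmod (- U * / (1 - U)) <= 1 + / d)%R.
Proof.
  intros Hd H. assert (1 - U <> 0) by (apply Cmod_gt_0; lra).
  replace (- U * / (1 - U)) with (1 + (- (1)) * / (1 - U)) by (field; easy).
  eapply Rle_trans; [apply Cmod_triangle|]. rewrite Cmod_mult, Cmod_opp, Cmod_1.
  pose proof (Cmod_inv_le _ d Hd H). lra.
Qed.

Section Bilateral.
Context {K L : Type} (g : K -> C) (wk : K -> nat) (h : L -> C) (wl : L -> nat) (p X : C).
Context (Hp : p <> 0) (Hp1 : (Cmod p < 1)%R) (HX : X <> 0) (HR : avoids_powers p X).

(** F is evaluated at p^(1-n)/X, so its k-th fraction has the pole argument 1/U,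
    and the l-th fraction of G has the pole argument V. *)
Let U (n : Z) (k : K) : C := X * CpowerZ p (n - 1 - Z.of_nat (wk k)).
Let V (n : Z) (l : L) : C := X * CpowerZ p (n + Z.of_nat (wl l)).

Lemma U_nz n k : U n k <> 0.
Proof. apply Cmult_neq_0; [easy|apply CpowerZ_nz, Hp]. Qed.

Lemma V_eq n l : X * CpowerZ p n * p ^ wl l = V n l.
Proof. unfold V. rewrite CpowerZ_add, CpowerZ_nat by easy. ring. Qed.

Lemma U_eq n k : / X * CpowerZ p (1 - n) * p ^ wk k = / U n k.
Proof.
  unfold U. replace (n - 1 - Z.of_nat (wk k))%Z with (- (1 - n + Z.of_nat (wk k)))%Z by lia.
  rewrite CpowerZ_opp, CpowerZ_add, CpowerZ_nat by easy.
  pose proof (CpowerZ_nz p (1 - n) Hp). pose proof (Cpow_nz p (wk k) Hp). field. auto.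
Qed.

Let N (k : K) (l : L) : nat := S (wk k + wl l).

Lemma V_U n k l : V n l = U n k * p ^ N k l.
Proof.
  unfold U, V, N. rewrite <- CpowerZ_nat, <- Cmult_assoc, <- CpowerZ_add by easy. do 2 f_equal. lia.
Qed.

Let kernel (n : Z) (k : K) (l : L) : C := (- U n k * / (1 - U n k)) * / (1 - V n l).

(** As V = U p^(|k|+|l|+1), the difference of the two fractions has numerator
    V - U = - U (1 - p^(|k|+|l|+1)). *)
Lemma kernel_split n k l :
  kernel n k l = / (1 - p ^ N k l) * (/ (1 - V n l) - / (1 - U n k)).
Proof.
  unfold kernel. pose proof (one_minus_pow_nz p (wk k + wl l) Hp1) as H1. fold (N k l) in H1.
  assert (H2 : 1 - U n k <> 0) by apply one_minus_nz, HR.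
  assert (H3 : 1 - V n l <> 0) by apply one_minus_nz, HR.
  rewrite (V_U n k l) in *. field. repeat split; easy.
Qed.

Lemma gauss_kernel_sum r k l :
  tsum (fun n => gauss p (r - n) * kernel n k l)
  = / (1 - p ^ N k l) * theta_recip p X 0 *
    (gauss p (r + Z.of_nat (wl l)) * CpowerZ X (r + Z.of_nat (wl l))
     - gauss p (r - 1 - Z.of_nat (wk k)) * CpowerZ X (r - 1 - Z.of_nat (wk k))).
Proof.
  assert (H : forall m r', (forall n, r' - (n + m) = r - n)%Z ->
     abs_summable (fun n => gauss p (r - n) * / (1 - X * CpowerZ p (n + m))) /\
     tsum (fun n => gauss p (r - n) * / (1 - X * CpowerZ p (n + m)))
      = gauss p r' * CpowerZ X r' * theta_recip p X 0).
  { intros m r' Hr.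
    assert (E : forall n, gauss p (r' - (n + m)) * / (1 - X * CpowerZ p (n + m)) =
                 gauss p (r - n) * / (1 - X * CpowerZ p (n + m))) by (intros; rewrite Hr; easy).
    pose proof (abs_summable_theta_recip p X r' Hp Hp1 HX HR) as Hab. split.
    - apply (abs_summable_ext _ _ E). apply (abs_summable_Z_shift _ m Hab).
    - rewrite <- theta_recip_eq by easy. rewrite <- (tsum_ext _ _ E). apply (tsum_Z_shift _ m Hab). }
  destruct (H (Z.of_nat (wl l)) (r + Z.of_nat (wl l))%Z) as [A1 E1]; [lia|].
  destruct (H (- 1 - Z.of_nat (wk k))%Z (r - 1 - Z.of_nat (wk k))%Z) as [A2 E2]; [lia|].
  transitivity (/ (1 - p ^ N k l) *
     (tsum (fun n => gauss p (r - n) * / (1 - X * CpowerZ p (n + Z.of_nat (wl l))))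
      + -(1) * tsum (fun n => gauss p (r - n) * / (1 - X * CpowerZ p (n + (- 1 - Z.of_nat (wk k))))))).
  - rewrite <- tsum_scal by easy. rewrite <- tsum_plus by (try apply abs_summable_scal; easy).
    rewrite <- tsum_scal by (apply abs_summable_plus; try apply abs_summable_scal; easy).
    apply tsum_ext. intros n. rewrite kernel_split. unfold V, U.
    replace (n + (-1 - Z.of_nat (wk k)))%Z with (n - 1 - Z.of_nat (wk k))%Z by lia. ring.
  - rewrite E1, E2. ring.
Qed.

Context (zeta : C) (HZ : zeta <> 0) (Hg : abs_summable g) (Hh : abs_summable h)
  (HgZ : abs_summable (fun k => g k * zeta ^ wk k)) (HhZ : abs_summable (fun l => h l * (/ zeta) ^ wl l)).

Let t (n : Z) : C := partial_fractions p g wk (/ X * CpowerZ p (1 - n)) * partial_fractions p h wl (X * CpowerZ p n).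

Lemma abs_summable_factors n : abs_summable (fun k => g k * (- U n k * / (1 - U n k))) /\
   abs_summable (fun l => h l * / (1 - V n l)).
Proof.
  destruct (avoids_powers_delta p X Hp Hp1 HX HR) as (d & Hd & Hdb). split.
  - apply (abs_summable_ext (fun k => (- U n k * / (1 - U n k)) * g k)); [intros; ring|].
    apply (abs_summable_mul_bounded _ _ (1 + / d)); [|easy]. intros k. apply flip_bound; [easy|apply Hdb].
  - apply (abs_summable_ext (fun l => / (1 - V n l) * h l)); [intros; ring|].
    apply (abs_summable_mul_bounded _ _ (/ d)); [|easy]. intros k. apply Cmod_inv_le; [easy|apply Hdb].
Qed.

Lemma product_double_sum n : t n = tsum (fun x : K * L => g (fst x) * h (snd x) * kernel n (fst x) (snd x)).
Proof.
  destruct (abs_summable_factors n) as [A1 A2]. unfold t, partial_fractions.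
  rewrite (tsum_ext _ (fun k => g k * (- U n k * / (1 - U n k)))).
  2:{ intros k. rewrite U_eq, inv_flip; [easy|apply U_nz|apply one_minus_nz, HR]. }
  rewrite (tsum_ext (fun l => _ * / (1 - X * _ * _)) (fun l => h l * / (1 - V n l))).
  2:{ intros l. rewrite V_eq. easy. }
  rewrite <- tsum_pair by easy. apply tsum_ext. intros [k l]. unfold kernel. simpl. ring.
Qed.

Let kernel_bound : exists B, forall n k l, (Cmod (kernel n k l) <= B)%R.
Proof.
  destruct (avoids_powers_delta p X Hp Hp1 HX HR) as (d & Hd & Hdb). exists ((1 + / d) * / d)%R.
  intros n k l. unfold kernel. rewrite Cmod_mult.
  apply Rmult_le_compat; try apply Cmod_ge_0; [apply flip_bound|apply Cmod_inv_le]; auto; apply Hdb.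
Qed.

Let gh (x : K * L) : C := g (fst x) * h (snd x).

Let c (x : K * L) : C := / (1 - p ^ N (fst x) (snd x)).

Lemma inv_one_minus_bound x : (Cmod (c x) <= / (1 - Cmod p))%R.
Proof.
  unfold c. apply Cmod_inv_le; [lra|].
  pose proof (Cmod_triangle (1 - p ^ N (fst x) (snd x)) (p ^ N (fst x) (snd x))) as Ht.
  replace (1 - p ^ N (fst x) (snd x) + p ^ N (fst x) (snd x)) with (RtoC 1) in Ht by ring.
  rewrite Cmod_1 in Ht.
  assert (Cmod (p ^ N (fst x) (snd x)) <= Cmod p)%R; [|lra].
  unfold N. simpl. rewrite Cmod_mult, Cmod_pow. pose proof (Cmod_ge_0 p).
  assert (Cmod p ^ (wk (fst x) + wl (snd x)) <= 1)%R; [|nra].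
  rewrite <- (pow1 (wk (fst x) + wl (snd x))). apply pow_incr; lra.
Qed.

(** The rapidly decreasing gauss (r - n) against the bounded kernel makes the
    triple sum absolutely convergent, whatever zeta is. *)
Lemma gauss_product_sum r :
  tsum (fun n => gauss p (r - n) * t n)
  = tsum (fun x : K * L => gh x * (c x * theta_recip p X 0 *
    (gauss p (r + Z.of_nat (wl (snd x))) * CpowerZ X (r + Z.of_nat (wl (snd x)))
     - gauss p (r - 1 - Z.of_nat (wk (fst x))) * CpowerZ X (r - 1 - Z.of_nat (wk (fst x)))))).
Proof.
  assert (Hgh : abs_summable gh) by (apply abs_summable_pair; easy).
  pose proof (abs_summable_gauss_1 p Hp Hp1) as He. apply (abs_summable_Z_refl _ r) in He.
  destruct kernel_bound as [B HB].
  assert (HA : abs_summable (fun y : Z * (K * L) =>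
      gauss p (r - fst y) * (gh (snd y) * kernel (fst y) (fst (snd y)) (snd (snd y))))).
  { apply (abs_summable_ext (fun y => kernel (fst y) (fst (snd y)) (snd (snd y)) * (gauss p (r - fst y) * gh (snd y))));
      [intros; ring|].
    apply (abs_summable_mul_bounded _ _ B); [intros; apply HB|]. apply (abs_summable_pair _ _ He Hgh). }
  transitivity (tsum (fun n => tsum (fun x : K * L =>
      gauss p (r - n) * (gh x * kernel n (fst x) (snd x))))).
  - apply tsum_ext. intros n. rewrite product_double_sum.
    rewrite <- tsum_scal; [easy|].
    apply (abs_summable_ext (fun x => kernel n (fst x) (snd x) * gh x)); [intros; unfold gh; ring|].
    apply (abs_summable_mul_bounded _ _ B); [intros; apply HB|easy].
  - rewrite (tsum_swap (fun n x => gauss p (r - n) * (gh x * kernel n (fst x) (snd x)))) by exact HA.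
    apply tsum_ext. intros x.
    replace (c x) with (/ (1 - p ^ N (fst x) (snd x))) by easy. rewrite <- gauss_kernel_sum.
    rewrite <- tsum_scal; [apply tsum_ext; intros; ring|].
    apply (abs_summable_ext (fun n => kernel n (fst x) (snd x) * gauss p (r - n))); [intros; ring|].
    apply (abs_summable_mul_bounded _ _ B); [intros; apply HB|easy].
Qed.

(** Expand 1 / (1 - p^(|k|+|l|+1)) in a geometric series; each term p^(m|k|) p^(m|l|)
    separates the two indices. *)
Lemma double_sum_collapse :
  tsum (fun x => gh x * (c x * ((/ zeta) ^ wl (snd x) - zeta * zeta ^ wk (fst x))))
  = tsum (fun m : nat => p ^ m * (weighted_series g wk (p ^ m) * weighted_series h wl (p ^ m * / zeta)
                           - zeta * (weighted_series g wk (zeta * p ^ m) * weighted_series h wl (p ^ m)))).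
Proof.
  assert (HA1 : abs_summable (fun x => g (fst x) * (h (snd x) * (/ zeta) ^ wl (snd x)))).
  { apply (abs_summable_pair g (fun l => h l * (/ zeta) ^ wl l)); easy. }
  assert (HA2 : abs_summable (fun x => (g (fst x) * zeta ^ wk (fst x)) * h (snd x))).
  { apply (abs_summable_pair (fun k => g k * zeta ^ wk k) h); easy. }
  set (a := fun x => gh x * ((/ zeta) ^ wl (snd x) - zeta * zeta ^ wk (fst x))).
  assert (HA : abs_summable a).
  { apply (abs_summable_ext (fun x => g (fst x) * (h (snd x) * (/ zeta) ^ wl (snd x))
       + (- zeta) * ((g (fst x) * zeta ^ wk (fst x)) * h (snd x)))).
    - intros x. unfold a, gh. ring.
    - apply abs_summable_plus; [easy|]. apply abs_summable_scal; easy. }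
  assert (Hpm : forall m, (Cmod (p ^ m) <= 1)%R).
  { intros m. rewrite Cmod_pow, <- (pow1 m). apply pow_incr. split; [apply Cmod_ge_0|lra]. }
  assert (Hpow : forall m n, (Cmod ((p ^ m) ^ n) <= 1)%R).
  { intros m n. rewrite <- Cpow_mult_r. apply Hpm. }
  transitivity (tsum (fun x => tsum (fun m : nat => a x * (p ^ N (fst x) (snd x)) ^ m))).
  - apply tsum_ext. intros x.
    assert (Hlt : (Cmod (p ^ N (fst x) (snd x)) < 1)%R).
    { unfold N. simpl. apply (Cmod_pow_lt1 p p); easy. }
    rewrite tsum_scal by (apply abs_summable_geom, Hlt). rewrite tsum_geom by easy. unfold a, c. ring.
  - rewrite (tsum_swap (fun x m => a x * (p ^ N (fst x) (snd x)) ^ m)).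
    + apply tsum_ext. intros m.
      assert (B1 : abs_summable (fun k => g k * (p ^ m) ^ wk k)).
      { apply (abs_summable_ext (fun k => (p ^ m) ^ wk k * g k)); [intros; ring|].
        apply (abs_summable_mul_bounded _ _ 1); auto. }
      assert (B2 : abs_summable (fun k => h k * (p ^ m) ^ wl k)).
      { apply (abs_summable_ext (fun k => (p ^ m) ^ wl k * h k)); [intros; ring|].
        apply (abs_summable_mul_bounded _ _ 1); auto. }
      assert (B3 : abs_summable (fun k => g k * (zeta * p ^ m) ^ wk k)).
      { apply (abs_summable_ext (fun k => (p ^ m) ^ wk k * (g k * zeta ^ wk k))); [intros; rewrite Cpow_mult_l; ring|].
        apply (abs_summable_mul_bounded _ _ 1); auto. }
      assert (B4 : abs_summable (fun k => h k * (p ^ m * / zeta) ^ wl k)).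
      { apply (abs_summable_ext (fun k => (p ^ m) ^ wl k * (h k * (/ zeta) ^ wl k))); [intros; rewrite Cpow_mult_l; ring|].
        apply (abs_summable_mul_bounded _ _ 1); auto. }
      unfold weighted_series. rewrite <- !tsum_pair by easy.
      pose proof (abs_summable_pair _ _ B1 B4) as C1. pose proof (abs_summable_pair _ _ B3 B2) as C2.
      transitivity (p ^ m * (tsum (fun x : K * L => g (fst x) * (p ^ m) ^ wk (fst x) * (h (snd x) * (p ^ m * / zeta) ^ wl (snd x)))
        + (- zeta) * tsum (fun x : K * L => g (fst x) * (zeta * p ^ m) ^ wk (fst x) * (h (snd x) * (p ^ m) ^ wl (snd x))))); [|ring].
      rewrite <- tsum_scal by easy. rewrite <- tsum_plus by (try apply abs_summable_scal; easy).
      rewrite <- tsum_scal by (apply abs_summable_plus; [easy|apply abs_summable_scal; easy]).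
      apply tsum_ext. intros x. unfold a, gh, N. rewrite !Cpow_mult_l.
      rewrite <- (Cpow_mult_r p (S _) m).
      replace (S (wk (fst x) + wl (snd x)) * m)%nat with (m + (m * wk (fst x) + m * wl (snd x)))%nat by lia.
      rewrite !Cpow_add_r, !Cpow_mult_r. ring.
    + apply (abs_summable_le _ (fun x => Cmod (a (fst x)) * Cmod p ^ snd x)%R).
      * apply (bounded_sums_pair (fun x => Cmod (a x)) (fun m => Cmod p ^ m)%R); auto.
        -- intros; apply Cmod_ge_0.
        -- intros; apply pow_le, Cmod_ge_0.
        -- apply bounded_sums_geom. split; [apply Cmod_ge_0|easy].
      * intros [x m]. simpl. rewrite Cmod_mult. apply Rmult_le_compat_l; [apply Cmod_ge_0|].
        unfold N. simpl. rewrite Cpow_mult_l, Cmod_mult, !Cmod_pow.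
        pose proof (pow_le (Cmod p) m (Cmod_ge_0 p)).
        assert ((Cmod p ^ (wk (fst x) + wl (snd x))) ^ m <= 1)%R; [|nra].
        rewrite <- pow_mult, <- (pow1 ((wk (fst x) + wl (snd x)) * m)).
        apply pow_incr. split; [apply Cmod_ge_0|lra].
Qed.

(** Comparing coefficients of zeta^r on both sides is [gauss_product_sum]; the
    sum over r of the theta coefficients shifted by l or by -1-k gives
    zeta^(-l) or zeta^(1+k) times the theta series at X zeta. *)
Theorem bilateral_sum : abs_summable (fun n => t n * CpowerZ zeta n) ->
  theta_series p zeta * tsum (fun n => t n * CpowerZ zeta n)
  = theta_recip p X 0 * theta_series p (X * zeta) *
    tsum (fun m : nat => p ^ m * (weighted_series g wk (p ^ m) * weighted_series h wl (p ^ m * / zeta)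
                           - zeta * (weighted_series g wk (zeta * p ^ m) * weighted_series h wl (p ^ m)))).
Proof.
  intros HT. rewrite <- double_sum_collapse.
  assert (HXZ : X * zeta <> 0) by (apply Cmult_neq_0; easy).
  pose proof (abs_summable_gauss p zeta Hp Hp1 HZ) as HE.
  pose proof (abs_summable_gauss p (X * zeta) Hp Hp1 HXZ) as HEX.
  (* (n, r) indexes the product of the n-th term with the theta term of degree r - n *)
  set (f := fun n r => (gauss p (r - n) * CpowerZ zeta (r - n)) * (t n * CpowerZ zeta n)).
  assert (HF : abs_summable (fun y : Z * Z => f (fst y) (snd y))).
  { pose proof (abs_summable_pair _ _ HT HE) as HM.
    apply (abs_summable_ext (fun y => t (fst y) * CpowerZ zeta (fst y) *
         (gauss p (snd y - fst y) * CpowerZ zeta (snd y - fst y)))); [intros; unfold f; ring|].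
    apply (bounded_sums_inj (fun y => Cmod (t (fst y) * CpowerZ zeta (fst y) * (gauss p (snd y) * CpowerZ zeta (snd y))))
        (fun y : Z * Z => (fst y, snd y - fst y)%Z)); [|exact HM].
    intros [n1 r1] [n2 r2] E. inversion E. simpl in *. subst. f_equal. lia. }
  transitivity (tsum (fun n => tsum (fun r => f n r))).
  { unfold theta_series. rewrite <- (tsum_scal _ _ HT). apply tsum_ext. intros n. unfold f.
    transitivity ((t n * CpowerZ zeta n) * tsum (fun r => gauss p (r - n) * CpowerZ zeta (r - n))).
    - replace (tsum (fun r => gauss p (r - n) * CpowerZ zeta (r - n)))
        with (tsum (fun r => gauss p r * CpowerZ zeta r)); [ring|].
      symmetry. apply (tsum_Z_shift (fun r => gauss p r * CpowerZ zeta r) (- n) HE).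
    - rewrite <- tsum_scal; [apply tsum_ext; intros; ring|]. apply (abs_summable_Z_shift _ (- n) HE). }
  rewrite (tsum_swap f HF).
  set (a1 := fun r (x : K * L) => (c x * (g (fst x) * (h (snd x) * (/ zeta) ^ wl (snd x)))) *
     (gauss p (r + Z.of_nat (wl (snd x))) * CpowerZ (X * zeta) (r + Z.of_nat (wl (snd x))))).
  set (a2 := fun r (x : K * L) => (c x * (g (fst x) * zeta ^ wk (fst x) * h (snd x))) *
     (gauss p (r - 1 - Z.of_nat (wk (fst x))) * CpowerZ (X * zeta) (r - 1 - Z.of_nat (wk (fst x))))).
  assert (C1 : abs_summable (fun x : K * L => c x * (g (fst x) * (h (snd x) * (/ zeta) ^ wl (snd x))))).
  { apply (abs_summable_mul_bounded _ _ _ inv_one_minus_bound). apply (abs_summable_pair g (fun l => h l * (/ zeta) ^ wl l)); easy. }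
  assert (C2 : abs_summable (fun x : K * L => c x * (g (fst x) * zeta ^ wk (fst x) * h (snd x)))).
  { apply (abs_summable_mul_bounded _ _ _ inv_one_minus_bound). apply (abs_summable_pair (fun k => g k * zeta ^ wk k) h); easy. }
  assert (HA1 : abs_summable (fun y : Z * (K * L) => a1 (fst y) (snd y))).
  { pose proof (abs_summable_swap _ (abs_summable_pair _ _ C1 HEX)) as HM. simpl in HM.
    apply (bounded_sums_inj (fun y => Cmod _) (fun y : Z * (K * L) =>
       (fst y + Z.of_nat (wl (snd (snd y))), snd y)%Z)) in HM; [exact HM|].
    intros [r1 x1] [r2 x2] E. inversion E. simpl in *. subst. f_equal. lia. }
  assert (HA2 : abs_summable (fun y : Z * (K * L) => a2 (fst y) (snd y))).
  { pose proof (abs_summable_swap _ (abs_summable_pair _ _ C2 HEX)) as HM. simpl in HM.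
    apply (bounded_sums_inj (fun y => Cmod _) (fun y : Z * (K * L) =>
       (fst y - 1 - Z.of_nat (wk (fst (snd y))), snd y)%Z)) in HM; [exact HM|].
    intros [r1 x1] [r2 x2] E. inversion E. simpl in *. subst. f_equal. lia. }
  set (a := fun r x => theta_recip p X 0 * (a1 r x + (- zeta) * a2 r x)).
  assert (HA : abs_summable (fun y : Z * (K * L) => a (fst y) (snd y))).
  { apply abs_summable_scal, abs_summable_plus; [easy|]. apply abs_summable_scal; easy. }
  transitivity (tsum (fun r => tsum (fun x => a r x))).
  - apply tsum_ext. intros r.
    transitivity (CpowerZ zeta r * tsum (fun n => gauss p (r - n) * t n)).
    + rewrite <- tsum_scal.
      * apply tsum_ext. intros n. unfold f, Z.sub. rewrite CpowerZ_add, CpowerZ_opp by easy.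
        pose proof (CpowerZ_nz zeta n HZ). field; easy.
      * pose proof (abs_summable_slice _ r (abs_summable_swap _ HF)) as HS. simpl in HS.
        apply (abs_summable_scal (/ CpowerZ zeta r)) in HS. eapply abs_summable_ext; [|apply HS]. intros n. simpl.
        unfold f, Z.sub. rewrite CpowerZ_add, CpowerZ_opp by easy.
        pose proof (CpowerZ_nz zeta n HZ). pose proof (CpowerZ_nz zeta r HZ). field; split; easy.
    + rewrite gauss_product_sum. rewrite <- tsum_scal.
      * apply tsum_ext. intros x. unfold a, a1, a2, gh.
        unfold Z.sub. rewrite !(CpowerZ_mult X zeta) by easy.
        rewrite !(CpowerZ_add zeta), !(CpowerZ_opp zeta), !CpowerZ_nat by easy. rewrite CpowerZ_1.
        rewrite Cpow_inv by easy.
        pose proof (Cpow_nz zeta (wl (snd x)) HZ). pose proof (Cpow_nz zeta (wk (fst x)) HZ). field.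
        repeat split; easy.
      * pose proof (abs_summable_slice _ r HA) as HS. simpl in HS.
        apply (abs_summable_scal (/ CpowerZ zeta r)) in HS. eapply abs_summable_ext; [|apply HS]. intros x. simpl.
        unfold a, a1, a2, gh.
        unfold Z.sub. rewrite !(CpowerZ_mult X zeta) by easy.
        rewrite !(CpowerZ_add zeta), !(CpowerZ_opp zeta), !CpowerZ_nat by easy. rewrite CpowerZ_1.
        rewrite Cpow_inv by easy. pose proof (CpowerZ_nz zeta r HZ).
        pose proof (Cpow_nz zeta (wl (snd x)) HZ). pose proof (Cpow_nz zeta (wk (fst x)) HZ). field.
        repeat split; easy.
  - rewrite (tsum_swap a HA). rewrite <- tsum_scal.
    + apply tsum_ext. intros x. unfold a.
      assert (S1 : abs_summable (fun r => a1 r x)) by exact (abs_summable_slice _ x (abs_summable_swap _ HA1)).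
      assert (S2 : abs_summable (fun r => a2 r x)) by exact (abs_summable_slice _ x (abs_summable_swap _ HA2)).
      rewrite tsum_scal by (apply abs_summable_plus; [exact S1|exact (abs_summable_scal _ _ S2)]).
      rewrite tsum_plus, tsum_scal by (first [exact S1|exact S2|exact (abs_summable_scal _ _ S2)]).
      unfold a1, a2. rewrite !tsum_scal.
      * rewrite (tsum_Z_shift (fun r => gauss p r * CpowerZ (X * zeta) r) _ HEX).
        assert (E : tsum (fun r => gauss p (r - 1 - Z.of_nat (wk (fst x))) *
           CpowerZ (X * zeta) (r - 1 - Z.of_nat (wk (fst x)))) = theta_series p (X * zeta)).
        { unfold theta_series. rewrite <- (tsum_Z_shift _ (- 1 - Z.of_nat (wk (fst x))) HEX). apply tsum_ext.
          intros r. do 2 f_equal; lia. }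
        rewrite E. unfold theta_series, gh. ring.
      * pose proof (abs_summable_Z_shift _ (- 1 - Z.of_nat (wk (fst x))) HEX) as HS.
        eapply abs_summable_ext; [|apply HS]. intros r. cbv beta.
        do 2 f_equal; lia.
      * apply (abs_summable_Z_shift _ (Z.of_nat (wl (snd x))) HEX).
    + apply (abs_summable_ext (fun x => c x * (g (fst x) * (h (snd x) * (/ zeta) ^ wl (snd x)))
        + (- zeta) * (c x * (g (fst x) * zeta ^ wk (fst x) * h (snd x))))); [intros; unfold gh; ring|].
      apply abs_summable_plus; [easy|]. apply abs_summable_scal; easy.
Qed.

End Bilateral.

(** * Decay of partial fraction series *)

Lemma avoids_powers_inv (p c : C) : p <> 0 -> c <> 0 -> avoids_powers p c -> avoids_powers p (/ c).
Proof.
  intros Hp Hc H n E. apply (H (- n)%Z). rewrite CpowerZ_opp by easy.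
  pose proof (CpowerZ_nz p n Hp).
  assert (CpowerZ p n = c) as ->; [|field; easy].
  transitivity (c * (/ c * CpowerZ p n)); [field; easy|rewrite E; ring].
Qed.

Lemma avoids_powers_scale (p c : C) m : p <> 0 -> avoids_powers p c -> avoids_powers p (c * CpowerZ p m).
Proof.
  intros Hp H n E. apply (H (m + n)%Z). rewrite CpowerZ_add by easy. rewrite <- E. ring.
Qed.

Lemma partial_fractions_bounded {K : Type} (p c : C) (g : K -> C) (w : K -> nat) :
  p <> 0 -> (Cmod p < 1)%R -> c <> 0 -> avoids_powers p c -> abs_summable g ->
  exists M, forall n, (Cmod (partial_fractions p g w (c * CpowerZ p n)) <= M)%R.
Proof.
  intros Hp Hp1 Hc HR [M HM]. destruct (avoids_powers_delta p c Hp Hp1 Hc HR) as (d & Hd & Hb).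
  exists (/ d * M)%R. intros n. apply (tsum_norm _ (fun k => / d * Cmod (g k))%R).
  - intros k. rewrite Cmod_mult, Rmult_comm. apply Rmult_le_compat_r; [apply Cmod_ge_0|].
    apply Cmod_inv_le; [easy|]. rewrite <- Cmult_assoc, <- CpowerZ_nat, <- CpowerZ_add by easy. apply Hb.
  - intros L ND. rewrite rsum_scal. apply Rmult_le_compat_l; [|apply HM, ND].
    left; apply Rinv_0_lt_compat, Hd.
Qed.

Lemma pow_split_le (r s : R) (n w : nat) : (0 < r)%R -> (0 < s)%R ->
  (w <= n)%nat -> (r <= s)%R -> (r ^ n * / r ^ w <= s ^ n * / s ^ w)%R.
Proof.
  intros Hr Hs Hw Hle. destruct (Nat.le_exists_sub w n Hw) as (j & -> & _).
  rewrite !pow_add, !Rmult_assoc, !Rinv_r by (apply pow_nonzero; lra).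
  rewrite !Rmult_1_r. apply pow_incr; lra.
Qed.

Lemma pow_split_ge (r s : R) (n w : nat) : (0 < r)%R -> (0 < s)%R ->
  (n <= w)%nat -> (s <= r)%R -> (r ^ n * / r ^ w <= s ^ n * / s ^ w)%R.
Proof.
  intros Hr Hs Hw Hle. destruct (Nat.le_exists_sub n w Hw) as (j & -> & _).
  pose proof (pow_lt r n Hr). pose proof (pow_lt s n Hs).
  pose proof (pow_lt r j Hr). pose proof (pow_lt s j Hs).
  rewrite !pow_add.
  replace (r ^ n * / (r ^ j * r ^ n))%R with (/ r ^ j)%R by (field; lra).
  replace (s ^ n * / (s ^ j * s ^ n))%R with (/ s ^ j)%R by (field; lra).
  apply Rinv_le_contravar; [easy|]. apply pow_incr; lra.
Qed.

(** With U = p^(n-|k|) / c the summand is - U / (1 - U), which is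
    - U - ... - U^J - U^(J+1) / (1 - U).  The vanishing moments remove the powers,
    and |U^(J+1) / (1 - U)| is at most a constant times the smaller of |U|^J and
    |U|^(J+1), hence times (rho^n / rho^|k|) when |p|^(J+1) < rho <= |p|^J. *)
Lemma partial_fractions_decay {K : Type} (p c : C) (g : K -> C) (w : K -> nat) (rho : R) :
  p <> 0 -> (Cmod p < 1)%R -> c <> 0 -> avoids_powers p c -> (0 < rho < 1)%R -> abs_summable g ->
  bounded_sums (fun k => Cmod (g k) * / rho ^ w k)%R ->
  (forall j, (1 <= j)%nat -> (rho <= Cmod p ^ j)%R -> weighted_series g w (/ p ^ j) = 0) ->
  exists M, (0 <= M)%R /\ forall n, (Cmod (partial_fractions p g w (c * / p ^ n)) <= M * rho ^ n)%R.
Proof.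
  intros Hp Hp1 Hc HR Hrho Hg Hb Hmom.
  pose proof (proj1 (Cmod_gt_0 p) Hp) as Hp0. pose proof (proj1 (Cmod_gt_0 c) Hc) as Hc0.
  destruct (avoids_powers_delta p (/ c) Hp Hp1) as (d & Hd & Hdb).
  { intros E; apply Hc; transitivity (c * c * / c); [field; easy|rewrite E; ring]. }
  { apply avoids_powers_inv; easy. }
  (* as many vanishing moments as rho allows: the largest J with rho <= |p|^J *)
  assert (HJ : exists J, (rho <= Cmod p ^ J)%R /\ (Cmod p ^ S J < rho)%R).
  { destruct (pow_lt_1_zero (Cmod p)) with (y := rho) as [N0 HN]; [rewrite Rabs_pos_eq; lra|lra|].
    specialize (HN N0 (Nat.le_refl _)). rewrite Rabs_pos_eq in HN by (apply pow_le; lra).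
    induction N0 as [|N0 IH]; [simpl in HN; lra|].
    destruct (Rle_or_lt rho (Cmod p ^ N0)) as [H|H]; [exists N0; auto|apply IH, H]. }
  destruct HJ as (J & HJ1 & HJ2).
  set (U := fun n k => / c * p ^ n * / p ^ w k).
  assert (HU0 : forall n k, U n k <> 0).
  { intros n k E. 
    assert (HE : Cmod (U n k) = 0%R) by (rewrite E; apply Cmod_0).
    unfold U in HE. rewrite !Cmod_mult, !Cmod_inv, !Cmod_pow in HE by (try apply Cpow_nz; easy).
    pose proof (pow_lt (Cmod p) n Hp0). pose proof (pow_lt (Cmod p) (w k) Hp0).
    assert (0 < / Cmod c * Cmod p ^ n * / Cmod p ^ w k)%R; [|lra].
    repeat apply Rmult_lt_0_compat; try apply Rinv_0_lt_compat; easy. }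
  assert (HUd : forall n k, (d <= Cmod (1 - U n k))%R).
  { intros n k. unfold U. specialize (Hdb (Z.of_nat n - Z.of_nat (w k))%Z).
    rewrite CpowerZ_center in Hdb by easy. rewrite Cmult_assoc in Hdb. exact Hdb. }
  assert (HU1 : forall n k, 1 - U n k <> 0).
  { intros n k. apply Cmod_gt_0. specialize (HUd n k). lra. }
  assert (HUm : forall n k, Cmod (U n k) = (/ Cmod c * (Cmod p ^ n * / Cmod p ^ w k))%R).
  { intros n k. unfold U. rewrite !Cmod_mult, !Cmod_inv, !Cmod_pow by (try apply Cpow_nz; easy). ring. }
  assert (HUpow : forall n k j, Cmod (U n k ^ j)
       = ((/ Cmod c) ^ j * ((Cmod p ^ j) ^ n * / (Cmod p ^ j) ^ w k))%R).
  { intros n k j. rewrite Cmod_pow, HUm, !Rpow_mult_distr. rewrite (pow_inv (Cmod p ^ w k)), <- !pow_mult.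
    rewrite (Nat.mul_comm n j), (Nat.mul_comm (w k) j). easy. }
  assert (Habj : forall n j, (rho <= Cmod p ^ j)%R -> abs_summable (fun k => g k * U n k ^ j)).
  { intros n j Hj. apply (abs_summable_le _ (fun k => ((/ Cmod c) ^ j * (Cmod p ^ j) ^ n) *
        (Cmod (g k) * / rho ^ w k))%R).
    - apply bounded_sums_scal; [|easy]. apply Rmult_le_pos; apply pow_le; [left; apply Rinv_0_lt_compat; easy|].
      apply pow_le; lra.
    - intros k. rewrite Cmod_mult, HUpow.
      assert (Hi : (/ (Cmod p ^ j) ^ w k <= / rho ^ w k)%R).
      { apply Rinv_le_contravar; [apply pow_lt; lra|]. apply pow_incr; lra. }
      assert (0 <= (/ Cmod c) ^ j * (Cmod p ^ j) ^ n)%R.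
      { apply Rmult_le_pos; apply pow_le; [left; apply Rinv_0_lt_compat; easy|apply pow_le; lra]. }
      pose proof (Cmod_ge_0 (g k)). set (a := ((/ Cmod c) ^ j * (Cmod p ^ j) ^ n)%R) in *.
      replace (Cmod (g k) * ((/ Cmod c) ^ j * ((Cmod p ^ j) ^ n * / (Cmod p ^ j) ^ w k)))%R
        with (a * (Cmod (g k) * / (Cmod p ^ j) ^ w k))%R by (unfold a; ring).
      apply Rmult_le_compat_l; [easy|]. apply Rmult_le_compat_l; easy. }
  assert (Hvan : forall n j, (1 <= j)%nat -> (rho <= Cmod p ^ j)%R -> tsum (fun k => g k * U n k ^ j) = 0).
  { intros n j Hj Hjr.
    assert (Eq : forall k, g k * U n k ^ j = (/ c * p ^ n) ^ j * (g k * (/ p ^ j) ^ w k)).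
    { intros k. unfold U. rewrite !Cpow_mult_l, !Cpow_inv, <- !Cpow_mult_r by (try apply Cpow_nz; easy).
      rewrite (Nat.mul_comm j). ring. }
    rewrite (tsum_ext _ _ Eq). rewrite tsum_scal.
    - unfold weighted_series in Hmom. rewrite Hmom by easy. ring.
    - pose proof (abs_summable_scal (/ (/ c * p ^ n) ^ j) _ (Habj n j Hjr)) as HA.
      eapply abs_summable_ext; [|apply HA]. intros k. cbv beta. rewrite Eq.
      assert ((/ c * p ^ n) ^ j <> 0); [|field; easy].
      apply Cpow_nz. intros E. specialize (HU0 n k). apply HU0. unfold U. rewrite E. ring. }
  assert (HabD : forall n j, (rho <= Cmod p ^ j)%R -> abs_summable (fun k => g k * (- U n k ^ S j * / (1 - U n k)))).
  { intros n j Hj. apply (abs_summable_ext (fun k => (- U n k * / (1 - U n k)) * (g k * U n k ^ j))).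
    - intros k. simpl. ring.
    - apply (abs_summable_mul_bounded _ _ (1 + / d)); [|apply Habj, Hj]. intros k. apply flip_bound; auto. }
  assert (Hform : forall n j, (rho <= Cmod p ^ j)%R ->
     partial_fractions p g w (c * / p ^ n) = tsum (fun k => g k * (- U n k ^ S j * / (1 - U n k)))).
  { intros n j. induction j; intros Hj.
    - apply tsum_ext. intros k. f_equal.
      replace (c * / p ^ n * p ^ w k) with (/ U n k).
      + rewrite inv_flip by easy. simpl. ring.
      + unfold U. pose proof (Cpow_nz p n Hp). pose proof (Cpow_nz p (w k) Hp). field; auto.
    - assert (Hj' : (rho <= Cmod p ^ j)%R).
      { eapply Rle_trans; [apply Hj|]. simpl. pose proof (pow_lt (Cmod p) j Hp0). nra. }
      rewrite IHj by easy.
      rewrite (tsum_ext _ (fun k => (-(1)) * (g k * U n k ^ S j) + g k * (- U n k ^ S (S j) * / (1 - U n k)))).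
      + rewrite tsum_plus, tsum_scal, Hvan by (first [lia|exact Hj|apply HabD, Hj|apply Habj, Hj|apply abs_summable_scal, Habj, Hj]).
        ring.
      + intros k. simpl. field. apply HU1. }
  destruct Hb as [M HM].
  assert (HM0 : (0 <= M)%R) by (apply (HM nil); constructor).
  pose proof (Rinv_0_lt_compat _ Hc0) as Hic. pose proof (Rinv_0_lt_compat _ Hd) as Hid.
  set (B := ((/ Cmod c) ^ S J * / d + (/ Cmod c) ^ J * (1 + / d))%R).
  assert (HB1 : (0 <= (/ Cmod c) ^ S J * / d)%R).
  { apply Rmult_le_pos; [apply pow_le|]; lra. }
  assert (HB2 : (0 <= (/ Cmod c) ^ J * (1 + / d))%R).
  { apply Rmult_le_pos; [apply pow_le|]; lra. }
  exists (B * M)%R. split; [apply Rmult_le_pos; [unfold B; lra|easy]|].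
  intros n. rewrite (Hform n J HJ1).
  apply (tsum_norm _ (fun k => (B * rho ^ n) * (Cmod (g k) * / rho ^ w k))%R).
  - intros k. rewrite Cmod_mult.
    replace (B * rho ^ n * (Cmod (g k) * / rho ^ w k))%R
      with (Cmod (g k) * (B * (rho ^ n * / rho ^ w k)))%R by ring.
    apply Rmult_le_compat_l; [apply Cmod_ge_0|].
    assert (Hr0 : (0 <= rho ^ n * / rho ^ w k)%R).
    { apply Rmult_le_pos; [apply pow_le; lra|]. left; apply Rinv_0_lt_compat, pow_lt; lra. }
    destruct (Nat.le_ge_cases (w k) n) as [Hw|Hw].
    + apply Rle_trans with ((/ Cmod c) ^ S J * / d * (rho ^ n * / rho ^ w k))%R.
      * rewrite Cmod_mult, Cmod_opp, HUpow.
        assert (H1 : ((Cmod p ^ S J) ^ n * / (Cmod p ^ S J) ^ w k <= rho ^ n * / rho ^ w k)%R).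
        { apply pow_split_le; [apply pow_lt; easy|lra|easy|lra]. }
        assert (H2 : (Cmod (/ (1 - U n k)) <= / d)%R) by (apply Cmod_inv_le; auto).
        assert (H3 : (0 <= (Cmod p ^ S J) ^ n * / (Cmod p ^ S J) ^ w k)%R).
        { apply Rmult_le_pos; [apply pow_le, pow_le; lra|].
          left; apply Rinv_0_lt_compat, pow_lt, pow_lt; lra. }
        rewrite !Rmult_assoc. apply Rmult_le_compat_l; [apply pow_le; lra|].
        rewrite (Rmult_comm (/ d)). rewrite <- !Rmult_assoc. apply Rmult_le_compat; auto. apply Cmod_ge_0.
      * apply Rmult_le_compat_r; [easy|unfold B; lra].
    + apply Rle_trans with ((/ Cmod c) ^ J * (1 + / d) * (rho ^ n * / rho ^ w k))%R.
      * replace (- U n k ^ S J * / (1 - U n k)) with (U n k ^ J * (- U n k * / (1 - U n k)))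
          by (simpl; ring).
        rewrite Cmod_mult, HUpow.
        assert (H1 : ((Cmod p ^ J) ^ n * / (Cmod p ^ J) ^ w k <= rho ^ n * / rho ^ w k)%R).
        { apply pow_split_ge; [apply pow_lt; easy|lra|easy|lra]. }
        pose proof (flip_bound _ d Hd (HUd n k)) as H2.
        assert (H3 : (0 <= (Cmod p ^ J) ^ n * / (Cmod p ^ J) ^ w k)%R).
        { apply Rmult_le_pos; [apply pow_le, pow_le; lra|].
          left; apply Rinv_0_lt_compat, pow_lt, pow_lt; lra. }
        rewrite !Rmult_assoc. apply Rmult_le_compat_l; [apply pow_le; lra|].
        rewrite (Rmult_comm (1 + / d)). rewrite <- !Rmult_assoc. apply Rmult_le_compat; auto. apply Cmod_ge_0.
      * apply Rmult_le_compat_r; [easy|unfold B; lra].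
  - intros L ND. rewrite rsum_scal.
    replace (B * M * rho ^ n)%R with (B * rho ^ n * M)%R by ring.
    apply Rmult_le_compat_l; [|apply HM, ND]. apply Rmult_le_pos; [unfold B; lra|apply pow_le; lra].
Qed.

(** * Partial fractions and analytic continuation *)

(** Expand every fraction in a geometric series and sum over k first. *)
Lemma partial_fractions_power_series {K : Type} (p z : C) (g : K -> C) (w : K -> nat) :
  (Cmod p < 1)%R -> (Cmod z < 1)%R -> abs_summable g ->
  abs_summable (fun n => weighted_series g w (p ^ n) * z ^ n) /\
  tsum (fun n => weighted_series g w (p ^ n) * z ^ n) = partial_fractions p g w z.
Proof.
  intros Hp Hz Hg.
  assert (Hpow : forall m n, (Cmod ((p ^ m) ^ n) <= 1)%R).
  { intros m n. rewrite <- Cpow_mult_r, Cmod_pow, <- (pow1 (m * n)). apply pow_incr.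
    split; [apply Cmod_ge_0|lra]. }
  assert (HA : abs_summable (fun y : nat * K => (p ^ fst y) ^ w (snd y) * (z ^ fst y * g (snd y)))).
  { apply (abs_summable_mul_bounded _ _ 1); [intros; apply Hpow|]. apply (abs_summable_pair (fun n => z ^ n) g); [apply abs_summable_geom, Hz|easy]. }
  assert (Hgn : forall n, abs_summable (fun k => g k * (p ^ n) ^ w k)).
  { intros n. apply (abs_summable_ext (fun k => (p ^ n) ^ w k * g k)); [intros; ring|].
    apply (abs_summable_mul_bounded _ _ 1); auto. }
  split.
  - destruct Hg as [M HM]. apply (abs_summable_mul_bounded _ _ M); [|apply abs_summable_geom, Hz].
    intros n. apply (tsum_norm _ (fun k => Cmod (g k))); [|exact HM].
    intros k. rewrite Cmod_mult. rewrite <- (Rmult_1_r (Cmod (g k))) at 2.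
    apply Rmult_le_compat_l; [apply Cmod_ge_0|apply Hpow].
  - transitivity (tsum (fun n => tsum (fun k => (p ^ n) ^ w k * (z ^ n * g k)))).
    + apply tsum_ext. intros n. unfold weighted_series. rewrite Cmult_comm, <- tsum_scal by easy.
      apply tsum_ext; intros; ring.
    + rewrite (tsum_swap (fun n k => (p ^ n) ^ w k * (z ^ n * g k)) HA).
      apply tsum_ext. intros k.
      pose proof (Cmod_pow_lt1 z p (w k) Hp Hz) as Hlt.
      rewrite <- tsum_geom, <- tsum_scal by (try apply abs_summable_geom; easy). apply tsum_ext. intros n.
      rewrite Cpow_mult_l, <- !Cpow_mult_r, (Nat.mul_comm n). ring.
Qed.

(** |1 - z0 p^|k|| is bounded below uniformly in k, so the geometric expansions of
    all the fractions around z0 converge at a common rate. *)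
Lemma partial_fractions_analytic {K : Type} (p z0 : C) (g : K -> C) (w : K -> nat) :
  (Cmod p < 1)%R -> abs_summable g -> phi21_regular p z0 -> analytic_at (partial_fractions p g w) z0.
Proof.
  intros Hp Hg Hz0. destruct (regular_delta p z0 Hp Hz0) as (d & Hd & Hdb).
  set (v := fun k => 1 - z0 * p ^ w k).
  assert (Hv : forall k, v k <> 0) by (intros k; apply one_minus_nz, Hz0).
  assert (Hvi : forall k, (Cmod (/ v k) <= / d)%R) by (intros k; apply Cmod_inv_le; [easy|apply Hdb]).
  exists (d / 2)%R, (fun n => tsum (fun k => g k * / v k * (p ^ w k * / v k) ^ n)).
  split; [lra|]. intros z Hz.
  assert (Hpw : forall k, (Cmod (p ^ w k) <= 1)%R).
  { intros k. rewrite Cmod_pow, <- (pow1 (w k)). apply pow_incr. split; [apply Cmod_ge_0|lra]. }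
  pose proof (Rinv_0_lt_compat _ Hd) as Hid.
  assert (Hpv : forall k, (Cmod (p ^ w k * / v k) <= / d)%R).
  { intros k. rewrite Cmod_mult, <- (Rmult_1_l (/ d)).
    apply Rmult_le_compat; auto; apply Cmod_ge_0. }
  assert (Hhalf : forall k, (Cmod (p ^ w k * / v k * (z - z0)) <= / 2)%R).
  { intros k. rewrite Cmod_mult. apply Rle_trans with (/ d * (d / 2))%R; [|right; field; lra].
    apply Rmult_le_compat; auto; try apply Cmod_ge_0. lra. }
  assert (Hgv : abs_summable (fun k => g k * / v k)).
  { apply (abs_summable_ext (fun k => / v k * g k)); [intros; ring|]. apply (abs_summable_mul_bounded _ _ (/ d)); auto. }
  set (f := fun (n : nat) k => g k * / v k * (p ^ w k * / v k * (z - z0)) ^ n).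
  assert (HA : abs_summable (fun y : K * nat => f (snd y) (fst y))).
  { apply (abs_summable_le _ (fun y => Cmod (g (fst y) * / v (fst y)) * (/ 2) ^ snd y)%R).
    - apply (bounded_sums_pair (fun k => Cmod (g k * / v k)) (fun n => (/ 2) ^ n)%R); auto.
      + intros; apply Cmod_ge_0.
      + intros; apply pow_le; lra.
      + apply bounded_sums_geom; lra.
    - intros [k n]. unfold f. simpl fst. simpl snd. rewrite Cmod_mult, Cmod_pow.
      apply Rmult_le_compat_l; [apply Cmod_ge_0|]. apply pow_incr. split; [apply Cmod_ge_0|apply Hhalf]. }
  assert (Ht : forall n, tsum (fun k => g k * / v k * (p ^ w k * / v k) ^ n) * (z - z0) ^ n
      = tsum (f n)).
  { intros n. rewrite Cmult_comm, <- tsum_scal.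
    - apply tsum_ext. intros k. unfold f. rewrite (Cpow_mult_l _ (z - z0)). ring.
    - apply (abs_summable_ext (fun k => (p ^ w k * / v k) ^ n * (g k * / v k))); [intros; ring|].
      apply (abs_summable_mul_bounded _ _ ((/ d) ^ n)); [|easy]. intros k. rewrite Cmod_pow.
      apply pow_incr. split; [apply Cmod_ge_0|apply Hpv]. }
  assert (Hs : abs_summable (fun n => tsum (f n))).
  { destruct Hgv as [M HM].
    apply (abs_summable_le _ (fun n => M * (/ 2) ^ n)%R).
    - apply bounded_sums_scal; [apply (HM nil); constructor|]. apply bounded_sums_geom; lra.
    - intros n. apply (tsum_norm _ (fun k => (/ 2) ^ n * Cmod (g k * / v k))%R).
      + intros k. unfold f. rewrite Cmod_mult, Rmult_comm, Cmod_pow.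
        apply Rmult_le_compat_r; [apply Cmod_ge_0|]. apply pow_incr. split; [apply Cmod_ge_0|apply Hhalf].
      + intros L ND. rewrite rsum_scal, Rmult_comm. apply Rmult_le_compat_r; [apply pow_le; lra|].
        apply HM, ND. }
  replace (fun n => _ * (z - z0) ^ n) with (fun n => tsum (f n))
    by (apply functional_extensionality; intros n; symmetry; apply Ht).
  replace (partial_fractions p g w z) with (tsum (fun n => tsum (f n))); [apply abs_summable_is_series, Hs|].
  transitivity (tsum (fun k => tsum (fun n => f n k)));
    [symmetry; exact (tsum_swap (fun k n => f n k) HA)|].
  apply tsum_ext. intros k.
  unfold f. assert (Hlt : (Cmod (p ^ w k * / v k * (z - z0)) < 1)%R) by (specialize (Hhalf k); lra).
  rewrite tsum_scal by (apply abs_summable_geom, Hlt). rewrite tsum_geom by easy.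
  pose proof (one_minus_nz _ (lt1_ne1 _ Hlt)) as Hn. specialize (Hv k).
  assert (E : 1 - z * p ^ w k = v k * (1 - p ^ w k * / v k * (z - z0))).
  { transitivity (v k - p ^ w k * (z - z0)); [unfold v; ring|field; easy]. }
  rewrite E. set (e := 1 - p ^ w k * / v k * (z - z0)) in *. field. split; easy.
Qed.

(** * Uniqueness of the continuation *)

(** At half the radius the terms are bounded by a constant M; at a fraction t of
    that point the terms of positive degree are at most a multiple of M t. *)
Lemma power_series_coef0 (b : nat -> C) (s0 : R) : (0 < s0)%R ->
  (forall s, (0 < s < s0)%R -> clim (fun n => lsum (fun k => b k * RtoC (- s) ^ k) (seq 0 (S n))) 0) ->
  b O = 0.
Proof.
  intros Hs0 H. set (s1 := (s0 / 2)%R).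
  assert (Hs1 : (0 < s1 < s0)%R) by (unfold s1; lra).
  destruct (clim_bounded _ _ (H s1 Hs1)) as (M & HM & HB).
  assert (Hmod : forall s k, (0 <= s)%R -> Cmod (b k * RtoC (- s) ^ k) = (Cmod (b k) * s ^ k)%R).
  { intros s k Hs. rewrite Cmod_mult, Cmod_pow, Cmod_R, Rabs_Ropp, Rabs_pos_eq; easy. }
  assert (Hb : forall k, (Cmod (b k) * s1 ^ k <= 2 * M)%R).
  { intros k. rewrite <- Hmod by lra. destruct k.
    - specialize (HB O). simpl in HB. rewrite Cplus_0_r, Cmult_1_r in HB. simpl. rewrite Cmult_1_r. lra.
    - pose proof (HB k) as H1. pose proof (HB (S k)) as H2. rewrite lsum_seq_last in H2.
      set (u := lsum (fun k => b k * RtoC (- s1) ^ k) (seq 0 (S k))) in *.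
      set (v := b (S k) * RtoC (- s1) ^ S k) in *.
      replace v with ((u + v) + (- u)) by ring.
      eapply Rle_trans; [apply Cmod_triangle|]. rewrite Cmod_opp. lra. }
  apply NNPP. intros Hnz. pose proof (proj1 (Cmod_gt_0 _) Hnz) as Hpos.
  set (t := (Rmin 1 (Cmod (b O) / (4 * M + 1)))%R).
  assert (Ht0 : (0 < t)%R).
  { apply Rmin_pos; [lra|]. apply Rdiv_lt_0_compat; lra. }
  assert (Ht1 : (t <= 1)%R) by apply Rmin_l.
  assert (Ht2 : (t <= Cmod (b O) / (4 * M + 1))%R) by apply Rmin_r.
  set (s := (s1 * (t / 2))%R).
  assert (Hs : (0 < s < s0)%R) by (unfold s, s1 in *; nra).
  assert (HL : (Cmod (0 - b O) <= 2 * M * t)%R).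
  { apply (clim_le (fun n => lsum (fun k => b k * RtoC (- s) ^ k) (seq 0 (S n)) - b O)).
    - apply clim_plus; [apply H, Hs|apply clim_const].
    - intros n. rewrite lsum_seq_S. simpl Cpow at 1. rewrite Cmult_1_r.
      match goal with |- (Cmod (?x + ?y - ?x) <= _)%R => replace (x + y - x) with y by ring end.
      eapply Rle_trans; [apply lsum_Cmod|].
      apply Rle_trans with (rsum (fun k => 2 * M * (t / 2) * (t / 2) ^ k)%R (seq 0 n)).
      + apply rsum_le. intros k _. rewrite Hmod by lra. unfold s. rewrite Rpow_mult_distr.
        specialize (Hb (S k)). pose proof (pow_le (t / 2) (S k) ltac:(lra)).
        replace (2 * M * (t / 2) * (t / 2) ^ k)%R with (2 * M * (t / 2) ^ S k)%R by (simpl; ring).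
        rewrite <- Rmult_assoc. apply Rmult_le_compat_r; easy.
      + rewrite rsum_scal. pose proof (geom_partial (t / 2) n ltac:(lra)) as Hg.
        assert (/ (1 - t / 2) <= 2)%R.
        { replace 2%R with (/ (/ 2))%R at 2 by field. apply Rinv_le_contravar; lra. }
        assert (0 <= M * t)%R by (apply Rmult_le_pos; lra).
        replace (2 * M * (t / 2))%R with (M * t)%R by field.
        replace (2 * M * t)%R with (M * t * 2)%R by ring.
        apply Rmult_le_compat_l; [easy|]. eapply Rle_trans; [exact Hg|easy]. }
  replace (0 - b O) with (- b O) in HL by ring. rewrite Cmod_opp in HL.
  assert (2 * M * t <= 2 * M * (Cmod (b O) / (4 * M + 1)))%R by (apply Rmult_le_compat_l; lra).
  assert (2 * M * (Cmod (b O) / (4 * M + 1)) < Cmod (b O))%R; [|lra].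
  apply Rmult_lt_reg_r with (4 * M + 1)%R; [lra|].
  replace (2 * M * (Cmod (b O) / (4 * M + 1)) * (4 * M + 1))%R with (2 * M * Cmod (b O))%R by (field; lra).
  nra.
Qed.

Lemma power_series_coef (b : nat -> C) (s0 : R) : (0 < s0)%R ->
  (forall s, (0 < s < s0)%R -> clim (fun n => lsum (fun k => b k * RtoC (- s) ^ k) (seq 0 (S n))) 0) ->
  forall n, b n = 0.
Proof.
  intros Hs0 H n. revert b H. induction n; intros b H.
  - apply (power_series_coef0 b s0); easy.
  - apply (IHn (fun k => b (S k))). intros s Hs.
    pose proof (power_series_coef0 b s0 Hs0 H) as Hb0.
    specialize (H s Hs). apply (clim_shift (fun n => lsum _ (seq 0 (S n)))) in H.
    assert (Hnz : RtoC (- s) <> 0) by (intros E; apply RtoC_inj in E; lra).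
    apply (clim_mult (fun _ => / RtoC (- s)) _ (/ RtoC (- s)) 0 (clim_const _)) in H.
    rewrite Cmult_0_r in H. apply (clim_ext _ _ _) with (2 := H). intros m.
    rewrite (lsum_seq_S _ (S m)), Hb0.
    rewrite (lsum_ext_in (fun k => b (S k) * RtoC (- s) ^ S k)
               (fun k => RtoC (- s) * (b (S k) * RtoC (- s) ^ k))) by (intros; simpl; ring).
    rewrite lsum_scal. field. easy.
Qed.

(** One-sided vanishing determines all Taylor coefficients, one after the other. *)
Lemma identity_left (f1 f2 : C -> C) (w v : C) (s0 : R) :
  analytic_at f1 w -> analytic_at f2 w -> v <> 0 -> (0 < s0)%R ->
  (forall s, (0 < s < s0)%R -> f1 (w + RtoC (- s) * v) = f2 (w + RtoC (- s) * v)) ->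
  exists r, (0 < r)%R /\
    forall s, (Rabs s < r)%R -> f1 (w + RtoC s * v) = f2 (w + RtoC s * v).
Proof.
  intros (r1 & a1 & Hr1 & H1) (r2 & a2 & Hr2 & H2) Hv Hs0 H.
  pose proof (proj1 (Cmod_gt_0 v) Hv) as Hv0.
  set (r := (Rmin r1 r2 / Cmod v)%R).
  assert (Hr : (0 < r)%R) by (apply Rdiv_lt_0_compat; [apply Rmin_pos|]; easy).
  set (b := fun n => (a1 n - a2 n) * v ^ n).
  assert (Hser : forall s, (Rabs s < r)%R ->
     clim (fun n => lsum (fun k => b k * RtoC s ^ k) (seq 0 (S n)))
       (f1 (w + RtoC s * v) - f2 (w + RtoC s * v))).
  { intros s Hs.
    assert (Hlt : (Cmod (w + RtoC s * v - w) < Rmin r1 r2)%R).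
    { replace (w + RtoC s * v - w) with (RtoC s * v) by ring. rewrite Cmod_mult, Cmod_R.
      replace (Rmin r1 r2) with (r * Cmod v)%R by (unfold r; field; lra).
      apply Rmult_lt_compat_r; easy. }
    specialize (H1 _ (Rlt_le_trans _ _ _ Hlt (Rmin_l _ _))).
    specialize (H2 _ (Rlt_le_trans _ _ _ Hlt (Rmin_r _ _))).
    apply is_series_clim in H1. apply is_series_clim in H2.
    apply (clim_mult _ _ _ _ (clim_const (-(1)))) in H2.
    pose proof (clim_plus _ _ _ _ H1 H2) as H3.
    replace (f1 (w + RtoC s * v) - f2 (w + RtoC s * v)) with
      (f1 (w + RtoC s * v) + -(1) * f2 (w + RtoC s * v)) by ring.
    apply (clim_ext _ _ _) with (2 := H3). intros n.
    rewrite <- lsum_scal, <- lsum_plus. apply lsum_ext_in. intros k _. unfold b.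
    replace (w + RtoC s * v - w) with (v * RtoC s) by ring. rewrite Cpow_mult_l. ring. }
  assert (Hb : forall n, b n = 0).
  { apply (power_series_coef b (Rmin r s0)); [apply Rmin_pos; easy|]. intros s Hs.
    pose proof (Rmin_l r s0). pose proof (Rmin_r r s0).
    assert (Hs1 : (Rabs (- s) < r)%R) by (rewrite Rabs_Ropp, Rabs_pos_eq; lra).
    specialize (Hser _ Hs1). rewrite H in Hser by lra.
    match type of Hser with clim _ ?l => replace l with (RtoC 0) in Hser by ring end.
    exact Hser. }
  exists r. split; [easy|]. intros s Hs. specialize (Hser s Hs).
  assert (E : clim (fun n => lsum (fun k => b k * RtoC s ^ k) (seq 0 (S n))) 0).
  { apply (clim_ext (fun _ => 0)); [|apply clim_const]. intros n.
    rewrite (lsum_ext_in _ (fun _ => 0 * 0)); [rewrite lsum_scal; ring|].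
    intros k _. rewrite Hb. ring. }
  apply Ceq_minus. apply (clim_unique _ _ _ Hser E).
Qed.

(** The supremum of the parameters up to which f1 and f2 agree can be passed by
    [identity_left], unless it is 1. *)
Lemma identity_segment (f1 f2 : C -> C) (w v : C) (e : R) :
  v <> 0 -> (0 < e)%R ->
  (forall s, (0 <= s <= 1)%R -> analytic_at f1 (w + RtoC s * v) /\ analytic_at f2 (w + RtoC s * v)) ->
  (forall s, (0 <= s < e)%R -> f1 (w + RtoC s * v) = f2 (w + RtoC s * v)) ->
  f1 (w + v) = f2 (w + v).
Proof.
  intros Hv He Han H0.
  set (E := fun t => (0 <= t <= 1)%R /\
     forall s, (0 <= s <= t)%R -> f1 (w + RtoC s * v) = f2 (w + RtoC s * v)).
  destruct (completeness E) as [T [HT1 HT2]].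
  { exists 1%R. intros t [Ht _]; lra. }
  { exists 0%R. split; [lra|]. intros s Hs. apply H0. lra. }
  assert (HTe : (Rmin (e / 2) 1 <= T)%R).
  { apply HT1. pose proof (Rmin_l (e / 2) 1). pose proof (Rmin_r (e / 2) 1).
    split; [split; [apply Rmin_glb; lra|easy]|]. intros s Hs. apply H0. lra. }
  assert (HT0 : (0 < T)%R).
  { eapply Rlt_le_trans; [|apply HTe]. apply Rmin_pos; lra. }
  assert (HTl : (T <= 1)%R) by (apply HT2; intros t [Ht _]; lra).
  assert (Hbelow : forall s, (0 <= s < T)%R -> f1 (w + RtoC s * v) = f2 (w + RtoC s * v)).
  { intros s Hs. apply NNPP. intros Hn.
    assert (T <= s)%R; [|lra]. apply HT2. intros t [Ht Hts].
    apply Rnot_lt_le. intros Hlt. apply Hn, Hts. lra. }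
  destruct (Han T ltac:(lra)) as [A1 A2].
  destruct (identity_left f1 f2 _ v T A1 A2 Hv HT0) as (r & Hr & Hloc).
  { intros s Hs. replace (w + RtoC T * v + RtoC (- s) * v) with (w + RtoC (T - s) * v)
      by (rewrite RtoC_minus, RtoC_opp; ring). apply Hbelow; lra. }
  assert (Hloc' : forall s, (Rabs (s - T) < r)%R -> f1 (w + RtoC s * v) = f2 (w + RtoC s * v)).
  { intros s Hs. specialize (Hloc _ Hs).
    replace (w + RtoC T * v + RtoC (s - T) * v) with (w + RtoC s * v) in Hloc
      by (rewrite RtoC_minus; ring). exact Hloc. }
  assert (HT : T = 1%R).
  { apply Rle_antisym; [easy|]. apply Rnot_lt_le. intros Hlt.
    set (t := Rmin 1 (T + r / 2)).
    assert (t <= T)%R.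
    { apply HT1. pose proof (Rmin_l 1 (T + r / 2)). pose proof (Rmin_r 1 (T + r / 2)).
      split; [split; [apply Rmin_glb; lra|easy]|]. intros s Hs.
      destruct (Rlt_or_le s T); [apply Hbelow; lra|]. apply Hloc'. fold t in H1.
      rewrite Rabs_pos_eq; lra. }
    unfold t, Rmin in H. destruct (Rle_dec 1 (T + r / 2)); lra. }
  specialize (Hloc' 1%R). rewrite HT in Hloc'.
  replace (w + v) with (w + 1 * v) by ring. apply Hloc'.
  replace (1 - 1)%R with 0%R by ring. rewrite Rabs_R0. easy.
Qed.

Lemma nonreal_regular (P : R) (z : C) : Im z <> 0%R -> phi21_regular (RtoC P) z.
Proof.
  intros Hz k E. rewrite <- RtoC_pow in E.
  pose proof (f_equal Re E) as E1. pose proof (f_equal Im E) as E2.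
  rewrite re_scal_r in E1. rewrite im_scal_r in E2. simpl in E1, E2.
  apply Rmult_integral in E2. destruct E2 as [E2|E2]; [easy|].
  rewrite E2, Rmult_0_r in E1. lra.
Qed.

(** The poles lie on the real line, so every non-real point is joined to 0 by a
    segment without poles.  A real regular z is then reached by the vertical segment from
    z + i. *)
Lemma continuation_unique (P : R) (A B D : C) (f1 f2 : C -> C) :
  is_phi21_continuation A B D (RtoC P) f1 -> is_phi21_continuation A B D (RtoC P) f2 ->
  forall z, phi21_regular (RtoC P) z -> f1 z = f2 z.
Proof.
  intros [Ha1 Hb1] [Ha2 Hb2].
  assert (Hnr : forall z, Im z <> 0%R -> f1 z = f2 z).
  { intros z Hz.
    assert (Hz0 : z <> 0) by (intros E; apply Hz; rewrite E; easy).
    pose proof (proj1 (Cmod_gt_0 z) Hz0) as Hz1.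
    assert (Hd : forall z, (Cmod z < 1)%R -> f1 z = f2 z) by (intros z' Hz'; rewrite Hb1, Hb2; easy).
    assert (Hr0 : phi21_regular (RtoC P) 0).
    { intros k E. rewrite Cmult_0_l in E. apply C1_nz. easy. }
    replace z with (0 + z) by ring. apply (identity_segment f1 f2 0 z (/ Cmod z)).
    - easy.
    - apply Rinv_0_lt_compat; easy.
    - intros s Hs. rewrite Cplus_0_l.
      assert (Hreg : phi21_regular (RtoC P) (RtoC s * z)).
      { destruct (Req_dec s 0) as [->|Hs']; [rewrite Cmult_0_l; exact Hr0|].
        apply nonreal_regular. rewrite im_scal_l. apply Rmult_integral_contrapositive; easy. }
      split; auto.
    - intros s Hs. rewrite Cplus_0_l. apply Hd. rewrite Cmod_mult, Cmod_R, Rabs_pos_eq by lra.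
      apply Rlt_le_trans with (/ Cmod z * Cmod z)%R; [apply Rmult_lt_compat_r; lra|].
      right; field; lra. }
  intros z Hz. destruct (Req_dec (Im z) 0) as [Him|Him]; [|apply Hnr, Him].
  assert (Him' : forall s, Im (z + Ci + RtoC s * (- Ci)) = (1 - s)%R).
  { intros s. unfold Im in *. destruct z as [zr zi]. simpl in *. rewrite Him. ring. }
  replace z with ((z + Ci) + (- Ci)) by ring.
  apply (identity_segment f1 f2 (z + Ci) (- Ci) 1).
  - intros E. apply Ci_nz. transitivity (- - Ci); [ring|rewrite E; ring].
  - lra.
  - intros s Hs. destruct (Req_dec s 1) as [->|Hs1].
    + replace (z + Ci + RtoC 1 * (- Ci)) with z by ring. auto.
    + assert (phi21_regular (RtoC P) (z + Ci + RtoC s * (- Ci))); [|split; auto].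
      apply nonreal_regular. rewrite Him'. lra.
  - intros s Hs. apply Hnr. rewrite Him'. lra.
Qed.

(** * Partial fractions of 2phi1 *)

Definition degree2 (x : nat * nat) : nat := (fst x + snd x)%nat.

(** The Taylor coefficients of H, as the product of the q-binomial series of
    (pw)_oo / (Aw)_oo and of (Dw)_oo / (Bw)_oo. *)
Definition phi21_coef (A B D p : C) (x : nat * nat) : C :=
  qpoch_inf A p * qpoch_inf B p / (qpoch_inf p p * qpoch_inf D p) *
  (qbin (p / A) p (fst x) * A ^ fst x * (qbin (D / B) p (snd x) * B ^ snd x)).

Lemma phi21_coef_abs_summable (A B D p w : C) : (Cmod p < 1)%R -> (Cmod (A * w) < 1)%R -> (Cmod (B * w) < 1)%R ->
  abs_summable (fun x => phi21_coef A B D p x * w ^ degree2 x).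
Proof.
  intros Hp HA HB.
  pose proof (abs_summable_pair _ _ (abs_summable_qbin (p / A) p (A * w) Hp HA) (abs_summable_qbin (D / B) p (B * w) Hp HB)) as H.
  apply (abs_summable_scal (qpoch_inf A p * qpoch_inf B p / (qpoch_inf p p * qpoch_inf D p))) in H.
  eapply abs_summable_ext; [|apply H]. intros [i j]. unfold phi21_coef, degree2. cbn [fst snd].
  rewrite Cpow_add_r, !Cpow_mult_l. ring.
Qed.

Lemma phi21_coef_series (A B D p w : C) : A <> 0 -> B <> 0 ->
  (Cmod p < 1)%R -> (Cmod (A * w) < 1)%R -> (Cmod (B * w) < 1)%R ->
  weighted_series (phi21_coef A B D p) degree2 w =
    qpoch_inf A p * qpoch_inf B p / (qpoch_inf p p * qpoch_inf D p) *
    (qpoch_inf (p * w) p / qpoch_inf (A * w) p * (qpoch_inf (D * w) p / qpoch_inf (B * w) p)).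
Proof.
  intros HA0 HB0 Hp HA HB.
  pose proof (abs_summable_qbin (p / A) p (A * w) Hp HA) as H1. pose proof (abs_summable_qbin (D / B) p (B * w) Hp HB) as H2.
  replace (p * w) with (p / A * (A * w)) by (field; easy).
  replace (D * w) with (D / B * (B * w)) by (field; easy).
  rewrite <- !q_binomial by easy. rewrite <- tsum_pair by easy.
  rewrite <- tsum_scal by (apply (abs_summable_pair _ _ H1 H2)).
  apply tsum_ext. intros [i j]. unfold phi21_coef, degree2. cbn [fst snd]. rewrite Cpow_add_r, !Cpow_mult_l. ring.
Qed.

(** The shift by p^m moves m factors out of each infinite product; with w = 1
    this yields the 2phi1 coefficients, with other w half of the 4phi3 terms. *)
Lemma phi21_coef_series_shift (A B D p w : C) m : A <> 0 -> B <> 0 ->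
  (Cmod p < 1)%R -> (Cmod (A * w) < 1)%R -> (Cmod (B * w) < 1)%R ->
  (forall k, p * w * p ^ k <> 1) -> (forall k, D * w * p ^ k <> 1) ->
  weighted_series (phi21_coef A B D p) degree2 (w * p ^ m) =
    qpoch_inf A p * qpoch_inf B p / (qpoch_inf p p * qpoch_inf D p) *
    (qpoch_inf (p * w) p * qpoch_inf (D * w) p / (qpoch_inf (A * w) p * qpoch_inf (B * w) p)) *
    (qpoch (A * w) p m * qpoch (B * w) p m / (qpoch (p * w) p m * qpoch (D * w) p m)).
Proof.
  intros HA0 HB0 Hp HA HB H1 H2.
  assert (HAm : (Cmod (A * w * p ^ m) < 1)%R) by (apply Cmod_pow_lt1; easy).
  assert (HBm : (Cmod (B * w * p ^ m) < 1)%R) by (apply Cmod_pow_lt1; easy).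
  rewrite phi21_coef_series by (rewrite ?Cmult_assoc; easy). rewrite !Cmult_assoc.
  rewrite (qpoch_inf_split (A * w) p m), (qpoch_inf_split (B * w) p m),
    (qpoch_inf_split (p * w) p m), (qpoch_inf_split (D * w) p m) by easy.
  pose proof (qpoch_inf_nz _ p Hp (small_regular _ p Hp HAm)).
  pose proof (qpoch_inf_nz _ p Hp (small_regular _ p Hp HBm)).
  pose proof (qpoch_nz _ p m (small_regular _ p Hp HA)).
  pose proof (qpoch_nz _ p m (small_regular _ p Hp HB)).
  pose proof (qpoch_nz _ p m H1). pose proof (qpoch_nz _ p m H2).
  set (kk := qpoch_inf A p * qpoch_inf B p / (qpoch_inf p p * qpoch_inf D p)).
  field. repeat split; easy.
Qed.

Lemma phi21_coef_series_pow (A B D p : C) m : A <> 0 -> B <> 0 ->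
  (Cmod p < 1)%R -> (Cmod A < 1)%R -> (Cmod B < 1)%R -> (forall k, D * p ^ k <> 1) ->
  weighted_series (phi21_coef A B D p) degree2 (p ^ m) = qpoch A p m * qpoch B p m / (qpoch p p m * qpoch D p m).
Proof.
  intros HA0 HB0 Hp HA HB HD.
  pose proof (phi21_coef_series_shift A B D p 1 m) as H. rewrite !Cmult_1_r, Cmult_1_l in H.
  pose proof (small_regular p p Hp Hp) as Hpp.
  rewrite H by easy.
  pose proof (qpoch_inf_nz _ p Hp Hpp). pose proof (qpoch_inf_nz _ p Hp HD).
  pose proof (qpoch_inf_nz _ p Hp (small_regular A p Hp HA)).
  pose proof (qpoch_inf_nz _ p Hp (small_regular B p Hp HB)).
  pose proof (qpoch_nz _ p m Hpp). pose proof (qpoch_nz _ p m HD).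
  field. repeat split; easy.
Qed.

Lemma phi21_coef_abs_summable_1 (A B D p : C) : (Cmod p < 1)%R -> (Cmod A < 1)%R -> (Cmod B < 1)%R -> abs_summable (phi21_coef A B D p).
Proof.
  intros Hp HA HB. pose proof (phi21_coef_abs_summable A B D p 1 Hp) as H. rewrite !Cmult_1_r in H.
  apply (abs_summable_ext _ (phi21_coef A B D p)) in H; try easy. intros x. cbv beta. rewrite Cpow_1_l. ring.
Qed.

Lemma partial_fractions_continuation (A B D p : C) : A <> 0 -> B <> 0 ->
  (Cmod p < 1)%R -> (Cmod A < 1)%R -> (Cmod B < 1)%R -> (forall k, D * p ^ k <> 1) ->
  is_phi21_continuation A B D p (partial_fractions p (phi21_coef A B D p) degree2).
Proof.
  intros HA0 HB0 Hp HA HB HD. pose proof (phi21_coef_abs_summable_1 A B D p Hp HA HB) as Hab. split.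
  - intros w Hw. apply partial_fractions_analytic; easy.
  - intros z Hz. destruct (partial_fractions_power_series p z (phi21_coef A B D p) degree2 Hp Hz Hab) as [H1 H2].
    assert (E : forall n, weighted_series (phi21_coef A B D p) degree2 (p ^ n) * z ^ n = bhyp_term [A; B] [D] p z n).
    { intros n. rewrite phi21_coef_series_pow by easy. unfold bhyp_term, qpochs. simpl fold_right.
      rewrite !Cmult_1_r. easy. }
    rewrite <- H2. unfold bhyp. rewrite CSeries_tsum.
    + apply tsum_ext, E.
    + apply (abs_summable_ext _ _ E), H1.
Qed.

Lemma phi21_partial_fractions (P : R) (A B D p z : C) : (0 < P < 1)%R -> p = RtoC P -> A <> 0 -> B <> 0 ->
  (Cmod A < 1)%R -> (Cmod B < 1)%R -> (forall k, D * p ^ k <> 1) -> phi21_regular p z ->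
  phi21 A B D p z = partial_fractions p (phi21_coef A B D p) degree2 z.
Proof.
  intros HP -> HA0 HB0 HA HB HD Hz.
  assert (Hp : (Cmod (RtoC P) < 1)%R) by (rewrite Cmod_R, Rabs_pos_eq; lra).
  pose proof (partial_fractions_continuation A B D (RtoC P) HA0 HB0 Hp HA HB HD) as Hc.
  apply (continuation_unique P A B D); [|exact Hc|exact Hz].
  unfold phi21. apply epsilon_spec. eexists; exact Hc.
Qed.

(** The moments are H(p^(-j)), and (p^(1-j); p)_oo = 0 for j >= 1. *)
Lemma phi21_coef_decay (A B D p c : C) (r : R) : p <> 0 -> A <> 0 -> B <> 0 ->
  (Cmod p < 1)%R -> (0 < r)%R -> c <> 0 -> avoids_powers p c ->
  (Cmod A < 1)%R -> (Cmod B < 1)%R -> (Cmod A * r < 1)%R -> (Cmod B * r < 1)%R ->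
  exists M rho, (0 < rho)%R /\ (rho * r < 1)%R /\ forall n,
    (Cmod (partial_fractions p (phi21_coef A B D p) degree2 (c * / p ^ n)) <= M * rho ^ n)%R.
Proof.
  intros Hp0 HA0 HB0 Hp Hr Hc HR HA HB HAr HBr.
  set (al := Rmax (Cmod A) (Cmod B)).
  assert (Hal0 : (0 < al)%R).
  { eapply Rlt_le_trans; [apply (proj1 (Cmod_gt_0 A) HA0)|apply Rmax_l]. }
  assert (Hal1 : (al < Rmin 1 (/ r))%R).
  { assert (H : forall z, (z < 1)%R -> (z * r < 1)%R -> (z < Rmin 1 (/ r))%R).
    { intros z H1 H2. apply Rmin_glb_lt; [easy|].
      apply Rmult_lt_reg_r with r; [easy|]. rewrite Rinv_l; lra. }
    unfold al. apply Rmax_lub_lt; apply H; easy. }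
  set (rho := ((al + Rmin 1 (/ r)) / 2)%R).
  assert (Hrho : (al < rho < Rmin 1 (/ r))%R) by (unfold rho; lra).
  pose proof (Rmin_l 1 (/ r)). pose proof (Rmin_r 1 (/ r)).
  assert (HAl : (Cmod A <= al)%R) by apply Rmax_l.
  assert (HBl : (Cmod B <= al)%R) by apply Rmax_r.
  assert (Hdiv : forall z s : R, (0 < s)%R -> (z < s)%R -> (z * / s < 1)%R).
  { intros z s Hs Hzs. apply Rmult_lt_reg_r with s; [easy|].
    rewrite Rmult_assoc, Rinv_l by lra. lra. }
  destruct (partial_fractions_decay p c (phi21_coef A B D p) degree2 rho) as (M & HM & HB'); try easy.
  - lra.
  - apply phi21_coef_abs_summable_1; easy.
  - assert (Hir : Cmod (RtoC (/ rho)) = (/ rho)%R).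
    { rewrite Cmod_R, Rabs_pos_eq; [easy|]. left; apply Rinv_0_lt_compat; lra. }
    pose proof (phi21_coef_abs_summable A B D p (RtoC (/ rho)) Hp) as HAB.
    rewrite !Cmod_mult, Hir in HAB.
    eapply bounded_sums_le; [|apply HAB; apply Hdiv; lra].
    intros x. cbv beta. rewrite Cmod_mult, Cmod_pow, Hir, pow_inv. lra.
  - intros j Hj Hpj.
    assert (Hlt : forall z, (Cmod z < rho)%R -> (Cmod (z * / p ^ j) < 1)%R).
    { intros z Hz. rewrite Cmod_mult, Cmod_inv, Cmod_pow by (apply Cpow_nz; easy).
      apply Hdiv; lra. }
    rewrite phi21_coef_series by (try easy; apply Hlt; lra).
    rewrite (qpoch_inf_zero (p * / p ^ j) p (j - 1) Hp).
    2:{ destruct j as [|j]; [lia|]. simpl. rewrite Nat.sub_0_r.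
        pose proof (Cpow_nz p j Hp0). field; auto. }
    unfold Cdiv. ring.
  - exists M, rho. split; [lra|]. split; [|easy].
    apply Rlt_le_trans with (/ r * r)%R; [apply Rmult_lt_compat_r; lra|]. right; field; lra.
Qed.

Lemma qpoch_bounded (p x : C) : (Cmod p < 1)%R -> exists M, forall n, (Cmod (qpoch x p n) <= M)%R.
Proof. intros Hp. eexists. intros n. apply qpoch_bound, Hp. Qed.

Lemma abs_summable_phi43 (A1 A2 A3 A4 B1 B2 B3 p : C) : (Cmod p < 1)%R ->
  (forall k, B1 * p ^ k <> 1) -> (forall k, B2 * p ^ k <> 1) -> (forall k, B3 * p ^ k <> 1) ->
  abs_summable (bhyp_term [A1; A2; A3; A4] [B1; B2; B3] p p).
Proof.
  intros Hp H1 H2 H3. pose proof (small_regular p p Hp Hp) as H0.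
  assert (Hm : forall f g : nat -> C, (exists M, forall n, (Cmod (f n) <= M)%R) -> abs_summable g ->
            abs_summable (fun n => f n * g n)).
  { intros f g [M HM] Hg. apply (abs_summable_mul_bounded _ _ M HM Hg). }
  pose proof (abs_summable_geom p Hp) as HG.
  apply (Hm _ _ (qpoch_inv_bound p p Hp H0)) in HG.
  apply (Hm _ _ (qpoch_inv_bound B1 p Hp H1)) in HG.
  apply (Hm _ _ (qpoch_inv_bound B2 p Hp H2)) in HG.
  apply (Hm _ _ (qpoch_inv_bound B3 p Hp H3)) in HG.
  apply (Hm _ _ (qpoch_bounded p A1 Hp)) in HG.
  apply (Hm _ _ (qpoch_bounded p A2 Hp)) in HG.
  apply (Hm _ _ (qpoch_bounded p A3 Hp)) in HG.
  apply (Hm _ _ (qpoch_bounded p A4 Hp)) in HG.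
  eapply abs_summable_ext; [|apply HG]. intros n. cbv beta. unfold bhyp_term, qpochs. simpl fold_right.
  pose proof (qpoch_nz _ p n H0). pose proof (qpoch_nz _ p n H1).
  pose proof (qpoch_nz _ p n H2). pose proof (qpoch_nz _ p n H3). field. repeat split; easy.
Qed.

Lemma theta_inv (x p : C) : p <> 0 -> x <> 0 -> theta (p / x) p = theta x p.
Proof.
  intros Hp Hx. unfold theta. replace (p / (p / x)) with x by (field; auto). ring.
Qed.

(** * The bilateral sum of products of two 2phi1 *)

Section General.
Context (p A B D A' B' D' X zt : C).
Context (Hp0 : p <> 0) (Hp : (Cmod p < 1)%R) (HA0 : A <> 0) (HB0 : B <> 0)
  (HA0' : A' <> 0) (HB0' : B' <> 0) (HX : X <> 0) (Hz : zt <> 0) (HR : avoids_powers p X)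
  (HA : (Cmod A < 1)%R) (HB : (Cmod B < 1)%R) (HA' : (Cmod A' < 1)%R) (HB' : (Cmod B' < 1)%R)
  (HAz : (Cmod (A * zt) < 1)%R) (HBz : (Cmod (B * zt) < 1)%R)
  (HAz' : (Cmod (A' / zt) < 1)%R) (HBz' : (Cmod (B' / zt) < 1)%R).

Let F := partial_fractions p (phi21_coef A B D p) degree2.
Let G := partial_fractions p (phi21_coef A' B' D' p) degree2.

(** For n tending to +oo the factor F decays and G is bounded, for n tending to
    -oo the roles are exchanged; the rates beat the growth of zt^n because A zt,
    B zt, A'/zt and B'/zt lie in the unit disc. *)
Lemma bilateral_phi21_abs_summable :
  abs_summable (fun n => F (/ X * CpowerZ p (1 - n)) * G (X * CpowerZ p n) * CpowerZ zt n).
Proof.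
  pose proof (proj1 (Cmod_gt_0 zt) Hz) as Hz0.
  assert (HX' : / X <> 0).
  { intros E. apply C1_nz. transitivity (X * / X); [field; easy|rewrite E; ring]. }
  pose proof (avoids_powers_inv p X Hp0 HX HR) as HR'.
  assert (HRp : avoids_powers p (/ X * p)).
  { pose proof (avoids_powers_scale p (/ X) 1 Hp0 HR') as H. rewrite CpowerZ_1 in H. exact H. }
  pose proof (phi21_coef_abs_summable_1 A B D p Hp HA HB) as Hg. pose proof (phi21_coef_abs_summable_1 A' B' D' p Hp HA' HB') as Hh.
  destruct (partial_fractions_bounded p (/ X) _ degree2 Hp0 Hp HX' HR' Hg) as [M1 K1].
  destruct (partial_fractions_bounded p X _ degree2 Hp0 Hp HX HR Hh) as [M2 K2].
  destruct (phi21_coef_decay A B D p (/ X * p) (Cmod zt)) as (M3 & r3 & Hr3 & Hr3' & K3); try easy.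
  { apply Cmult_neq_0; easy. }
  { rewrite <- Cmod_mult; easy. }
  { rewrite <- Cmod_mult; easy. }
  destruct (phi21_coef_decay A' B' D' p X (Cmod (/ zt))) as (M4 & r4 & Hr4 & Hr4' & K4); try easy.
  { rewrite Cmod_inv by easy. apply Rinv_0_lt_compat; easy. }
  { rewrite <- Cmod_mult; easy. }
  { rewrite <- Cmod_mult; easy. }
  apply bounded_sums_Z.
  - intros; apply Cmod_ge_0.
  - apply (bounded_sums_le _ (fun n => (M3 * M2) * (r3 * Cmod zt) ^ n)%R).
    + intros n. rewrite !Cmod_mult, (CpowerZ_nat zt), Cmod_pow, Rpow_mult_distr.
      replace (/ X * CpowerZ p (1 - Z.of_nat n)) with (/ X * p * / p ^ n).
      2:{ unfold Z.sub. rewrite CpowerZ_add, CpowerZ_neg_nat, CpowerZ_1 by easy. ring. }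
      specialize (K3 n). specialize (K2 (Z.of_nat n)).
      replace (M3 * M2 * (r3 ^ n * Cmod zt ^ n))%R with (M3 * r3 ^ n * M2 * Cmod zt ^ n)%R by ring.
      apply Rmult_le_compat_r; [apply pow_le; lra|].
      apply Rmult_le_compat; try apply Cmod_ge_0; easy.
    + apply bounded_sums_scal.
      * assert (0 <= M3)%R.
        { specialize (K3 O). simpl in K3. rewrite Rmult_1_r in K3.
          eapply Rle_trans; [apply Cmod_ge_0|apply K3]. }
        assert (0 <= M2)%R by (eapply Rle_trans; [apply Cmod_ge_0|apply (K2 0%Z)]).
        apply Rmult_le_pos; easy.
      * apply bounded_sums_geom. split; [|easy]. apply Rmult_le_pos; lra.
  - apply (bounded_sums_le _ (fun n => (M1 * M4) * (r4 * Cmod (/ zt)) ^ n)%R).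
    + intros n. rewrite !Cmod_mult, (CpowerZ_neg_nat p), (CpowerZ_neg_nat zt), Rpow_mult_distr.
      rewrite <- (Cpow_inv zt), Cmod_pow by easy.
      specialize (K4 n). specialize (K1 (1 - - Z.of_nat n)%Z).
      replace (M1 * M4 * (r4 ^ n * Cmod (/ zt) ^ n))%R with (M1 * (M4 * r4 ^ n) * Cmod (/ zt) ^ n)%R by ring.
      apply Rmult_le_compat_r; [apply pow_le, Cmod_ge_0|].
      apply Rmult_le_compat; try apply Cmod_ge_0; easy.
    + apply bounded_sums_scal.
      * assert (0 <= M4)%R.
        { specialize (K4 O). simpl in K4. rewrite Rmult_1_r in K4.
          eapply Rle_trans; [apply Cmod_ge_0|apply K4]. }
        assert (0 <= M1)%R by (eapply Rle_trans; [apply Cmod_ge_0|apply (K1 0%Z)]).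
        apply Rmult_le_pos; easy.
      * apply bounded_sums_geom. split; [|easy]. apply Rmult_le_pos; [lra|apply Cmod_ge_0].
Qed.

Context (HD : forall k, D * p ^ k <> 1) (HD' : forall k, D' * p ^ k <> 1)
  (HDz : forall k, D * zt * p ^ k <> 1) (HDz' : forall k, D' / zt * p ^ k <> 1)
  (Hpz : forall k, p * zt * p ^ k <> 1) (Hpz' : forall k, p / zt * p ^ k <> 1)
  (Hzt : qpoch_inf zt p <> 0).

(** [bilateral_sum] with H1 and H2 evaluated on the four geometric progressions;
    theta(zt) is simplified with (zt)_oo = (1 - zt) (p zt)_oo and
    (1/zt)_oo = (1 - 1/zt) (p/zt)_oo. *)
Theorem bilateral_phi21_sum :
  tsum (fun n => F (/ X * CpowerZ p (1 - n)) * G (X * CpowerZ p n) * CpowerZ zt n)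
  = qpoch_inf p p * qpoch_inf (D' / zt) p * qpoch_inf A' p * qpoch_inf B' p *
      theta (p / (X * zt)) p /
      (qpoch_inf zt p * qpoch_inf D' p * qpoch_inf (A' / zt) p * qpoch_inf (B' / zt) p * theta X p) *
      phi43 A B (A' / zt) (B' / zt) D (D' / zt) (p / zt) p p
    + qpoch_inf p p * qpoch_inf (D * zt) p * qpoch_inf A p * qpoch_inf B p *
      theta (p / (X * zt)) p /
      (qpoch_inf D p * qpoch_inf (1 / zt) p * qpoch_inf (A * zt) p * qpoch_inf (B * zt) p * theta X p) *
      phi43 (A * zt) (B * zt) A' B' (D * zt) D' (p * zt) p p.
Proof.
  pose proof (phi21_coef_abs_summable_1 A B D p Hp HA HB) as Hg. pose proof (phi21_coef_abs_summable_1 A' B' D' p Hp HA' HB') as Hh.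
  pose proof (small_regular p p Hp Hp) as Hpp.
  assert (HXz : X * zt <> 0) by (apply Cmult_neq_0; easy).
  pose proof (bilateral_sum (phi21_coef A B D p) degree2 (phi21_coef A' B' D' p) degree2 p X Hp0 Hp HX HR zt Hz Hg Hh
    (phi21_coef_abs_summable A B D p zt Hp HAz HBz) (phi21_coef_abs_summable A' B' D' p (/ zt) Hp HAz' HBz') bilateral_phi21_abs_summable) as E.
  fold F G in E. set (T := tsum _) in E at 1. fold T.
  rewrite !jacobi_triple_product in E by easy.
  pose proof (theta_recip_0 p X Hp0 Hp HX HR) as EL.
  pose proof (avoids_powers_theta p X Hp0 Hp HX HR) as Hth.
  rewrite <- (theta_inv (X * zt)) in E by easy.
  set (c1 := qpoch_inf A' p * qpoch_inf B' p / (qpoch_inf p p * qpoch_inf D' p) *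
    (qpoch_inf (p / zt) p * qpoch_inf (D' / zt) p / (qpoch_inf (A' / zt) p * qpoch_inf (B' / zt) p))).
  set (c2 := qpoch_inf A p * qpoch_inf B p / (qpoch_inf p p * qpoch_inf D p) *
    (qpoch_inf (p * zt) p * qpoch_inf (D * zt) p / (qpoch_inf (A * zt) p * qpoch_inf (B * zt) p))).
  set (f1 := phi43 A B (A' / zt) (B' / zt) D (D' / zt) (p / zt) p p).
  set (f2 := phi43 (A * zt) (B * zt) A' B' (D * zt) D' (p * zt) p p).
  pose proof (abs_summable_phi43 A B (A' / zt) (B' / zt) D (D' / zt) (p / zt) p Hp HD HDz' Hpz') as HF1.
  pose proof (abs_summable_phi43 (A * zt) (B * zt) A' B' (D * zt) D' (p * zt) p Hp HDz HD' Hpz) as HF2.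
  assert (EP : tsum (fun m : nat => p ^ m * (weighted_series (phi21_coef A B D p) degree2 (p ^ m) * weighted_series (phi21_coef A' B' D' p) degree2 (p ^ m * / zt)
                           - zt * (weighted_series (phi21_coef A B D p) degree2 (zt * p ^ m) * weighted_series (phi21_coef A' B' D' p) degree2 (p ^ m))))
     = c1 * f1 + (- zt * c2) * f2).
  { unfold f1, f2, phi43, bhyp. rewrite !CSeries_tsum by easy.
    rewrite <- !tsum_scal by easy. rewrite <- tsum_plus by (apply abs_summable_scal; easy).
    apply tsum_ext. intros m. rewrite !(phi21_coef_series_pow _ _ _ p m) by easy.
    rewrite (phi21_coef_series_shift A B D p zt m) by easy.
    rewrite (Cmult_comm (p ^ m) (/ zt)). rewrite (phi21_coef_series_shift A' B' D' p (/ zt) m) by easy.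
    fold (Cdiv p zt) (Cdiv D' zt) (Cdiv A' zt) (Cdiv B' zt). fold c1 c2.
    unfold bhyp_term, qpochs. simpl fold_right.
    pose proof (qpoch_nz _ p m Hpp). pose proof (qpoch_nz _ p m HD). pose proof (qpoch_nz _ p m HD').
    pose proof (qpoch_nz _ p m HDz). pose proof (qpoch_nz _ p m HDz').
    pose proof (qpoch_nz _ p m Hpz). pose proof (qpoch_nz _ p m Hpz').
    set (u1 := qpoch (D' / zt) p m) in *. set (u2 := qpoch (p / zt) p m) in *.
    set (u3 := qpoch (A' / zt) p m) in *. set (u4 := qpoch (B' / zt) p m) in *.
    field. repeat split; easy. }
  rewrite EP in E. clear EP.
  assert (S1 : qpoch_inf zt p = (1 - zt) * qpoch_inf (p * zt) p).
  { rewrite (qpoch_inf_split zt p 1 Hp). simpl. rewrite !Cmult_1_r, Cmult_1_l.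
    rewrite (Cmult_comm zt p). easy. }
  assert (S2 : qpoch_inf (1 / zt) p = (1 - 1 / zt) * qpoch_inf (p / zt) p).
  { rewrite (qpoch_inf_split (1 / zt) p 1 Hp). simpl. rewrite !Cmult_1_r, Cmult_1_l.
    replace (1 / zt * p) with (p / zt) by (field; easy). easy. }
  assert (N1 : 1 - zt <> 0).
  { intros E1. apply Hzt. rewrite S1, E1. ring. }
  pose proof (qpoch_inf_nz _ p Hp Hpp). pose proof (qpoch_inf_nz _ p Hp HD).
  pose proof (qpoch_inf_nz _ p Hp HD'). pose proof (qpoch_inf_nz _ p Hp Hpz).
  pose proof (qpoch_inf_nz _ p Hp Hpz').
  pose proof (qpoch_inf_nz _ p Hp (small_regular _ p Hp HAz)).
  pose proof (qpoch_inf_nz _ p Hp (small_regular _ p Hp HBz)).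
  pose proof (qpoch_inf_nz _ p Hp (small_regular _ p Hp HAz')).
  pose proof (qpoch_inf_nz _ p Hp (small_regular _ p Hp HBz')).
  assert (N2 : zt - 1 <> 0).
  { intros E1. apply N1. transitivity (- (zt - 1)); [ring|rewrite E1; ring]. }
  assert (EL' : theta_recip p X 0 = qpoch_inf p p * qpoch_inf p p / theta X p).
  { rewrite <- EL. field; easy. }
  rewrite EL' in E. unfold theta in E at 1.
  apply (Cmult_cancel_l (qpoch_inf p p * (qpoch_inf zt p * qpoch_inf (p / zt) p))).
  { repeat apply Cmult_neq_0; easy. }
  rewrite E. rewrite S2, S1. unfold c1, c2.
  set (t1 := theta (p / (X * zt)) p). set (t2 := theta X p) in *.
  set (u1 := qpoch_inf (D' / zt) p) in *. set (u2 := qpoch_inf (p / zt) p) in *.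
  set (u3 := qpoch_inf (A' / zt) p) in *. set (u4 := qpoch_inf (B' / zt) p) in *.
  field. repeat split; easy.
Qed.

End General.

(** * The corollary *)

Lemma RCpower_add (q : R) (z w : C) : RCpower q (z + w) = RCpower q z * RCpower q w.
Proof.
  unfold RCpower. apply C_ext; cbn [Re Im fst snd Cplus Cmult]; unfold Re, Im;
  rewrite !Rmult_plus_distr_r, exp_plus, ?cos_plus, ?sin_plus; ring.
Qed.

Lemma RCpower_Cmod (q : R) (z : C) : Cmod (RCpower q z) = exp (Re z * ln q).
Proof.
  assert (E : RCpower q z = RtoC (exp (Re z * ln q)) * (cos (Im z * ln q), sin (Im z * ln q))).
  { unfold RCpower. apply C_ext; simpl; ring. }
  rewrite E, Cmod_mult, Cmod_R, Rabs_pos_eq by (left; apply exp_pos).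
  replace (Cmod (cos (Im z * ln q), sin (Im z * ln q))%R) with 1%R; [ring|].
  symmetry. unfold Cmod. simpl fst. simpl snd. rewrite <- sqrt_1. f_equal.
  pose proof (sin2_cos2 (Im z * ln q)) as H. unfold Rsqr in H. lra.
Qed.

Lemma RCpower_nz (q : R) (z : C) : RCpower q z <> 0.
Proof. apply Cmod_gt_0. rewrite RCpower_Cmod. apply exp_pos. Qed.

Lemma RCpower_2 (q : R) : (0 < q)%R -> RCpower q 2 = RtoC q ^ 2.
Proof.
  intros Hq. unfold RCpower. rewrite re_RtoC, im_RtoC, Rmult_0_l, cos_0, sin_0.
  replace (2 * ln q)%R with (ln q + ln q)%R by ring. rewrite exp_plus, exp_ln by easy.
  rewrite <- RtoC_pow. apply C_ext; simpl; ring.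
Qed.

Lemma Cdiv_nz (x y : C) : x <> 0 -> y <> 0 -> x / y <> 0.
Proof.
  intros Hx Hy E. apply Hx. transitivity (x / y * y); [field; easy|rewrite E; ring].
Qed.

Lemma qpochs_inf_nz_In (l : list C) (p : C) : qpochs_inf l p <> 0 ->
  forall x, In x l -> qpoch_inf x p <> 0.
Proof.
  unfold qpochs_inf. induction l as [|h l IH]; simpl; intros H x Hx; [easy|].
  destruct Hx as [<-|Hx].
  - intros E. apply H. rewrite E. ring.
  - apply IH; [|easy]. intros E. apply H. rewrite E. ring.
Qed.

Lemma small_mul (q r1 r2 : R) : (0 < q < 1)%R -> (0 <= r1 <= q)%R -> (0 <= r2 <= q ^ 2)%R ->
  (r1 * r2 * q < 1)%R.
Proof.
  intros Hq H1 H2. assert (q ^ 2 < 1)%R by (simpl; nra).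
  assert (r1 * r2 <= q)%R by nra. nra.
Qed.

Theorem corollary3p15 :
  forall (q : R) (s u t v : C) (lambda eps : R) (x y : C),
  (0 < q < 1)%R ->
  s <> 0 -> u <> 0 -> t <> 0 -> v <> 0 -> x <> 0 -> y <> 0 ->
  (0 < Cmod (u * x) <= q ^ 2)%R -> (0 < Cmod (u / x) <= q ^ 2)%R ->
  (0 < Cmod (v * y) <= q ^ 2)%R -> (0 < Cmod (v / y) <= q ^ 2)%R ->
  (0 < Cmod (s / u) <= q)%R -> (0 < Cmod (t / v) <= q)%R ->
  let p : C := RtoC q ^ 2 in
  let a := s * RCpower q (1 - 2 * Ci * lambda) in
  let b := s * RCpower q (1 + 2 * Ci * lambda) in
  let c := t * v * q / u in
  let d := q * v / (u * t) in
  let kappa := RCpower q (- (1) - 2 * eps + 2 * Ci * lambda) in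
  let a' := s * v * q / u in
  (* all expressions are defined *)
  lower_ok [a * b] p -> lower_ok [c * p / d] p ->
  (forall n : Z, phi21_regular p (kappa * CpowerZ q (2 - 2 * n))) ->
  (forall n : Z, phi21_regular p (CpowerZ q (2 * n) / kappa)) ->
  lower_ok [a * b; a * c; a * d] p ->
  lower_ok [p * b / d; p * c / d; RtoC q ^ 4 / (a * d)] p ->
  qpochs_inf [p / (a * d); c * p / d; a' * y; a' / y] p <> 0 ->
  qpochs_inf [a * b; a * d / p; p * x / d; p / (x * d)] p <> 0 ->
  theta (1 / kappa) p <> 0 ->
  is_sumZ
    (fun n : Z =>
       phi21 (a * x) (a / x) (a * b) p (kappa * CpowerZ q (2 - 2 * n)) *
       phi21 (b * c * y / a') (b * c / (y * a')) (c * p / d) p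
             (CpowerZ q (2 * n) / kappa) *
       CpowerZ (p / (a * d)) n)
    (qpochs_inf [p; a * c; b * c * y / a'; b * c / (y * a')] p *
       theta (a * d * kappa) p /
     (qpochs_inf [p / (a * d); c * p / d; a' * y; a' / y] p *
       theta (1 / kappa) p) *
     phi43 (a * x) (a / x) (a' * y) (a' / y) (a * b) (a * c) (a * d) p p
     +
     qpochs_inf [p; p * b / d; a * x; a / x] p * theta (a * d * kappa) p /
     (qpochs_inf [a * b; a * d / p; p * x / d; p / (x * d)] p *
       theta (1 / kappa) p) *
     phi43 (p * x / d) (p / (d * x)) (b * c * y / a') (b * c / (y * a'))
           (p * b / d) (p * c / d) (RtoC q ^ 4 / (a * d)) p p).
Proof.
  intros q s u t v lambda eps x y Hq Hs Hu Ht Hv Hx Hy Hux Hux' Hvy Hvy' Hsu Htv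
    p a b c d kappa a' L1 L2 R1 R2 L3 L4 N1 _ _.
  set (ea := RCpower q (1 - 2 * Ci * lambda)) in *.
  set (eb := RCpower q (1 + 2 * Ci * lambda)) in *.
  assert (Hq0 : RtoC q <> 0) by (intros E; apply RtoC_inj in E; lra).
  assert (Hp0 : p <> 0) by (apply Cpow_nz; easy).
  assert (HpR : p = RtoC (q ^ 2)) by (unfold p; rewrite RtoC_pow; easy).
  assert (HP : (0 < q ^ 2 < 1)%R) by (simpl; nra).
  assert (Hp1 : (Cmod p < 1)%R) by (rewrite HpR, Cmod_R, Rabs_pos_eq; lra).
  assert (Hea : Cmod ea = q).
  { unfold ea. rewrite RCpower_Cmod.
    replace (Re (1 - 2 * Ci * lambda)) with 1%R by (simpl; ring). rewrite Rmult_1_l. apply exp_ln; lra. }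
  assert (Heb : Cmod eb = q).
  { unfold eb. rewrite RCpower_Cmod.
    replace (Re (1 + 2 * Ci * lambda)) with 1%R by (simpl; ring). rewrite Rmult_1_l. apply exp_ln; lra. }
  assert (Hab : ea * eb = p).
  { unfold ea, eb, p. rewrite <- RCpower_add, <- RCpower_2 by lra. f_equal. ring. }
  assert (Hea0 : ea <> 0) by apply RCpower_nz. assert (Heb0 : eb <> 0) by apply RCpower_nz.
  assert (Hk0 : kappa <> 0) by apply RCpower_nz.
  clearbody ea eb kappa.
  assert (Ha0 : a <> 0) by (apply Cmult_neq_0; easy).
  assert (Hb0 : b <> 0) by (apply Cmult_neq_0; easy).
  assert (Hc0 : c <> 0) by (unfold c; apply Cdiv_nz; [repeat apply Cmult_neq_0|]; easy).
  assert (Hd0 : d <> 0) by (unfold d; apply Cdiv_nz; apply Cmult_neq_0; easy).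
  assert (Ha'0 : a' <> 0) by (unfold a'; apply Cdiv_nz; [repeat apply Cmult_neq_0|]; easy).
  assert (Hrel : a' * a' * p = a * b * c * d).
  { unfold a, b. transitivity (s * s * (ea * eb) * c * d); [|ring]. rewrite Hab.
    unfold a', c, d. field. split; easy. }
  (* every upper parameter, also after multiplication or division by zt, has the
     shape (s/u or t/v) (one of ux, u/x, vy, v/y) (a factor of modulus q) *)
  assert (Hsz : forall w w1 w2 e : C, w = w1 * w2 * e -> (0 < Cmod w1 <= q)%R ->
            (0 < Cmod w2 <= q ^ 2)%R -> Cmod e = q -> (Cmod w < 1)%R).
  { intros w w1 w2 e -> H1 H2 He. rewrite !Cmod_mult, He. apply small_mul; lra. }
  assert (Hqm : Cmod (RtoC q) = q) by (rewrite Cmod_R, Rabs_pos_eq; lra).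
  assert (SA : (Cmod (a * x) < 1)%R).
  { refine (Hsz _ (s / u) (u * x) ea _ Hsu Hux Hea). unfold a. field; easy. }
  assert (SB : (Cmod (a / x) < 1)%R).
  { refine (Hsz _ (s / u) (u / x) ea _ Hsu Hux' Hea). unfold a. field; split; easy. }
  assert (SA' : (Cmod (b * c * y / a') < 1)%R).
  { refine (Hsz _ (t / v) (v * y) eb _ Htv Hvy Heb). unfold b, c, a'. field; repeat split; easy. }
  assert (SB' : (Cmod (b * c / (y * a')) < 1)%R).
  { refine (Hsz _ (t / v) (v / y) eb _ Htv Hvy' Heb). unfold b, c, a'. field; repeat split; easy. }
  set (zt := p / (a * d)).
  assert (Hz0 : zt <> 0) by (unfold zt; apply Cdiv_nz; [|apply Cmult_neq_0]; easy).
  assert (EAz : a * x * zt = p * x / d) by (unfold zt; field; split; easy).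
  assert (EBz : a / x * zt = p / (x * d)) by (unfold zt; field; repeat split; easy).
  assert (EDz : a * b * zt = p * b / d) by (unfold zt; field; split; easy).
  assert (EAz' : b * c * y / a' / zt = a' * y).
  { transitivity (a * b * c * d * y / (a' * p)); [unfold zt; field; repeat split; easy|].
    rewrite <- Hrel. field; split; easy. }
  assert (EBz' : b * c / (y * a') / zt = a' / y).
  { transitivity (a * b * c * d / (y * a' * p)); [unfold zt; field; repeat split; easy|].
    rewrite <- Hrel. field; repeat split; easy. }
  assert (EDz' : c * p / d / zt = a * c) by (unfold zt; field; repeat split; easy).
  assert (Epz : p * zt = RtoC q ^ 4 / (a * d)) by (unfold zt, p; field; split; easy).
  assert (Epz' : p / zt = a * d) by (unfold zt; field; repeat split; easy).
  assert (E1z : 1 / zt = a * d / p) by (unfold zt; field; repeat split; easy).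
  assert (SAz : (Cmod (a * x * zt) < 1)%R).
  { rewrite EAz. refine (Hsz _ (t / v) (u * x) q _ Htv Hux Hqm). unfold p, d. field; repeat split; easy. }
  assert (SBz : (Cmod (a / x * zt) < 1)%R).
  { rewrite EBz. refine (Hsz _ (t / v) (u / x) q _ Htv Hux' Hqm). unfold p, d. field; repeat split; easy. }
  assert (SAz' : (Cmod (b * c * y / a' / zt) < 1)%R).
  { rewrite EAz'. refine (Hsz _ (s / u) (v * y) q _ Hsu Hvy Hqm). unfold a'. field; repeat split; easy. }
  assert (SBz' : (Cmod (b * c / (y * a') / zt) < 1)%R).
  { rewrite EBz'. refine (Hsz _ (s / u) (v / y) q _ Hsu Hvy' Hqm). unfold a'. field; repeat split; easy. }
  set (X := 1 / kappa).
  assert (HX0 : X <> 0) by (apply Cdiv_nz; [exact C1_nz|easy]).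
  assert (Ekz : p / (X * zt) = a * d * kappa) by (unfold X, zt; field; repeat split; easy).
  assert (Epow : forall n, CpowerZ q (2 * n) = CpowerZ p n).
  { intros n. rewrite <- CpowerZ_CpZ by easy. easy. }
  assert (EF : forall n, kappa * CpowerZ q (2 - 2 * n) = / X * CpowerZ p (1 - n)).
  { intros n. replace (2 - 2 * n)%Z with (2 * (1 - n))%Z by lia. rewrite Epow.
    f_equal. unfold X. field. easy. }
  assert (EG : forall n, CpowerZ q (2 * n) / kappa = X * CpowerZ p n).
  { intros n. rewrite Epow. unfold X. field. easy. }
  assert (HR : avoids_powers p X).
  { intros n E. specialize (R2 n O). apply R2. rewrite EG. simpl. rewrite Cmult_1_r. easy. }
  assert (HA0 : a * x <> 0) by (apply Cmult_neq_0; easy).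
  assert (HB0 : a / x <> 0) by (apply Cdiv_nz; easy).
  assert (HA0' : b * c * y / a' <> 0) 
    by exact (Cdiv_nz _ _ (Cmult_neq_0 _ _ (Cmult_neq_0 _ _ Hb0 Hc0) Hy) Ha'0).
  assert (HB0' : b * c / (y * a') <> 0)
    by exact (Cdiv_nz _ _ (Cmult_neq_0 _ _ Hb0 Hc0) (Cmult_neq_0 _ _ Hy Ha'0)).
  assert (HD : forall k, a * b * p ^ k <> 1) by (apply L1; simpl; auto).
  assert (HD' : forall k, c * p / d * p ^ k <> 1) by (apply L2; simpl; auto).
  assert (HDz : forall k, a * b * zt * p ^ k <> 1) by (rewrite EDz; apply L4; simpl; auto).
  assert (HDz' : forall k, c * p / d / zt * p ^ k <> 1) by (rewrite EDz'; apply L3; simpl; auto).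
  assert (Hpz : forall k, p * zt * p ^ k <> 1) by (rewrite Epz; apply L4; simpl; auto).
  assert (Hpz' : forall k, p / zt * p ^ k <> 1) by (rewrite Epz'; apply L3; simpl; auto).
  assert (Hzt : qpoch_inf zt p <> 0) by (apply (qpochs_inf_nz_In _ _ N1); simpl; auto).
  pose proof (bilateral_phi21_abs_summable p (a * x) (a / x) (a * b) (b * c * y / a') (b * c / (y * a')) (c * p / d)
    X zt Hp0 Hp1 HA0 HB0 HA0' HB0' HX0 Hz0 HR SA SB SA' SB' SAz SBz SAz' SBz') as GA.
  pose proof (bilateral_phi21_sum p (a * x) (a / x) (a * b) (b * c * y / a') (b * c / (y * a')) (c * p / d)
    X zt Hp0 Hp1 HA0 HB0 HA0' HB0' HX0 Hz0 HR SA SB SA' SB' SAz SBz SAz' SBz'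
    HD HD' HDz HDz' Hpz Hpz' Hzt) as GS.
  apply is_sumZ_tsum in GA. rewrite GS in GA. clear GS.
  match type of GA with is_sumZ ?f1 ?S1 =>
    match goal with |- is_sumZ ?f2 ?S2 =>
      replace f2 with f1; [replace S2 with S1; [exact GA|]|] end end.
  - rewrite EAz, EBz, EDz, EAz', EBz', EDz', Epz, Epz', E1z, Ekz.
    rewrite (Cmult_comm p c), (Cmult_comm d x).
    unfold qpochs_inf. simpl fold_right. rewrite !Cmult_1_r, !Cmult_assoc. easy.
  - apply functional_extensionality. intros n.
    specialize (R1 n). specialize (R2 n). rewrite EF in R1 |- *. rewrite EG in R2 |- *.
    rewrite (phi21_partial_fractions _ (a * x) (a / x) (a * b) p _ HP HpR HA0 HB0 SA SB HD R1).
    rewrite (phi21_partial_fractions _ _ _ _ p _ HP HpR HA0' HB0' SA' SB' HD' R2).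
    reflexivity.
Qed.
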